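(* Let $G$ be a profinite group. A map $f:X\to Y$ in $\hat{\mathcal S}_G$ is a cofibration if and only if it is a level-wise monomorphism and $G$ acts freely on each set $Y_n - f(X_n)$. In particular, an object $X$ of $\hat{\mathcal S}_G$ is cofibrant if and only if $G$ acts freely on each profinite set $X_n$.
   Context: A profinite space is a simplicial object in the category of profinite sets; $\hat{\mathcal S}$ is the category of profinite spaces. For $X\in\hat{\mathcal S}$: $\pi_0X$ is the coequalizer in profinite sets of $d_0,d_1:X_1\rightrightarrows X_0$; $\pi_1(X,x)$ is the profinite group of automorphisms over $(X,x)$ of the universal profinite covering $(\tilde X,x)$ (the limit of the automorphism groups of finite Galois coverings); a local coefficient system $\mathcal M$ on $X$ is a functor from the profinite fundamental groupoid $\Pi X$ to profinite abelian groups and $H^*(X;\mathcal M)$ is the cohomology of the complex $\hom_{\Pi X}(\tilde X_*,\mathcal M)$ of continuous natural transformations. A map $f:X\to Y$ in $\hat{\mathcal S}$ is a weak equivalence if it induces isomorphisms on $\pi_0$, on $\pi_1(X,x)\to\pi_1(Y,f(x))$ for every $x\in X_0$, and $H^q(Y;\mathcal M)\to H^q(X;f^*\mathcal M)$ for every local system $\mathcal M$ of finite abelian groups on $Y$ and every $q\ge0$; a cofibration in $\hat{\mathcal S}$ is a level-wise monomorphism; a fibration in $\hat{\mathcal S}$ is a map with the right lifting property with respect to all cofibrations that are weak equivalences. $\hat{\mathcal S}_G$ is the category of profinite spaces $X$ with a continuous $G$-action on each $X_n$ compatible with the simplicial structure maps, and $G$-equivariant maps of profinite spaces. It carries the model structure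 in which a map is a weak equivalence (resp. fibration) if its underlying map in $\hat{\mathcal S}$ is one, and a cofibration if it has the left lifting property with respect to all trivial fibrations (fibrations that are weak equivalences) in $\hat{\mathcal S}_G$. An object is cofibrant if the map from the initial (empty) object to it is a cofibration. *)

(* Defs.v *)
From HB Require Import structures.
From mathcomp Require Import all_boot all_order all_algebra.
From mathcomp Require Import boolp classical_sets cardinality topology.

Set Implicit Arguments.
Unset Strict Implicit.
Unset Printing Implicit Defensive.

Import GRing.Theory.
Local Open Scope classical_set_scope.

HB.mixin Record isProfinite T of Topological T := {
  profinite_compact : compact [set: T];
  profinite_hausdorff : hausdorff_space T;
  profinite_totally_disconnected : totally_disconnected [set: T] }.

#[short(type="profiniteType")]
HB.structure Definition Profinite := {T of isProfinite T & Topological T}.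

HB.mixin Record hasContinuousGroupLaw G of Group G & Topological G := {
  mulg_continuous : continuous (fun p : G * G => (p.1 * p.2)%g);
  invg_continuous : continuous (fun g : G => (g^-1)%g) }.

#[short(type="profiniteGroupType")]
HB.structure Definition ProfiniteGroup :=
  {G of hasContinuousGroupLaw G & Group G & Profinite G}.

(* Maps m -> n of the simplex category, with 'I_n.+1 as the ordinal [n] *)

Record delta (m n : nat) := Delta {
  delta_fun :> 'I_m.+1 -> 'I_n.+1;
  delta_mono : {homo delta_fun : i j / (i <= j)%N} }.

Definition delta_id n : delta n n := @Delta n n id (fun _ _ le_ij => le_ij).

Lemma delta_comp_mono l m n (s : delta m n) (t : delta l m) :
  {homo s \o t : i j / (i <= j)%N}.
Proof. by move=> i j le_ij; do 2! apply: delta_mono. Qed.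

Definition delta_comp l m n (s : delta m n) (t : delta l m) : delta l n :=
  Delta (delta_comp_mono s t).

Lemma coface_mono n (i : 'I_n.+2) :
  {homo (lift i : 'I_n.+1 -> 'I_n.+2) : j k / (j <= k)%N}.
Proof. by move=> j k le_jk; rewrite /= leq_bump2. Qed.

Definition coface n (i : 'I_n.+2) : delta n n.+1 := Delta (@coface_mono n i).

Definition delta_vertex n (i : 'I_n.+1) : delta 0 n :=
  @Delta 0 n (fun _ => i) (fun _ _ _ => leqnn i).

(* Simplicial profinite sets *)

Record pspace := PSpace {
  simp :> nat -> profiniteType;
  smap : forall m n, delta m n -> simp n -> simp m;
  smap_continuous : forall m n (t : delta m n), continuous (smap t);
  smap_id : forall n (x : simp n), smap (delta_id n) x = x;
  smap_comp : forall l m n (s : delta m n) (t : delta l m) (x : simp n),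
    smap (delta_comp s t) x = smap t (smap s x) }.

Arguments smap {p m n} t x.

Definition face (X : pspace) n (i : 'I_n.+2) : X n.+1 -> X n :=
  smap (coface i).
Definition vertex (X : pspace) n (i : 'I_n.+1) : X n -> X 0%N :=
  smap (delta_vertex i).
Definition d0 (X : pspace) : X 1%N -> X 0%N := @face X 0 ord0.
Definition d1 (X : pspace) : X 1%N -> X 0%N := @face X 0 ord_max.

Record pmap (X Y : pspace) := PMap {
  pmap_fun :> forall n, X n -> Y n;
  pmap_continuous : forall n, continuous (@pmap_fun n);
  pmap_natural : forall m n (t : delta m n) (x : X n),
    pmap_fun (smap t x) = smap t (pmap_fun x) }.

Definition pmap_id (X : pspace) : pmap X X :=
  @PMap X X (fun _ x => x) (fun n x => cvg_id) (fun _ _ _ _ => erefl).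

Section PMapComp.
Variables (X Y Z : pspace) (g : pmap Y Z) (f : pmap X Y).

Definition pmap_comp_fun n (x : X n) : Z n := g n (f n x).

Lemma pmap_comp_continuous n : continuous (@pmap_comp_fun n).
Proof.
by move=> x; apply: (@continuous_comp _ _ _ (f n) (g n));
  exact: pmap_continuous.
Qed.

Lemma pmap_comp_natural m n (t : delta m n) (x : X n) :
  pmap_comp_fun (smap t x) = smap t (pmap_comp_fun x).
Proof. by rewrite /pmap_comp_fun !pmap_natural. Qed.

Definition pmap_comp : pmap X Z := PMap pmap_comp_continuous pmap_comp_natural.
End PMapComp.

Definition pmap_iso (X Y : pspace) (f : pmap X Y) : Prop :=
  exists g : pmap Y X, (forall n x, g n (f n x) = x) /\
                       (forall n y, f n (g n y) = y).

(* [q] exhibits [P] as the coequalizer of [d0] and [d1] in profinite sets. *)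
Definition is_pi0 (X : pspace) (P : profiniteType) (q : X 0%N -> P) : Prop :=
  [/\ continuous q, (forall e : X 1%N, q (d0 e) = q (d1 e)) &
      forall (Z : profiniteType) (h : X 0%N -> Z), continuous h ->
        (forall e : X 1%N, h (d0 e) = h (d1 e)) ->
        exists! k : P -> Z, continuous k /\ (forall x, k (q x) = h x)].

(* A continuous bijection between profinite sets is a homeomorphism. *)
Definition pi0_iso (X Y : pspace) (f : pmap X Y) : Prop :=
  exists (P : profiniteType) (q : X 0%N -> P)
         (Q : profiniteType) (r : Y 0%N -> Q) (g : P -> Q),
    [/\ is_pi0 q, is_pi0 r, continuous g,
        (forall x, g (q x) = r (f 0%N x)) & bijective g].

(* The equivalence relation on vertices of having the same image in pi_0 *)
Definition same_component (X : pspace) (x y : X 0%N) : Prop :=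
  forall (Z : profiniteType) (h : X 0%N -> Z), continuous h ->
    (forall e : X 1%N, h (d0 e) = h (d1 e)) -> h x = h y.

Definition connected_pspace (X : pspace) : Prop :=
  (exists x : X 0%N, True) /\ (forall x y : X 0%N, same_component x y).

(* Unique lifting against the vertex inclusions Delta[0] -> Delta[n] *)
Definition is_covering (E X : pspace) (p : pmap E X) : Prop :=
  forall n (i : 'I_n.+1) (s : X n) (e : E 0%N), vertex i s = p 0%N e ->
    exists! t : E n, p n t = s /\ vertex i t = e.

Definition is_deck (E X : pspace) (p : pmap E X) (h : pmap E E) : Prop :=
  pmap_iso h /\ (forall n e, p n (h n e) = p n e).

(* Pointed finite Galois coverings of (X,x). As X need not be connected while
   the total space is, these are coverings of the component of x. *)
Record galois (X : pspace) (x : X 0%N) := Galois {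
  gal_space :> pspace;
  gal_proj : pmap gal_space X;
  gal_pt : gal_space 0%N;
  gal_ptP : gal_proj 0%N gal_pt = x;
  gal_connected : connected_pspace gal_space;
  gal_covering : is_covering gal_proj;
  gal_onto : forall y : X 0%N, same_component x y ->
    exists e, gal_proj 0%N e = y;
  gal_finite : forall y : X 0%N, finite_set [set e | gal_proj 0%N e = y];
  gal_galois : forall e e' : gal_space 0%N,
    gal_proj 0%N e = gal_proj 0%N e' ->
    exists! h : pmap gal_space gal_space,
      is_deck gal_proj h /\ h 0%N e = e' }.

Definition galois_map (X : pspace) (x : X 0%N) (E E' : galois x)
    (m : pmap E E') : Prop :=
  (forall n e, gal_proj E' n (m n e) = gal_proj E n e) /\
  m 0%N (gal_pt E) = gal_pt E'.

(* The universal profinite covering of (X,x): a limit, in profinite spaces, of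
   the diagram of all pointed finite Galois coverings of (X,x). *)
Record univ_cover (X : pspace) (x : X 0%N) := UnivCover {
  uc_space :> pspace;
  uc_proj : pmap uc_space X;
  uc_pt : uc_space 0%N;
  uc_cone : forall E : galois x, pmap uc_space E;
  uc_cone_proj : forall (E : galois x) n u,
    gal_proj E n (uc_cone E n u) = uc_proj n u;
  uc_cone_pt : forall E : galois x, uc_cone E 0%N uc_pt = gal_pt E;
  uc_cone_map : forall (E E' : galois x) (m : pmap E E'), galois_map m ->
    forall n u, m n (uc_cone E n u) = uc_cone E' n u;
  uc_limit : forall (Z : pspace) (z : forall E : galois x, pmap Z E),
    (forall (E E' : galois x) (m : pmap E E'), galois_map m ->
       forall n w, m n (z E n w) = z E' n w) ->
    exists! h : pmap Z uc_space,
      forall (E : galois x) n w, uc_cone E n (h n w) = z E n w }.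

(* A choice of universal covering at each vertex (unique up to unique pointed
   isomorphism over X) *)
Definition univ_covers (X : pspace) := forall x : X 0%N, univ_cover x.

(* Morphisms of the fundamental groupoid: isomorphisms over X between universal
   coverings; in particular [pi1 U x x] is the fundamental group at x. *)
Record pi1 (X : pspace) (U : univ_covers X) (x y : X 0%N) := Pi1 {
  pi1_map :> pmap (U x) (U y);
  pi1_over : forall n u, uc_proj (U y) n (pi1_map n u) = uc_proj (U x) n u;
  pi1_iso : pmap_iso pi1_map }.

Section Groupoid.
Variables (X : pspace) (U : univ_covers X).

Lemma pi1_id_iso x : pmap_iso (pmap_id (U x)).
Proof. by exists (pmap_id (U x)). Qed.

Definition pi1_id x : pi1 U x x :=
  @Pi1 X U x x (pmap_id (U x)) (fun _ _ => erefl) (pi1_id_iso x).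

Variables (x y z : X 0%N) (b : pi1 U y z) (a : pi1 U x y).

Lemma pi1_comp_over n u :
  uc_proj (U z) n (pmap_comp b a n u) = uc_proj (U x) n u.
Proof. by rewrite /= /pmap_comp_fun !pi1_over. Qed.

Lemma pi1_comp_iso : pmap_iso (pmap_comp b a).
Proof.
case: (pi1_iso a) => a' [aK a'K]; case: (pi1_iso b) => b' [bK b'K].
exists (pmap_comp a' b'); split=> n u; rewrite /= /pmap_comp_fun.
  by rewrite bK aK.
by rewrite a'K b'K.
Qed.

Definition pi1_comp : pi1 U x z := Pi1 pi1_comp_over pi1_comp_iso.
End Groupoid.

(* An isomorphism a : U x -> U y over X is determined by a(base point), and
   evaluation there identifies [pi1 U x y] with the fibre of U y over x. The
   limit topology coming from the finite Galois coverings, on whose fibres it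
   is discrete, is the subspace topology of that fibre. *)
Definition pi1_eval (X : pspace) (U : univ_covers X) (x y : X 0%N)
  (a : pi1 U x y) : U y 0%N := a 0%N (uc_pt (U x)).

HB.instance Definition _ (X : pspace) (U : univ_covers X) (x y : X 0%N) :=
  gen_eqMixin (pi1 U x y).
HB.instance Definition _ (X : pspace) (U : univ_covers X) (x y : X 0%N) :=
  gen_choiceMixin (pi1 U x y).
HB.instance Definition _ (X : pspace) (U : univ_covers X) (x y : X 0%N) :=
  Topological.copy (pi1 U x y) (initial_topology (@pi1_eval X U x y)).

(* Continuous functors from the fundamental groupoid; the groups are finite,
   hence discrete. *)
Record local_system (X : pspace) (U : univ_covers X) := LocalSystem {
  ls_obj :> X 0%N -> finZmodType;
  ls_map : forall x y, pi1 U x y -> ls_obj x -> ls_obj y;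
  ls_add : forall x y (a : pi1 U x y), {morph ls_map a : m m' / (m + m')%R};
  ls_id : forall x m, ls_map (pi1_id U x) m = m;
  ls_comp : forall x y z (b : pi1 U y z) (a : pi1 U x y) m,
    ls_map (pi1_comp b a) m = ls_map b (ls_map a m);
  ls_continuous : forall x y m m', open [set a : pi1 U x y | ls_map a m = m'] }.

Arguments ls_map {X U} l {x y} a m.

Section Cohomology.
Variables (X : pspace) (U : univ_covers X) (M : local_system U).

Definition family q := forall x : X 0%N, U x q -> M x.

(* Continuous natural transformations from U_q to M *)
Definition cochain q (c : family q) : Prop :=
  (forall x m, open [set u : U x q | c x u = m]) /\
  (forall x y (a : pi1 U x y) (u : U x q), c y (a q u) = ls_map M a (c x u)).

Definition differential q (c : family q) : family q.+1 :=
  fun x u => (\sum_(i < q.+2) c x (face i u) *~ ((-1) ^+ i))%R.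

Definition cocycle q (c : family q) : Prop :=
  cochain c /\ forall x u, differential c (x := x) u = 0%R.

Definition coboundary q : family q -> Prop :=
  match q with
  | 0 => fun c => forall x u, c x u = 0%R
  | q'.+1 => fun c => exists2 b : family q', cochain b &
                        forall x u, c x u = differential b (x := x) u
  end.
End Cohomology.

(* The functor between fundamental groupoids induced by f: the pointed lifts
   U x -> V (f x) of f, and the maps on morphisms compatible with these. *)
Record induced (X Y : pspace) (f : pmap X Y) (U : univ_covers X)
    (V : univ_covers Y) := Induced {
  ind_lift : forall x, pmap (U x) (V (f 0%N x));
  ind_lift_over : forall x n u,
    uc_proj (V (f 0%N x)) n (ind_lift x n u) = f n (uc_proj (U x) n u);
  ind_lift_pt : forall x, ind_lift x 0%N (uc_pt (U x)) = uc_pt (V (f 0%N x));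
  ind_map : forall x y, pi1 U x y -> pi1 V (f 0%N x) (f 0%N y);
  ind_mapE : forall x y (a : pi1 U x y) n u,
    ind_map a n (ind_lift x n u) = ind_lift y n (a n u);
  ind_map_id : forall x, ind_map (pi1_id U x) = pi1_id V (f 0%N x);
  ind_map_comp : forall x y z (b : pi1 U y z) (a : pi1 U x y),
    ind_map (pi1_comp b a) = pi1_comp (ind_map b) (ind_map a) }.

Arguments ind_map {X Y f U V} i {x y} a.

Section Pullback.
Variables (X Y : pspace) (f : pmap X Y) (U : univ_covers X) (V : univ_covers Y).
Variables (F : induced f U V) (M : local_system V).

Lemma ind_map_continuous x y : continuous (@ind_map _ _ _ _ _ F x y).
Proof.
apply/continuousP => _ [A oA <-].
exists (ind_lift F y 0%N @^-1` A).
  by apply: open_comp => // u _; exact: pmap_continuous.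
rewrite eqEsubset; split=> a; rewrite /preimage /= /pi1_eval;
  by rewrite -(ind_lift_pt F x) ind_mapE.
Qed.

Lemma pull_add x y (a : pi1 U x y) :
  {morph ls_map M (ind_map F a) : m m' / (m + m')%R}.
Proof. exact: ls_add. Qed.

Lemma pull_id x m : ls_map M (ind_map F (pi1_id U x)) m = m.
Proof. by rewrite ind_map_id ls_id. Qed.

Lemma pull_comp x y z (b : pi1 U y z) (a : pi1 U x y) m :
  ls_map M (ind_map F (pi1_comp b a)) m =
  ls_map M (ind_map F b) (ls_map M (ind_map F a) m).
Proof. by rewrite ind_map_comp ls_comp. Qed.

Lemma pull_continuous x y m m' :
  open [set a : pi1 U x y | ls_map M (ind_map F a) m = m'].
Proof.
have /continuousP cF := @ind_map_continuous x y.
exact: (cF _ (@ls_continuous _ _ M _ _ m m')).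
Qed.

Definition pull : local_system U :=
  @LocalSystem X U (fun x => M (f 0%N x))
    (fun x y a => ls_map M (ind_map F a))
    pull_add pull_id pull_comp pull_continuous.

Definition pull_family q (c : family M q) : family pull q :=
  fun x u => c (f 0%N x) (ind_lift F x q u).

(* H^q(Y;M) -> H^q(X;f^*M) is bijective, on representatives *)
Definition cohomology_iso q : Prop :=
  (forall c : family M q, cocycle c ->
     coboundary (pull_family c) -> coboundary c) /\
  (forall d : family pull q, cocycle d ->
     exists2 c : family M q, cocycle c &
       coboundary (fun x u => (d x u - pull_family c (x := x) u)%R)).
End Pullback.

(* [ind_map F] is continuous, and multiplicative on fundamental groups; these
   are compact Hausdorff, so bijectivity means isomorphism. *)
Definition weak_equivalence (X Y : pspace) (f : pmap X Y) : Prop :=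
  pi0_iso f /\
  exists (U : univ_covers X) (V : univ_covers Y) (F : induced f U V),
    (forall x : X 0%N, bijective (@ind_map _ _ _ _ _ F x x)) /\
    (forall (M : local_system V) q, cohomology_iso F M q).

Definition levelwise_mono (X Y : pspace) (f : pmap X Y) : Prop :=
  forall n, injective (f n).

Definition has_lift (A B E Z : pspace) (i : pmap A B) (p : pmap E Z) : Prop :=
  forall (u : pmap A E) (v : pmap B Z),
    (forall n a, p n (u n a) = v n (i n a)) ->
    exists h : pmap B E, (forall n a, h n (i n a) = u n a) /\
                         (forall n b, p n (h n b) = v n b).

Definition fibration (E Z : pspace) (p : pmap E Z) : Prop :=
  forall (A B : pspace) (i : pmap A B),
    levelwise_mono i -> weak_equivalence i -> has_lift i p.

Record gspace (G : profiniteGroupType) := GSpace {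
  gspace_pspace :> pspace;
  gact : forall n, G -> gspace_pspace n -> gspace_pspace n;
  gact_continuous : forall n, continuous
    (fun p : G * gspace_pspace n => gact p.1 p.2);
  gact1 : forall n (x : gspace_pspace n), gact 1%g x = x;
  gactM : forall n (g h : G) (x : gspace_pspace n),
    gact (g * h)%g x = gact g (gact h x);
  gact_natural : forall m n (t : delta m n) g (x : gspace_pspace n),
    smap t (gact g x) = gact g (smap t x) }.

Record gmap (G : profiniteGroupType) (X Y : gspace G) := GMap {
  gmap_pmap :> pmap X Y;
  gmap_equivariant : forall n (g : G) (x : X n),
    gmap_pmap n (gact g x) = gact g (gmap_pmap n x) }.

Section GSpaces.
Variable G : profiniteGroupType.

Definition g_has_lift (A B E Z : gspace G) (i : gmap A B) (p : gmap E Z) :=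
  forall (u : gmap A E) (v : gmap B Z),
    (forall n a, p n (u n a) = v n (i n a)) ->
    exists h : gmap B E, (forall n a, h n (i n a) = u n a) /\
                         (forall n b, p n (h n b) = v n b).

Definition g_weak_equivalence (X Y : gspace G) (f : gmap X Y) : Prop :=
  weak_equivalence f.

Definition g_fibration (X Y : gspace G) (f : gmap X Y) : Prop := fibration f.

Definition g_cofibration (X Y : gspace G) (f : gmap X Y) : Prop :=
  forall (E Z : gspace G) (p : gmap E Z),
    g_fibration p -> g_weak_equivalence p -> g_has_lift f p.

Definition acts_freely_on (X : gspace G) n (A : set (X n)) : Prop :=
  forall x : X n, A x -> forall g : G, gact g x = x -> g = 1%g.
End GSpaces.

Definition empty_type : Type := discrete_topology void.
HB.instance Definition _ := Topological.copy empty_type (discrete_topology void).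

Lemma empty_compact : compact [set: empty_type].
Proof.
have -> : [set: empty_type] = set0 by rewrite eqEsubset; split; case.
exact: compact0.
Qed.

Lemma empty_hausdorff : hausdorff_space empty_type.
Proof. by case. Qed.

Lemma empty_totally_disconnected : totally_disconnected [set: empty_type].
Proof. by case. Qed.

HB.instance Definition _ := isProfinite.Build empty_type
  empty_compact empty_hausdorff empty_totally_disconnected.

Section Initial.
Variable G : profiniteGroupType.

Definition empty_pspace : pspace :=
  @PSpace (fun _ => empty_type) (fun _ _ _ x => x)
    (fun _ _ _ x => match x with end) (fun _ _ => erefl)
    (fun _ _ _ _ _ _ => erefl).

Lemma empty_gact_continuous : forall n : nat,
  continuous (fun p : G * empty_pspace n => p.2).
Proof. by move=> n [_ []]. Qed.

Definition empty_gspace : gspace G :=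
  @GSpace G empty_pspace (fun _ _ x => x) empty_gact_continuous
    (fun _ _ => erefl) (fun _ _ _ _ => erefl) (fun _ _ _ _ _ => erefl).

Variable X : gspace G.

Definition from_empty_pmap : pmap empty_gspace X :=
  @PMap empty_gspace X (fun _ x => match x with end)
    (fun _ x => match x with end) (fun _ _ _ x => match x with end).

Definition from_empty : gmap empty_gspace X :=
  @GMap G empty_gspace X from_empty_pmap (fun _ _ x => match x with end).

Definition g_cofibrant : Prop := g_cofibration from_empty.
End Initial.

(* Main.v *)
Require Import Defs.
From HB Require Import structures.
From mathcomp Require Import all_boot all_order all_algebra all_fingroup.
From mathcomp Require Import ssrAC zify.
From mathcomp Require Import boolp classical_sets functions cardinality topology.
Require Import Defs.

Set Implicit Arguments.
Unset Strict Implicit.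
Unset Printing Implicit Defensive.

Import GRing.Theory.
Local Open Scope classical_set_scope.

(** A cofibration has to lift against all trivial fibrations, so the theorem
    requires enough trivial fibrations to detect freeness and injectivity, and a
    lifting procedure that freeness makes equivariant.

    Both rest on the cofree profinite spaces [cofree dim S]. A map into one of
    them is a family of functions on sets of simplices with values in [S j], so it
    extends along every level-wise monomorphism when the [S j] are finite and
    nonempty. They are contractible by an explicit contraction ([contract]), and
    projections [Z * cofree dim S] to [Z] are weak equivalences
    ([projection_weak_equivalence]): transport along the contraction shows that
    every Galois covering of the product comes from [Z], so that the universal
    coverings of the product are products ([product_univ_cover]), and the prism
    operators of the contraction compare the cohomology ([prism_homotopy]).

    Let [f] be a level-wise monomorphism, free off its image, and [p] a trivial
    fibration from [E] to [Z]. The clopen sets of simplices embed [E] into a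
    cofree space [hull E], and the graph of this embedding is a level-wise
    monomorphism and a weak equivalence into [Z * hull E]
    ([graph_weak_equivalence]). Lifting [p] against it makes [p] a retract of the
    projection ([trivial_fibration_retract]), so that lifts along [p] may be
    completed from arbitrary coordinates. An equivariant lift is then constructed
    level by level ([next_lift]). On one level the values are prescribed on the
    image of [f] and on degenerate simplices, and must have prescribed faces
    elsewhere. A continuous equivariant choice of such values exists by
    [equivariant_lifting]: a maximality argument settles the coordinates of the
    values, finitely many orbits of coordinates at a time. Freeness lets a value
    chosen at one point spread along its orbit, and finitely many coordinates are
    locally constant, so that compactness patches the local choices.

    Conversely, let [f] be a cofibration. A cofree space on a finite [G]-set [Q]
    shows that equivariant functions to [Q] extend along [f]; as finite quotients
    of [X n] separate points, [f] is injective ([cofibration_mono]). If some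
    [g <> 1] fixes a point [y] off the image, the action on a projection between
    cofree spaces is twisted so that it is trivial over the image of [X] while [g]
    acts without fixed points over [y]; a constant map on [X] then has no
    equivariant extension ([cofibration_free]). *)

(** * Compactness and clopen sets *)

(** Otherwise the complements of the good sets generate a proper filter, and a
    cluster point of that filter contradicts the local hypothesis. Compactness
    is used below mostly in this form, which spares the choice of a finite
    subcover. *)
Lemma compact_union_ind (T : topologicalType) (P : set T -> Prop) :
  compact [set: T] -> P set0 -> (forall A B, P A -> P B -> P (A `|` B)) ->
  (forall x : T, exists2 U : set T, nbhs x U & P U) -> P setT.
Proof.
move=> cT P0 PU Ploc; apply: contrapT => nPT.
pose F : set_system T := [set A | exists2 B, P B & ~` B `<=` A].
have FF : Filter F.
  split; first by exists set0.
  - move=> A B [A' PA sA] [B' PB sB]; exists (A' `|` B'); first exact: PU.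
    by move=> x /not_orP[nA nB]; split; [exact: sA|exact: sB].
  - by move=> A B AB [A' PA sA]; exists A' => // x /sA /AB.
have PF : ProperFilter F.
  split=> // -[B PB sB]; apply: nPT.
  suff <- : B = setT by [].
  by apply/seteqP; split=> // x _; apply: contrapT => /sB.
have [|x [_ clx]] := cT F PF; first exact: filterT.
have [U Ux PU'] := Ploc x.
have FU : F (~` U) by exists U.
by have [y []] := clx _ _ FU Ux.
Qed.

Lemma closed_graph_continuous (X Y : topologicalType) (f : X -> Y) :
  compact [set: Y] -> closed [set p : X * Y | f p.1 = p.2] -> continuous f.
Proof.
move=> cY clf x U /=; rewrite nbhsE => -[V [oV Vfx] VU].
have cV : compact (~` V) by apply: subclosed_compact cY _ => //; exact: open_closedC.
have H := (iffLR (compact_near_coveringP _) cV) X (nbhs x) (fun x' y => f x' <> y) (nbhs_filter x).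
have -> : (nbhs (f @ x) U) = nbhs x (f @^-1` U) by [].
apply: filterS (H _).
  by move=> x' /= Hx'; apply: VU; apply: contrapT => /Hx'.
move=> y nVy.
have : open (~` [set p : X * Y | f p.1 = p.2]) by exact: closed_openC.
rewrite openE => /(_ (x, y)) /=; case; first by move=> e; apply: nVy; rewrite -e.
move=> [A B] /= [Ax By] AB; exists (B, A) => //= -[y' x'] /= [By' Ax'].
by apply: (AB (x', y')).
Qed.

Lemma closed_proj1 (X Y : topologicalType) (A : set (X * Y)) :
  compact [set: Y] -> closed A -> closed [set x | exists y, A (x, y)].
Proof.
move=> cY clA; rewrite -openC openE => x /= nx.
have H := (iffLR (compact_near_coveringP _) cY) X (nbhs x) (fun x' y => ~ A (x', y)) (nbhs_filter x).
apply: filterS (H _).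
  by move=> x' /= Hx' [y]; exact: Hx'.
move=> y _.
have : open (~` A) by exact: closed_openC.
rewrite openE => /(_ (x, y)) /=; case; first by move=> Axy; apply: nx; exists y.
move=> [U V] /= [Ux Vy] UV; exists (V, U) => //= -[y' x'] /= [Vy' Ux'].
by apply: (UV (x', y')).
Qed.

Lemma closed_eq (X Y : topologicalType) (f g : X -> Y) :
  hausdorff_space Y -> continuous f -> continuous g ->
  closed [set x | f x = g x].
Proof.
rewrite open_hausdorff => hY cf cg; rewrite -openC openE => x /= nfg.
have /eqP/hY [[A B] /= [/set_mem Af /set_mem Bg] [oA oB AB]] := nfg.
have : nbhs x (f @^-1` A `&` g @^-1` B).
  by apply: filterI; [apply/cf/open_nbhs_nbhs|apply/cg/open_nbhs_nbhs].
apply: filterS => x' [Ax' Bx'] e; have : (A `&` B) (f x') by split=> //; move: Bx'; rewrite /preimage /= -e.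
by rewrite (eqP AB).
Qed.

Lemma closed_preimage (X Y : topologicalType) (f : X -> Y) (A : set Y) :
  continuous f -> closed A -> closed (f @^-1` A).
Proof. by move=> cf; apply: closed_comp => x _; exact: cf. Qed.

Lemma open_preimage (X Y : topologicalType) (f : X -> Y) (A : set Y) :
  continuous f -> open A -> open (f @^-1` A).
Proof. by move=> cf; apply: open_comp => x _; exact: cf. Qed.

Lemma fst_continuous (X Y : topologicalType) : continuous (@fst X Y).
Proof. by move=> x; exact: cvg_fst. Qed.

Lemma snd_continuous (X Y : topologicalType) : continuous (@snd X Y).
Proof. by move=> x; exact: cvg_snd. Qed.

Lemma pair_continuous (X Y Z : topologicalType) (f : X -> Y) (g : X -> Z) :
  continuous f -> continuous g -> continuous (fun x => (f x, g x)).
Proof. by move=> cf cg x; apply: cvg_pair; [exact: cf|exact: cg]. Qed.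

Lemma comp_continuous (X Y Z : topologicalType) (f : X -> Y) (g : Y -> Z) :
  continuous f -> continuous g -> continuous (fun x => g (f x)).
Proof. by move=> cf cg x; apply: (@continuous_comp _ _ _ f g); [exact: cf|exact: cg]. Qed.

(** Every point outside [O] is missed by some member of the family, so that
    finitely many members suffice by compactness. *)
Lemma clopen_family_inter (T : topologicalType) (K : set (set T)) (O : set T) :
  compact [set: T] -> (forall A, K A -> closed A) -> K setT ->
  (forall A B, K A -> K B -> K (A `&` B)) -> open O ->
  (forall x, (forall A, K A -> A x) -> O x) ->
  exists2 A, K A & A `<=` O.
Proof.
move=> cT Kcl KT KI oO QO.
suff [A KA AO] : exists2 A, K A & setT `&` A `<=` O.
  by exists A => // x Ax; exact: AO.
apply: (@compact_union_ind _ (fun S => exists2 A, K A & S `&` A `<=` O)) => //.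
- by exists setT => // x [].
- move=> S S' [A KA SA] [B KB SB]; exists (A `&` B); first exact: KI.
  by move=> x [[Sx|Sx] [Ax Bx]]; [exact: SA|exact: SB].
move=> x; have [Ox|nOx] := pselect (O x).
  by exists O; [exact: open_nbhs_nbhs|exists setT => // y []].
have [A /not_implyP[KA nAx]] : exists A, ~ (K A -> A x).
  by apply/existsNP => H; apply: nOx; exact: QO.
exists (~` A); last by exists A => // y [].
by apply: open_nbhs_nbhs; split=> //; apply: closed_openC; exact: Kcl.
Qed.

(** The intersection [Q] of the clopen sets around [x] is connected: normality
    extends a separation of [Q] to disjoint open sets, one clopen set around [x]
    already lies in their union by compactness, and it is cut in two by them. *)
Lemma profinite_zero_dimensional (T : profiniteType) : zero_dimensional T.
Proof.
move=> x y xy; apply: contrapT => nex.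
have cT := @profinite_compact T; have hT := @profinite_hausdorff T.
pose K : set (set T) := [set A | clopen A /\ A x].
have KI A B : K A -> K B -> K (A `&` B).
  by move=> [cA Ax] [cB Bx]; split=> //; exact: clopenI.
have KT : K setT by split=> //; exact: clopenT.
pose Q : set T := [set z | forall A, K A -> A z].
have Qx : Q x by move=> A [].
have Qy : Q y.
  by move=> A [cA Ax]; apply: contrapT => nAy; apply: nex; exists A.
have Qc : closed Q.
  rewrite -openC openE => z /= /existsNP[A /not_implyP[KA nAz]].
  have : open (~` A) by apply: closed_openC; case: KA => -[].
  rewrite openE => /(_ z nAz); apply: filterS => w nAw /(_ A KA).
  exact: nAw.
suff cQ : connected Q.
  have : connected_component [set: T] x y by exists Q.
  rewrite profinite_totally_disconnected // => /= yx.
  by move: xy; rewrite yx eqxx.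
move=> B B0 [C1 oC1 B1] [C2 cC2 B2].
have clB : closed B by rewrite B2; exact: closedI.
pose B' := Q `&` ~` C1.
have clB' : closed B' by apply: closedI => //; exact: open_closedC.
have BB' : B `&` B' = set0.
  by apply/seteqP; split=> // z []; rewrite B1 => -[_ ?] [].
have nT := compact_normal hT cT.
have [|C nC CB'] := nT _ clB (~` B').
  apply/set_nbhsP; exists (~` B'); split=> //; first exact: closed_openC.
  by apply/disjoints_subset.
have /set_nbhsP [U [oU BU UC]] := nC.
pose V := ~` closure C.
have oV : open V by exact/closed_openC/closed_closure.
have B'V : B' `<=` V by move=> z B'z /CB'.
have UV : U `&` V = set0.
  by apply/seteqP; split=> // z [/UC Cz nCz]; apply: nCz; exact: subset_closure.
have [|||A [[oA cA] Ax] AUV] := @clopen_family_inter T K (U `|` V) cT _ KT KI.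
- by move=> A [[]].
- exact: openU.
- move=> z Qz; have [C1z|nC1z] := pselect (C1 z).
    by left; apply: BU; rewrite B1.
  by right; exact: B'V.
have AU : clopen (A `&` U).
  split; first exact: openI.
  have -> : A `&` U = A `&` ~` V.
    apply/seteqP; split=> z [Az].
      by move=> Uz; split=> // Vz; have : (U `&` V) z by []; rewrite UV.
    by move=> nVz; split=> //; case: (AUV _ Az).
  by apply: closedI => //; exact: open_closedC.
have AV : clopen (A `&` V).
  split; first exact: openI.
  have -> : A `&` V = A `&` ~` U.
    apply/seteqP; split=> z [Az].
      by move=> Vz; split=> // Uz; have : (U `&` V) z by []; rewrite UV.
    by move=> nVz; split=> //; case: (AUV _ Az).
  by apply: closedI => //; exact: open_closedC.
have [C1x|nC1x] := pselect (C1 x).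
  rewrite B1; apply/seteqP; split=> [z []|z Qz] //; split=> //.
  apply: contrapT => nC1z.
  have [|_ Uz] := Qz (A `&` U).
    by split=> //; split=> //; apply: BU; rewrite B1.
  have Vz : V z by exact: B'V.
  by have : (U `&` V) z by []; rewrite UV.
exfalso; case: B0 => z Bz.
have Qz : Q z by move: Bz; rewrite B1 => -[].
have [|_ Vz] := Qz (A `&` V).
  by split=> //; split=> //; exact: B'V.
have : (U `&` V) z by split=> //; exact: BU.
by rewrite UV.
Qed.

Lemma clopen_nbhs (T : profiniteType) (x : T) (U : set T) :
  nbhs x U -> exists C, [/\ clopen C, C x & C `<=` U].
Proof.
move=> Ux; have := zero_dimensional_cvg (x := x) (@profinite_hausdorff T)
  (@profinite_zero_dimensional T) (@profinite_compact T).
by move=> /(_ _ Ux)[C [Cx cC] CU]; exists C.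
Qed.

Lemma clopen_separate (T : profiniteType) (A B : set T) :
  closed A -> closed B -> (forall x, A x -> ~ B x) ->
  exists C, [/\ clopen C, A `<=` C & forall x, B x -> ~ C x].
Proof.
move=> cA cB AB.
suff [C [cC AC CB]] : exists C, [/\ clopen C, A `&` setT `<=` C & forall x, B x -> ~ C x].
  by exists C; split=> // x Ax; exact: AC.
apply: (@compact_union_ind _ (fun S => exists C,
  [/\ clopen C, A `&` S `<=` C & forall x, B x -> ~ C x])).
- exact: profinite_compact.
- by exists set0; split; [exact: clopen0|move=> x [_ []]|move=> x _ []].
- move=> S S' [C [cC AC CB]] [C' [cC' AC' CB']]; exists (C `|` C'); split.
  + exact: clopenU.
  + by move=> x [Ax [Sx|Sx]]; [left; exact: AC|right; exact: AC'].
  + by move=> x Bx [Cx|Cx]; [exact: (CB x)|exact: (CB' x)].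
move=> x; have [Bx|nBx] := pselect (B x).
  exists (~` A); last by exists set0; split; [exact: clopen0|move=> y [Ay /(_ Ay)]|move=> y _ []].
  by apply: open_nbhs_nbhs; split; [exact: closed_openC|move=> /AB].
have [|C [cC Cx CB]] := @clopen_nbhs T x (~` B).
  by apply: open_nbhs_nbhs; split=> //; exact: closed_openC.
exists C; first by apply: open_nbhs_nbhs; split=> //; case: cC.
by exists C; split=> // y By /CB.
Qed.

Lemma clopen_points (T : profiniteType) (x y : T) : x <> y ->
  exists C, [/\ clopen C, C x & ~ C y].
Proof. by move=> /eqP/profinite_zero_dimensional. Qed.

(** * Profinite sets *)
Section ProdProfinite.
Variables T U : profiniteType.

Lemma prod_profinite_compact : compact [set: T * U].
Proof.
rewrite -setXTT; apply: compact_setX; exact: profinite_compact.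
Qed.

Lemma prod_profinite_zero_dimensional : zero_dimensional (T * U)%type.
Proof.
move=> [x y] [x' y'] /eqP ne.
have [exx|/clopen_points[C [cC Cx Cx']]] := pselect (x = x').
  have /clopen_points[C [cC Cy Cy']] : y <> y' by move=> eyy; apply: ne; rewrite exx eyy.
  exists (snd @^-1` C); split=> //; apply: preimage_clopen => //.
  exact: snd_continuous.
exists (fst @^-1` C); split=> //; apply: preimage_clopen => //.
exact: fst_continuous.
Qed.

Lemma zero_dimensional_hausdorff (X : topologicalType) :
  zero_dimensional X -> hausdorff_space X.
Proof.
move=> zX; rewrite open_hausdorff => x y /zX [C [[oC cC] Cx nCy]].
exists (C, ~` C) => /=; first by split; exact/mem_set.
by split=> //; [exact: closed_openC|rewrite setICr].
Qed.

HB.instance Definition _ := isProfinite.Build (T * U)%type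
  prod_profinite_compact
  (zero_dimensional_hausdorff prod_profinite_zero_dimensional)
  (zero_dimension_totally_disconnected prod_profinite_zero_dimensional).
End ProdProfinite.

Section FunProfinite.
Variables (I : Type) (T : I -> profiniteType).

Lemma eval_continuous i : continuous (fun f : prod_topology T => f i).
Proof. exact: (@proj_continuous {classic I} T i). Qed.

Lemma fun_continuous (X : topologicalType) (f : X -> prod_topology T) :
  (forall i, continuous (fun x => f x i)) -> continuous f.
Proof.
move=> cf x; apply/cvg_sup => i; apply/cvg_image.
  apply/seteqP; split=> // y _.
  (* any value of the i-th coordinate is completed by the coordinates of f x *)
  exists (fun j => if pselect (i = j) is left e then ecast j (T j) e y else f x j) => //.
  by case: pselect => // e; rewrite (Prop_irrelevance e erefl).
move=> U Ui; rewrite /=; exists ((fun g : prod_topology T => g i) @^-1` U).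
  exact: cf.
apply: image_preimage; apply/seteqP; split=> // y _.
exists (fun j => if pselect (i = j) is left e then ecast j (T j) e y else f x j) => //.
by case: pselect => // e; rewrite (Prop_irrelevance e erefl).
Qed.

Lemma fun_compact : compact [set: prod_topology T].
Proof.
have := @tychonoff {classic I} T (fun i => [set: T i]) _.
have -> : [set f : forall i, T i | forall i, [set: T i] (f i)] = setT.
  by apply/seteqP.
by apply=> i; exact: profinite_compact.
Qed.

Lemma fun_zero_dimensional : zero_dimensional (prod_topology T).
Proof.
move=> f g /eqP fg.
have [i /eqP/profinite_zero_dimensional [C [cC Cf Cg]]] : exists i, f i <> g i.
  by apply/existsNP => H; apply: fg; exact: functional_extensionality_dep.
exists ((fun h : prod_topology T => h i) @^-1` C); split=> //.
by apply: preimage_clopen => //; exact: eval_continuous.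
Qed.

HB.instance Definition _ := isProfinite.Build (prod_topology T)
  fun_compact (zero_dimensional_hausdorff fun_zero_dimensional)
  (zero_dimension_totally_disconnected fun_zero_dimensional).
End FunProfinite.

Section ClosedProfinite.
Variables (T : profiniteType) (A : set T) (cA : closed A).

(** The closedness proof is a parameter of the type, so that the profinite
    structure can be inferred from it. *)
Definition closed_subspace of closed A : Type := set_type A.
Local Notation S := (closed_subspace cA).
HB.instance Definition _ := Topological.copy S (set_type A).

Definition incl (x : S) : T := set_val x.
Definition restr (x : T) (Ax : A x) : S := SigSub (mem_set Ax).

Lemma incl_inj : injective incl. Proof. exact: val_inj. Qed.
Lemma incl_mem (x : S) : A (incl x). Proof. exact: set_valP. Qed.
Lemma inclK (x : T) (Ax : A x) : incl (restr Ax) = x. Proof. by []. Qed.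

Lemma incl_continuous : continuous incl.
Proof. exact: initial_continuous. Qed.

Lemma incl_continuousP (X : topologicalType) (f : X -> S) :
  continuous (fun x => incl (f x)) -> continuous f.
Proof.
move=> cf; apply/continuousP => _ [B oB <-].
by move: cf => /continuousP /(_ _ oB).
Qed.

Lemma closed_subspace_compact : compact [set: S].
Proof.
have cAc : compact A by apply: subclosed_compact cA (@profinite_compact T) _.
move=> F PF _.
have [|x [Ax clx]] := cAc (incl @ F) _.
  by rewrite /= /fmap /=; apply: filterS filterT => x _; exact: incl_mem.
exists (restr Ax); split=> // B C FB.
rewrite nbhsE => -[_ [[D oD <-] Dx] DC].
have : (incl @ F) (incl @` B).
  have : F (incl @^-1` (incl @` B)) by apply: filterS FB => y By; exists y.
  by [].
move=> /clx /(_ (open_nbhs_nbhs (conj oD Dx)))[_ [[y By <-] Dy]].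
by exists y; split=> //; exact: DC.
Qed.

Lemma closed_subspace_zero_dimensional : zero_dimensional S.
Proof.
move=> x y /eqP xy.
have [C [cC Cx Cy]] : exists C, [/\ clopen C, C (incl x) & ~ C (incl y)].
  by apply: clopen_points => /incl_inj.
exists (incl @^-1` C); split=> //.
by apply: preimage_clopen => //; exact: incl_continuous.
Qed.

HB.instance Definition _ := isProfinite.Build S
  closed_subspace_compact
  (zero_dimensional_hausdorff closed_subspace_zero_dimensional)
  (zero_dimension_totally_disconnected closed_subspace_zero_dimensional).
End ClosedProfinite.

Section FiniteProfinite.
Variable F : finType.

Definition finite_space : Type := discrete_topology F.
HB.instance Definition _ := Topological.copy finite_space (discrete_topology F).
HB.instance Definition _ := Discrete_ofNbhs.Build finite_space erefl.

Lemma finite_space_compact : compact [set: finite_space].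
Proof. by apply: finite_compact; exact: (@finite_finset F setT). Qed.

Lemma finite_space_zero_dimensional : zero_dimensional finite_space.
Proof. exact: (@discrete_zero_dimension (discrete_topology F)). Qed.

HB.instance Definition _ := isProfinite.Build finite_space
  finite_space_compact
  (zero_dimensional_hausdorff finite_space_zero_dimensional)
  (zero_dimension_totally_disconnected finite_space_zero_dimensional).

Lemma finite_space_open (A : set finite_space) : open A.
Proof. exact: (@discrete_open (discrete_topology F)). Qed.

Lemma to_finite_continuous (X : topologicalType) (f : X -> finite_space) :
  (forall s, open [set x | f x = s]) -> continuous f.
Proof.
move=> of_; apply/continuousP => A _.
have -> : f @^-1` A = \bigcup_(s in A) [set x | f x = s].
  by apply/seteqP; split=> [x Ax|x [s As /= e]]; [exists (f x)|rewrite /preimage /= e].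
by apply: bigcup_open => s _; exact: of_.
Qed.

Lemma finite_fiber_clopen (X : topologicalType) (f : X -> finite_space)
  (A : set finite_space) : continuous f -> clopen (f @^-1` A).
Proof.
move=> cf; apply: preimage_clopen => //; split; first exact: finite_space_open.
by rewrite -openC; exact: finite_space_open.
Qed.
End FiniteProfinite.


Lemma finite_open_forall (T : topologicalType) (F : finType) (P : F -> set T) (x : T) :
  (forall s, nbhs x (P s)) -> nbhs x [set y | forall s, P s y].
Proof. by move=> H; exact: (@filter_forall _ _ P (nbhs x) _ H). Qed.

Lemma finite_closed_exists (T : topologicalType) (F : finType) (P : F -> set T) :
  (forall s, closed (P s)) -> closed [set y | exists s, P s y].
Proof.
move=> cP; rewrite -openC openE => x /= nx.
have : nbhs x [set y | forall s, (~` P s) y].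
  apply: finite_open_forall => s; apply: open_nbhs_nbhs; split.
    exact: closed_openC.
  by move=> Px; apply: nx; exists s.
by apply: filterS => y H [s]; exact: H.
Qed.

Lemma clopen_near (T : topologicalType) (C : set T) (x : T) : clopen C ->
  nbhs x [set y | C y <-> C x].
Proof.
move=> [oC cC]; have [Cx|nCx] := pselect (C x).
  by apply: filterS (open_nbhs_nbhs (conj oC Cx)) => y Cy; split.
apply: filterS (open_nbhs_nbhs (conj (closed_openC cC) (nCx : (~` C) x))) => y nCy.
by split=> // /nCy.
Qed.

(** Each [A s] has a clopen neighbourhood missing the others; the value at a
    point is the first [s] whose neighbourhood contains it. *)
Lemma finite_extension (B : profiniteType) (F : finType) (s0 : F) (A : F -> set B) :
  (forall s, closed (A s)) -> (forall s t b, A s b -> A t b -> s = t) ->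
  exists2 v : B -> finite_space F, continuous v & forall s b, A s b -> v b = s.
Proof.
move=> cA dA.
have sep s : exists C, [/\ clopen C, A s `<=` C & forall b t, t != s -> A t b -> ~ C b].
  have [|||C [cC AC CA]] := @clopen_separate B (A s) [set b | exists t, t != s /\ A t b].
  - exact: cA.
  - apply: finite_closed_exists => t; have [->|ts] := eqVneq t s.
      rewrite (_ : (fun _ => _) = set0); first exact: closed0.
      by apply/seteqP; split=> b [].
    rewrite (_ : (fun _ => _) = A t); first exact: cA.
    by apply/seteqP; split=> b // [].
  - by move=> b Asb [t [/eqP ts Atb]]; apply: ts; exact: dA Atb Asb.
  by exists C; split=> // b t ts Atb; apply: CA; exists t.
have [C CP] := choice sep.
exists (fun b => odflt s0 [pick s | `[< C s b >]]).
  apply: to_finite_continuous => s; rewrite openE => b /= <-.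
  have : nbhs b [set b' | forall t, C t b' <-> C t b].
    by apply: finite_open_forall => t; apply: clopen_near; case: (CP t).
  apply: filterS => b' bb' /=; congr (odflt s0 _).
  by apply: eq_pick => t; apply/asboolP/asboolP => /bb'.
move=> s b Asb; case: pickP => [t /asboolP Ct|/(_ s)] /=.
  by apply: contrapT => /eqP; rewrite eq_sym => st; case: (CP t) => _ _ /(_ b s st Asb).
by case: (CP s) => _ /(_ b Asb) Cs _ /asboolP.
Qed.

(** Profinite sets that are injective with respect to embeddings *)
Definition absolute_extensor (S : profiniteType) : Prop :=
  forall (A B : profiniteType) (i : A -> B) (u : A -> S),
    continuous i -> injective i -> continuous u ->
    exists2 v : B -> S, continuous v & forall a, v (i a) = u a.

Lemma finite_absolute_extensor (F : finType) (s0 : F) :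
  absolute_extensor (finite_space F).
Proof.
move=> A B i u ci ii cu.
have [||v cv vE] := @finite_extension B F s0 (fun s => i @` (u @^-1` [set s])).
- move=> s; apply: compact_closed; first exact: profinite_hausdorff.
  apply: continuous_compact; first by apply: continuous_subspaceT.
  apply: subclosed_compact (@profinite_compact _) _ => //.
  by case: (finite_fiber_clopen [set s] cu).
- by move=> s t b [a /= <- <-] [a' /= <- /ii ->].
by exists v => // a; apply: vE; exists a.
Qed.

Lemma dependent_choice (I : Type) (T : I -> Type) (P : forall i, T i -> Prop) :
  (forall i, exists y, P i y) -> exists f : forall i, T i, forall i, P i (f i).
Proof. by move=> ex; exists (fun i => proj1_sig (cid (ex i))) => i; case: (cid _). Qed.

(** * Simplicial profinite sets *)

Lemma delta_ext m n (s t : delta m n) : s =1 t -> s = t.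
Proof.
case: s t => [f fm] [g gm] /= /funext fg; subst g.
by rewrite (Prop_irrelevance fm gm).
Qed.

Lemma delta_eqP m n (s t : delta m n) : (forall i, s i = t i :> nat) -> s = t.
Proof. by move=> st; apply: delta_ext => i; apply: val_inj; exact: st. Qed.

Lemma pmap_ext (X Y : pspace) (f g : pmap X Y) : (forall n x, f n x = g n x) -> f = g.
Proof.
case: f g => [f fc fn] [g gc gn] /= fg.
have {}fg : f = g.
  by apply: functional_extensionality_dep => n; apply: funext; exact: fg.
by subst g; rewrite (Prop_irrelevance fc gc) (Prop_irrelevance fn gn).
Qed.

Lemma smap_compE (X : pspace) l m n (s : delta m n) (t : delta l m)
  (r : delta l n) (x : X n) : (forall i, s (t i) = r i :> nat) ->
  smap t (smap s x) = smap r x.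
Proof. by move=> H; rewrite -smap_comp; congr (smap _ x); exact: delta_eqP. Qed.

Lemma smap_comp2 (X : pspace) l m m' n (s : delta m n) (t : delta l m)
  (s' : delta m' n) (t' : delta l m') (x : X n) :
  (forall i, s (t i) = s' (t' i) :> nat) ->
  smap t (smap s x) = smap t' (smap s' x).
Proof. by move=> H; rewrite -!smap_comp; congr (smap _ x); exact: delta_eqP. Qed.

Lemma smap_idE (X : pspace) n (t : delta n n) (x : X n) :
  (forall i, t i = i :> nat) -> smap t x = x.
Proof.
by move=> H; rewrite -[RHS]smap_id; congr (smap _ x); apply: delta_eqP => i; rewrite H.
Qed.

Definition delta_const m : delta m 0 :=
  @Delta m 0 (fun _ => ord0) (fun _ _ _ => leqnn _).

Section Products.
Variables X Y : pspace.

Definition prod_smap m n (t : delta m n) (p : X n * Y n) : X m * Y m :=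
  (smap t p.1, smap t p.2).

Lemma prod_smap_continuous m n (t : delta m n) : continuous (prod_smap t).
Proof.
apply: pair_continuous.
  by apply: comp_continuous (@fst_continuous _ _) _; exact: smap_continuous.
by apply: comp_continuous (@snd_continuous _ _) _; exact: smap_continuous.
Qed.

Lemma prod_smap_id n p : prod_smap (delta_id n) p = p.
Proof. by case: p => x y; rewrite /prod_smap !smap_id. Qed.

Lemma prod_smap_comp l m n (s : delta m n) (t : delta l m) p :
  prod_smap (delta_comp s t) p = prod_smap t (prod_smap s p).
Proof. by rewrite /prod_smap !smap_comp. Qed.

Definition prod_pspace : pspace :=
  @PSpace (fun n => (X n * Y n)%type) prod_smap prod_smap_continuous
    prod_smap_id prod_smap_comp.

Lemma prod_smapE m n (t : delta m n) (x : X n) (y : Y n) :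
  smap t ((x, y) : prod_pspace n) = (smap t x, smap t y).
Proof. by []. Qed.

Definition prod_fst : pmap prod_pspace X :=
  @PMap prod_pspace X (fun n p => p.1) (fun n => @fst_continuous _ _)
    (fun _ _ _ _ => erefl).

Definition prod_snd : pmap prod_pspace Y :=
  @PMap prod_pspace Y (fun n p => p.2) (fun n => @snd_continuous _ _)
    (fun _ _ _ _ => erefl).

Variables (Q : pspace) (f : pmap Q X) (g : pmap Q Y).

Lemma pair_pmap_continuous n : continuous (fun q : Q n => (f n q, g n q)).
Proof. by apply: pair_continuous; exact: pmap_continuous. Qed.

Lemma pair_pmap_natural m n (t : delta m n) (q : Q n) :
  (f m (smap t q), g m (smap t q)) = prod_smap t (f n q, g n q).
Proof. by rewrite !pmap_natural. Qed.

Definition pair_pmap : pmap Q prod_pspace :=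
  @PMap Q prod_pspace (fun n q => (f n q, g n q)) pair_pmap_continuous
    pair_pmap_natural.
End Products.

Section SubSpace.
Variables (X : pspace) (A : forall n, set (X n)).
Hypothesis cA : forall n, closed (@A n).
Hypothesis sA : forall m n (t : delta m n) x, A x -> A (smap t x).

Definition sub_simp n : profiniteType := closed_subspace (@cA n).

Definition sub_smap m n (t : delta m n) (x : sub_simp n) : sub_simp m :=
  restr (@cA m) (sA t (incl_mem x)).

Lemma sub_smap_continuous m n (t : delta m n) : continuous (sub_smap t).
Proof.
apply: incl_continuousP => /=.
have : continuous (fun x : sub_simp n => smap t (incl x)) by
  apply: comp_continuous (@incl_continuous _ _ _) _; exact: smap_continuous.
by [].
Qed.

Lemma sub_smap_id n x : sub_smap (delta_id n) x = x.
Proof. by apply: incl_inj; rewrite inclK smap_id. Qed.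

Lemma sub_smap_comp l m n (s : delta m n) (t : delta l m) x :
  sub_smap (delta_comp s t) x = sub_smap t (sub_smap s x).
Proof. by apply: incl_inj; rewrite !inclK smap_comp. Qed.

Definition sub_pspace : pspace :=
  @PSpace sub_simp sub_smap sub_smap_continuous sub_smap_id sub_smap_comp.

Definition sub_incl : pmap sub_pspace X :=
  @PMap sub_pspace X (fun n x => incl x) (fun n => @incl_continuous _ _ _)
    (fun _ _ _ _ => erefl).

Lemma sub_inclP n (x : sub_pspace n) : A (sub_incl n x).
Proof. exact: incl_mem. Qed.

Lemma sub_incl_inj n : injective (sub_incl n).
Proof. exact: incl_inj. Qed.

Definition sub_elt n (x : X n) (Ax : A x) : sub_pspace n := restr (@cA n) Ax.

Lemma sub_eltK n (x : X n) (Ax : A x) : sub_incl n (sub_elt Ax) = x.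
Proof. by []. Qed.

Section Corestr.
Variables (Q : pspace) (f : pmap Q X) (fA : forall n q, A (f n q)).

Definition sub_corestr_fun n (q : Q n) : sub_pspace n := sub_elt (fA q).

Lemma sub_corestr_continuous n : continuous (@sub_corestr_fun n).
Proof. apply: incl_continuousP; exact: (@pmap_continuous _ _ f n). Qed.

Lemma sub_corestr_natural m n (t : delta m n) (q : Q n) :
  sub_corestr_fun (smap t q) = smap t (sub_corestr_fun q).
Proof. by apply: incl_inj; rewrite !inclK pmap_natural. Qed.

Definition sub_corestr : pmap Q sub_pspace :=
  PMap sub_corestr_continuous sub_corestr_natural.

Lemma sub_corestrK n (q : Q n) : sub_incl n (sub_corestr n q) = f n q.
Proof. by []. Qed.
End Corestr.
End SubSpace.

(** * Cofree simplicial sets *)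
Section Cofree.
Variables (J : Type) (dim : J -> nat) (S : J -> profiniteType).

(** The functor [cofree] is right adjoint to taking the profinite sets of
    [dim j]-simplices: a map from [X] amounts to a family of functions from
    [X (dim j)] to [S j]. *)
Definition cofree_simp m : profiniteType :=
  prod_topology (fun j : J => prod_topology (fun _ : delta (dim j) m => S j)).

Definition cofree_smap m n (t : delta m n) (w : cofree_simp n) : cofree_simp m :=
  fun j r => w j (delta_comp t r).

Lemma cofree_eval_continuous m j (r : delta (dim j) m) :
  continuous (fun w : cofree_simp m => w j r).
Proof.
apply: (@comp_continuous _ _ _ (fun w : cofree_simp m => w j)
  (fun v : prod_topology (fun _ : delta (dim j) m => S j) => v r)).
  exact: eval_continuous.
exact: eval_continuous.
Qed.

Lemma cofree_continuous m (X : topologicalType) (f : X -> cofree_simp m) :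
  (forall j r, continuous (fun x => f x j r)) -> continuous f.
Proof.
by move=> cf; apply: fun_continuous => j; apply: fun_continuous => r; exact: cf.
Qed.

Lemma cofree_ext m (w w' : cofree_simp m) :
  (forall j r, w j r = w' j r) -> w = w'.
Proof.
move=> ww; apply: functional_extensionality_dep => j.
by apply: functional_extensionality_dep => r; exact: ww.
Qed.

Lemma cofree_smap_continuous m n (t : delta m n) : continuous (cofree_smap t).
Proof. by apply: cofree_continuous => j r; exact: cofree_eval_continuous. Qed.

Lemma cofree_smap_id n w : cofree_smap (delta_id n) w = w.
Proof.
by apply: cofree_ext => j r; rewrite /cofree_smap; congr (w j _); exact: delta_eqP.
Qed.

Lemma cofree_smap_comp l m n (s : delta m n) (t : delta l m) w :
  cofree_smap (delta_comp s t) w = cofree_smap t (cofree_smap s w).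
Proof.
by apply: cofree_ext => j r; rewrite /cofree_smap; congr (w j _); exact: delta_eqP.
Qed.

Definition cofree : pspace :=
  @PSpace cofree_simp cofree_smap cofree_smap_continuous cofree_smap_id
    cofree_smap_comp.

Section ToCofree.
Variables (X : pspace) (f : forall j, X (dim j) -> S j).
Hypothesis cf : forall j, continuous (@f j).

Definition to_cofree_fun m (x : X m) : cofree m := fun j r => f (smap r x).

Lemma to_cofree_continuous m : continuous (@to_cofree_fun m).
Proof.
apply: cofree_continuous => j r.
by apply: (@comp_continuous _ _ _ (smap r) (@f j)); [exact: smap_continuous|exact: cf].
Qed.

Lemma to_cofree_natural m n (t : delta m n) (x : X n) :
  to_cofree_fun (smap t x) = smap t (to_cofree_fun x).
Proof. by apply: cofree_ext => j r; rewrite /to_cofree_fun /= -smap_comp. Qed.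

Definition to_cofree : pmap X cofree := PMap to_cofree_continuous to_cofree_natural.
End ToCofree.

(** By the adjunction only the functions on [dim j]-simplices have to be
    extended. *)
Lemma cofree_lift (A B : pspace) (i : pmap A B) (u : pmap A cofree) :
  levelwise_mono i ->
  (forall j, absolute_extensor (S j)) ->
  exists v : pmap B cofree, forall n a, v n (i n a) = u n a.
Proof.
move=> im aeS.
have ext j : exists f : B (dim j) -> S j, continuous f /\
    forall a, f (i (dim j) a) = u (dim j) a j (delta_id _).
  have [|||f cf fE] := aeS j _ _ (i (dim j)) (fun a => u (dim j) a j (delta_id _)).
  - exact: pmap_continuous.
  - exact: im.
  - apply: (@comp_continuous _ _ _ (u (dim j)) (fun w => w j (delta_id _))).
      exact: pmap_continuous.
    exact: cofree_eval_continuous.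
  by exists f.
have [f fP] := dependent_choice ext.
exists (to_cofree (fun j => (fP j).1)) => n a; apply: cofree_ext => j r.
rewrite /= /to_cofree_fun -pmap_natural (fP j).2 pmap_natural /= /cofree_smap.
by congr (u n a j _); exact: delta_eqP.
Qed.
End Cofree.

(** * Contractions *)

Section Contraction.
Variables (J : Type) (dim : J -> nat) (S : J -> profiniteType).
Local Notation W := (cofree dim S).
Variable w : W 0.
Arguments w : clear implicits.

(** An explicit contraction onto the vertex [w]. The map [e] to the interval
    says which vertices are already contracted: a face none of whose vertices is
    contracted is evaluated on [om], any other face takes its value from [w]. *)
Definition contract m M (a : delta M m) (e : delta M 1) (om : W m) : W M :=
  fun j r => if [forall i, e (r i) == ord0] then om j (delta_comp a r)
             else w j (delta_const _).

Lemma contract_continuous m M (a : delta M m) (e : delta M 1) :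
  continuous (contract a e).
Proof.
apply: cofree_continuous => j r; rewrite /contract.
case: [forall i, _]; first exact: cofree_eval_continuous.
exact: cst_continuous.
Qed.

Lemma contract_smap m M N (a : delta M m) (e : delta M 1) (t : delta N M)
    (a' : delta N m) (e' : delta N 1) om :
  (forall i, a (t i) = a' i :> nat) -> (forall i, e (t i) = e' i :> nat) ->
  smap t (contract a e om) = contract a' e' om.
Proof.
move=> at_ et_; apply: cofree_ext => j r.
have -> : a' = delta_comp a t by apply: delta_eqP => i; rewrite -at_.
have -> : e' = delta_comp e t by apply: delta_eqP => i; rewrite -et_.
rewrite /= /cofree_smap /contract.
have -> : delta_comp a (delta_comp t r) = delta_comp (delta_comp a t) r.
  exact: delta_eqP.
by [].
Qed.

Lemma contract_comp l m M (a : delta M l) (e : delta M 1) (s : delta l m)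
    (a' : delta M m) om : (forall i, s (a i) = a' i :> nat) ->
  contract a e (smap s om) = contract a' e om.
Proof.
move=> sa; apply: cofree_ext => j r; rewrite /contract /= /cofree_smap.
by case: ifP => // _; congr (om j _); apply: delta_eqP => i; exact: sa.
Qed.

Lemma contract0 m M (a : delta M m) (e : delta M 1) om :
  (forall i, e i = 0%N :> nat) -> contract a e om = smap a om.
Proof.
move=> e0; apply: cofree_ext => j r; rewrite /contract ifT //.
by apply/forallP => i; apply/eqP/val_inj; exact: e0.
Qed.

Lemma contract1 m M (a : delta M m) (e : delta M 1) om :
  (forall i, e i = 1%N :> nat) -> contract a e om = smap (delta_const M) w.
Proof.
move=> e1; apply: cofree_ext => j r; rewrite /contract ifF.
  by rewrite /= /cofree_smap; congr (w j _); exact: delta_eqP.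
by apply/negbTE/forallPn; exists ord0; apply/eqP => /(congr1 val); rewrite /= e1.
Qed.
End Contraction.
Arguments contract_smap {J dim S w m M N a e t} a' e' {om} _ _.
Arguments contract_comp {J dim S w l m M a e s} a' {om} _.

(** * Coverings *)

Section DeltaEdge.
Variables (n : nat) (i j : 'I_n.+1).
Hypothesis ij : (i <= j)%N.
Definition edge_fun (k : 'I_2) := if k == ord0 then i else j.
Lemma edge_mono : {homo edge_fun : k l / (k <= l)%N}.
Proof.
move=> k l kl; rewrite /edge_fun; case: eqVneq => [_|k0]; case: eqVneq => // l0.
by move: kl k0; rewrite l0 leqn0 => /eqP k0 /eqP[]; exact: val_inj.
Qed.
Definition delta_edge : delta 1 n := Delta edge_mono.
End DeltaEdge.

Lemma delta_min_mono : {homo (fun i : 'I_3 => inord (minn i 1) : 'I_2) : i j / (i <= j)%N}.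
Proof.
move=> i j ij; rewrite !inordK ?ltnS ?geq_minr //.
by rewrite leq_min geq_minr andbT (leq_trans (geq_minl _ _)).
Qed.
Definition delta_min : delta 2 1 := Delta delta_min_mono.

Lemma pred_ord3 (k : 'I_3) : (k.-1 < 2)%N.
Proof. by case: k => -[|[|[|]]]. Qed.
Lemma delta_pred_mono : {homo (fun i : 'I_3 => Ordinal (pred_ord3 i)) : i j / (i <= j)%N}.
Proof. by move=> i j /= ij; rewrite -!subn1 leq_sub2r. Qed.
Definition delta_pred : delta 2 1 := Delta delta_pred_mono.

Section CoveringLemmas.
Variables (D X : pspace) (p : pmap D X).
Hypothesis cov : is_covering p.

Lemma covering_vertex_inj n (i : 'I_n.+1) (d d' : D n) :
  p n d = p n d' -> vertex i d = vertex i d' -> d = d'.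
Proof.
move=> pd vd.
have [|t [_ tU]] := cov (i := i) (s := p n d) (e := vertex i d).
  by rewrite /vertex pmap_natural.
by rewrite -(tU d) // -(tU d').
Qed.

(** A simplex of a covering is determined by its image and one vertex, so to
    extend a lift of a face it suffices to extend the lift of a vertex. *)
Lemma covering_extension m M (a : delta m M) (x : X M) (d : D m) :
  smap a x = p m d -> exists t : D M, p M t = x /\ smap a t = d.
Proof.
move=> ax.
have [|t [[pt vt] _]] := cov (i := a ord0) (s := x) (e := vertex ord0 d).
  rewrite /vertex pmap_natural -ax.
  by rewrite (smap_compE (r := delta_vertex (a ord0))).
exists t; split=> //; apply: (covering_vertex_inj (i := ord0)).
  by rewrite pmap_natural pt.
by rewrite -vt /vertex (smap_compE (r := delta_vertex (a ord0))).
Qed.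

(** Unique lifting makes the graph of the lift closed, and its target is
    compact. *)
Lemma covering_section_continuous (Q : topologicalType) n (i : 'I_n.+1)
    (b : Q -> X n) (c0 : Q -> D 0) (c : Q -> D n) :
  continuous b -> continuous c0 -> (forall q, p n (c q) = b q) ->
  (forall q, vertex i (c q) = c0 q) -> continuous c.
Proof.
move=> cb cc0 pc vc; apply: closed_graph_continuous; first exact: profinite_compact.
rewrite (_ : (fun _ => _) = [set z : Q * D n | p n z.2 = b z.1] `&`
  [set z : Q * D n | vertex i z.2 = c0 z.1]).
  apply: closedI; apply: closed_eq; try exact: profinite_hausdorff.
  - by apply: comp_continuous (@snd_continuous _ _) _; exact: pmap_continuous.
  - by apply: comp_continuous (@fst_continuous _ _) _.
  - by apply: comp_continuous (@snd_continuous _ _) _; exact: smap_continuous.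
  - by apply: comp_continuous (@fst_continuous _ _) _.
apply/seteqP; split=> [[q d] /= <-|[q d] /= [pd vd]]; first by rewrite pc vc.
by apply: (covering_vertex_inj (i := i)); rewrite ?pc ?vc.
Qed.

Definition edge_to n (i : 'I_n.+1) : delta 1 n := delta_edge (leq0n i : (ord0 <= i)%N).

Section Lifting.
Variables (Q : pspace) (b : pmap Q X) (c0 : Q 0 -> D 0).
Hypothesis c0_cont : continuous c0.
Hypothesis c0_over : forall q, p 0 (c0 q) = b 0 q.
Hypothesis c0_edge : forall q : Q 1, exists t : D 1,
  [/\ p 1 t = b 1 q, vertex ord0 t = c0 (vertex ord0 q) &
      vertex ord_max t = c0 (vertex ord_max q)].

(** Simplices are lifted from their first vertex. The condition on edges makes
    the other vertices agree, and naturality follows by unique lifting. *)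
Lemma covering_lift : exists c : pmap Q D,
  (forall n q, p n (c n q) = b n q) /\ (forall q, c 0 q = c0 q).
Proof.
have ex n (q : Q n) : exists t : D n, p n t = b n q /\ vertex ord0 t = c0 (vertex ord0 q).
  have [|t [tP _]] := cov (i := ord0 : 'I_n.+1) (s := b n q) (e := c0 (vertex ord0 q)).
    by rewrite c0_over /vertex pmap_natural.
  by exists t.
have [c cP] : exists c : forall n, Q n -> D n, forall n q,
    p n (c n q) = b n q /\ vertex ord0 (c n q) = c0 (vertex ord0 q).
  by exists (fun n q => proj1_sig (cid (ex n q))) => n q; case: (cid (ex n q)).
have cv n (q : Q n) (i : 'I_n.+1) : vertex i (c n q) = c0 (vertex i q).
  have [t [pt t0 t1]] := c0_edge (smap (edge_to i) q).
  have e0 (Y : pspace) (y : Y n) : vertex ord0 (smap (edge_to i) y) = vertex ord0 y.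
    by rewrite /vertex (smap_compE (r := delta_vertex ord0)).
  have e1 (Y : pspace) (y : Y n) : vertex ord_max (smap (edge_to i) y) = vertex i y.
    by rewrite /vertex (smap_compE (r := delta_vertex i)).
  have ct : smap (edge_to i) (c n q) = t.
    apply: (covering_vertex_inj (i := ord0)).
      by rewrite pmap_natural (cP _ _).1 pt pmap_natural.
    by rewrite e0 (cP _ _).2 t0 e0.
  by rewrite -[LHS]e1 ct t1 e1.
have cc n : continuous (c n).
  apply: (covering_section_continuous (i := ord0) (b := b n)
     (c0 := fun q => c0 (vertex ord0 q))).
  - exact: pmap_continuous.
  - apply: (@comp_continuous _ _ _ (vertex ord0)) => //; exact: smap_continuous.
  - by move=> q; case: (cP n q).
  - by move=> q; case: (cP n q).
have cn m n (t : delta m n) q : c m (smap t q) = smap t (c n q).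
  apply: (covering_vertex_inj (i := ord0)).
    by rewrite pmap_natural !(cP _ _).1 pmap_natural.
  have e0 (Y : pspace) (y : Y n) : vertex ord0 (smap t y) = vertex (t ord0) y.
    by rewrite /vertex (smap_compE (r := delta_vertex (t ord0))).
  by rewrite cv !e0 cv.
exists (PMap cc cn); split=> [n q|q] /=; first by case: (cP n q).
have e0 (Y : pspace) (y : Y 0) : vertex ord0 y = y.
  by rewrite /vertex smap_idE // => i; rewrite (ord1 i).
by have := (cP 0%N q).2; rewrite !e0.
Qed.
End Lifting.
End CoveringLemmas.

(** * Coverings of a product with a contractible factor *)

Lemma vertex_natural (X Y : pspace) (f : pmap X Y) n (i : 'I_n.+1) (x : X n) :
  f 0%N (vertex i x) = vertex i (f n x).
Proof. exact: pmap_natural. Qed.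

Lemma vertex_smap (X : pspace) m n (t : delta m n) (i : 'I_m.+1) (x : X n) :
  vertex i (smap t x) = vertex (t i) x.
Proof. by rewrite /vertex (smap_compE (r := delta_vertex (t i))). Qed.

Lemma vertex0 (X : pspace) (i : 'I_1) (x : X 0%N) : vertex i x = x.
Proof. by rewrite /vertex smap_idE // => j; rewrite (ord1 j) (ord1 i). Qed.

Lemma d0E (X : pspace) (e : X 1%N) : d0 e = vertex ord_max e.
Proof.
by rewrite /d0 /face /vertex; congr (smap _ e); apply: delta_eqP => i; rewrite (ord1 i).
Qed.

Lemma d1E (X : pspace) (e : X 1%N) : d1 e = vertex ord0 e.
Proof.
by rewrite /d1 /face /vertex; congr (smap _ e); apply: delta_eqP => i; rewrite (ord1 i).
Qed.

Definition cst (X : pspace) (x : X 0%N) n : X n := smap (delta_const n) x.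

Lemma smap_cst (X : pspace) (x : X 0%N) m n (t : delta m n) :
  smap t (cst x n) = cst x m.
Proof. by rewrite /cst; apply: smap_compE. Qed.

Lemma cst0 (X : pspace) (x : X 0%N) : cst x 0 = x.
Proof. by rewrite /cst smap_idE // => i; rewrite (ord1 i). Qed.

Lemma vertex_cst (X : pspace) (x : X 0%N) n (i : 'I_n.+1) :
  vertex i (cst x n) = x.
Proof. by rewrite /vertex smap_cst /cst smap_idE // => k; rewrite (ord1 k). Qed.

Lemma pmap_cst (X Y : pspace) (f : pmap X Y) (x : X 0%N) n :
  f n (cst x n) = cst (f 0%N x) n.
Proof. exact: pmap_natural. Qed.

Section Transport.
Variables (Z : pspace) (J : Type) (dim : J -> nat) (S : J -> profiniteType).
Local Notation W := (cofree dim S).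
Local Notation T := (prod_pspace Z W).
Variable w : W 0%N.
Arguments w : clear implicits.

Lemma contract_cst m M (a : delta M m) (e : delta M 1) :
  contract w a e (cst w m) = cst w M.
Proof.
apply: cofree_ext => j r; rewrite /contract /cst /= /cofree_smap.
by case: ifP => _; congr (w j _); exact: delta_eqP.
Qed.

Definition base_pmap (Q : pspace) : pmap Q W :=
  @PMap Q W (fun n _ => cst w n) (fun n => @cst_continuous _ _ _)
    (fun m n t _ => esym (smap_cst w t)).

(** The edge along which the contraction moves [(z, om)] to [(z, w)] *)
Definition contract_edge (z : Z 0%N) (om : W 0%N) : T 1%N :=
  (cst z 1, contract w (delta_const 1) (delta_id 1) om).

Lemma contract_edge0 z om : vertex ord0 (contract_edge z om) = (z, om).
Proof.
rewrite /vertex prod_smapE; congr (_, _); first by rewrite smap_cst /cst smap_idE // => k; rewrite (ord1 k).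
rewrite (contract_smap (delta_const 0) (delta_vertex ord0)) //.
by rewrite contract0 // smap_idE // => i; rewrite (ord1 i).
Qed.

Lemma contract_edge1 z om : vertex ord_max (contract_edge z om) = (z, w).
Proof.
rewrite /vertex prod_smapE; congr (_, _); first by rewrite smap_cst /cst smap_idE // => k; rewrite (ord1 k).
rewrite (contract_smap (delta_const 0) (delta_vertex ord_max)) //.
by rewrite contract1 // smap_idE // => i; rewrite (ord1 i).
Qed.

Lemma contract_edge_base z : contract_edge z w = cst ((z, w) : T 0%N) 1.
Proof.
rewrite /contract_edge; congr (_, _).
have {2}-> : w = cst w 0 by rewrite /cst smap_idE // => i; rewrite (ord1 i).
by rewrite contract_cst.
Qed.

Section Cov.
Variables (D : pspace) (p : pmap D T).
Hypothesis cov : is_covering p.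

(** Transport of vertices of a covering along the contracting edges *)
Definition joined_by (x x' : D 0%N) (e : D 1%N) :=
  [/\ p 1%N e = contract_edge (p 0%N x).1 (p 0%N x).2, vertex ord0 e = x &
      vertex ord_max e = x'].
Definition joined (x x' : D 0%N) := exists e : D 1%N, joined_by x x' e.

Lemma joined_over x x' : joined x x' -> p 0%N x' = ((p 0%N x).1, w).
Proof. by move=> [e [pe _ <-]]; rewrite vertex_natural pe contract_edge1. Qed.

Lemma joined_fun x x' x'' : joined x x' -> joined x x'' -> x' = x''.
Proof.
move=> [e [pe e0 <-]] [f [pf f0 <-]].
by have -> : e = f by apply: (covering_vertex_inj cov (i := ord0)); rewrite ?pe ?pf ?e0 ?f0.
Qed.

Lemma joined_inj x y x' : joined x x' -> joined y x' -> p 0%N x = p 0%N y -> x = y.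
Proof.
move=> [e [pe e0 e1]] [f [pf f0 f1]] pxy.
rewrite -e0 -f0; congr vertex.
by apply: (covering_vertex_inj cov (i := ord_max)); rewrite ?pe ?pf ?e1 ?f1 ?pxy.
Qed.

Lemma joined_ex x : exists x', joined x x'.
Proof.
have [|e [[pe e0] _]] := cov (i := ord0 : 'I_2)
    (s := contract_edge (p 0%N x).1 (p 0%N x).2) (e := x).
  by rewrite contract_edge0; case: (p 0%N x).
by exists (vertex ord_max e), e.
Qed.

Lemma joined_ex_inv x' z om : p 0%N x' = (z, w) ->
  exists x, joined x x' /\ p 0%N x = (z, om).
Proof.
move=> px'.
have [|e [[pe e1] _]] := cov (i := ord_max : 'I_2) (s := contract_edge z om) (e := x').
  by rewrite contract_edge1.
have px : p 0%N (vertex ord0 e) = (z, om) by rewrite vertex_natural pe contract_edge0.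
by exists (vertex ord0 e); split=> //; exists e; rewrite /joined_by px.
Qed.

Lemma joined_refl x z : p 0%N x = (z, w) -> joined x x.
Proof.
by move=> px; exists (cst x 1); split; rewrite ?vertex_cst // pmap_cst px contract_edge_base.
Qed.

(** Contracting an edge sweeps out a square, made of two triangles that share
    its diagonal. *)
Definition square_lower (ze : Z 1%N) (om : W 1%N) : T 2%N :=
  (smap delta_min ze, contract w delta_min delta_pred om).
Definition square_upper (ze : Z 1%N) (om : W 1%N) : T 2%N :=
  (smap delta_pred ze, contract w delta_pred delta_min om).
Definition square_diag (ze : Z 1%N) (om : W 1%N) : T 1%N :=
  (ze, contract w (delta_id 1) (delta_id 1) om).

Definition face01 : delta 1 2 := coface ord_max.
Definition face02 : delta 1 2 := coface (inord 1).
Definition face12 : delta 1 2 := coface ord0.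

Lemma min01 i : delta_min (face01 i) = i :> nat.
Proof. by rewrite /= inordK ?ltnS ?geq_minr //; case: i => -[|[|]]. Qed.
Lemma min02 i : delta_min (face02 i) = i :> nat.
Proof. by rewrite /= inordK ?ltnS ?geq_minr // /bump inordK //; case: i => -[|[|]]. Qed.
Lemma min12 i : delta_min (face12 i) = 1%N :> nat.
Proof. by rewrite /= inordK ?ltnS ?geq_minr //; case: i => -[|[|]]. Qed.
Lemma pred01 i : delta_pred (face01 i) = 0%N :> nat.
Proof. by case: i => -[|[|]]. Qed.
Lemma pred02 i : delta_pred (face02 i) = i :> nat.
Proof. by rewrite /= /bump inordK //; case: i => -[|[|]]. Qed.
Lemma pred12 i : delta_pred (face12 i) = i :> nat.
Proof. by case: i => -[|[|]]. Qed.

Lemma lower01 ze om : smap face01 (square_lower ze om) = (ze, om).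
Proof.
rewrite prod_smapE; congr (_, _).
  by rewrite (smap_compE (r := delta_id 1)) ?smap_id // => i; rewrite min01.
rewrite (contract_smap (delta_id 1) (delta_comp delta_pred face01)) //.
  by rewrite contract0 ?smap_id // => i; exact: pred01.
by move=> i; exact: min01.
Qed.

Lemma lower02 ze om : smap face02 (square_lower ze om) = square_diag ze om.
Proof.
rewrite prod_smapE; congr (_, _).
  by rewrite (smap_compE (r := delta_id 1)) ?smap_id // => i; rewrite min02.
by apply: contract_smap => i; [exact: min02|exact: pred02].
Qed.

Lemma lower12 ze om : smap face12 (square_lower ze om) =
  contract_edge (vertex ord_max ze) (vertex ord_max om).
Proof.
rewrite prod_smapE; congr (_, _).
  by apply: smap_comp2 => i; rewrite min12.
rewrite [RHS](contract_comp (delta_comp delta_min face12)) => [|i].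
  by apply: contract_smap => i //; exact: pred12.
by rewrite /= -[RHS]/(nat_of_ord (delta_min (face12 i))) min12.
Qed.

Lemma upper02 ze om : smap face02 (square_upper ze om) = square_diag ze om.
Proof.
rewrite prod_smapE; congr (_, _).
  by rewrite (smap_compE (r := delta_id 1)) ?smap_id // => i; rewrite pred02.
by apply: contract_smap => i; [exact: pred02|exact: min02].
Qed.

Lemma upper01 ze om : smap face01 (square_upper ze om) =
  contract_edge (vertex ord0 ze) (vertex ord0 om).
Proof.
rewrite prod_smapE; congr (_, _).
  by apply: smap_comp2 => i; rewrite pred01.
rewrite [RHS](contract_comp (delta_comp delta_pred face01)) => [|i].
  by apply: contract_smap => i //; exact: min01.
by rewrite /= -[RHS]/(nat_of_ord (delta_pred (face01 i))) pred01.
Qed.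

Lemma upper12 ze om : smap face12 (square_upper ze om) = (ze, cst w 1).
Proof.
rewrite prod_smapE; congr (_, _).
  by rewrite (smap_compE (r := delta_id 1)) ?smap_id // => i; rewrite pred12.
rewrite (contract_smap (delta_comp delta_pred face12) (delta_comp delta_min face12)) //.
by rewrite contract1 // => i; exact: min12.
Qed.

(** Transport carries edges to edges: the given edge is a side of the square
    swept out by its contraction, and lifting one triangle after the other yields
    the opposite side. *)
Lemma joined_edge (d : D 1%N) x0 x1 : joined (vertex ord0 d) x0 ->
  joined (vertex ord_max d) x1 -> exists d' : D 1%N,
  [/\ p 1%N d' = ((p 1%N d).1, cst w 1), vertex ord0 d' = x0 & vertex ord_max d' = x1].
Proof.
case pd : (p 1%N d) => [ze om] /= j0 j1.
have [a [pa a01]] := covering_extension cov (etrans (lower01 ze om) (esym pd)).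
have [b [pb b02]] : exists b, p 2%N b = square_upper ze om /\ smap face02 b = smap face02 a.
  by apply: covering_extension => //; rewrite pmap_natural pa lower02 upper02.
exists (smap face12 b); rewrite pmap_natural pb upper12; split=> //.
  apply: (joined_fun _ j0); exists (smap face01 b); split.
  - by rewrite pmap_natural pb upper01 vertex_natural pd.
  - rewrite -a01 !vertex_smap.
    have -> : face01 ord0 = face02 ord0 by apply: val_inj; rewrite /= /bump inordK.
    by rewrite -!vertex_smap b02.
  - by rewrite !vertex_smap; congr (vertex _ b); exact: val_inj.
apply: (joined_fun _ j1); exists (smap face12 a); split.
- by rewrite pmap_natural pa lower12 vertex_natural pd.
- by rewrite -a01 !vertex_smap; congr (vertex _ a); exact: val_inj.
have e : face12 ord_max = face02 ord_max by apply: val_inj; rewrite /= /bump inordK.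
by rewrite !vertex_smap e -!vertex_smap b02.
Qed.

Lemma joined_edge_inv (d' : D 1%N) ze om x0 x1 : p 1%N d' = (ze, cst w 1) ->
  joined x0 (vertex ord0 d') -> joined x1 (vertex ord_max d') ->
  p 0%N x0 = (vertex ord0 ze, vertex ord0 om) ->
  p 0%N x1 = (vertex ord_max ze, vertex ord_max om) ->
  exists d : D 1%N, [/\ p 1%N d = (ze, om), vertex ord0 d = x0 & vertex ord_max d = x1].
Proof.
move=> pd' j0 j1 px0 px1.
have [b [pb b12]] := covering_extension cov (etrans (upper12 ze om) (esym pd')).
have [a [pa a02]] : exists a, p 2%N a = square_lower ze om /\ smap face02 a = smap face02 b.
  by apply: covering_extension => //; rewrite pmap_natural pb lower02 upper02.
exists (smap face01 a); rewrite pmap_natural pa lower01; split=> //.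
  have -> : vertex ord0 (smap face01 a) = vertex ord0 (smap face01 b).
    rewrite !vertex_smap.
    have -> : face01 ord0 = face02 ord0 by apply: val_inj; rewrite /= /bump inordK.
    by rewrite -!vertex_smap a02.
  apply: (joined_inj _ j0).
    exists (smap face01 b); split=> //.
      by rewrite vertex_natural !pmap_natural pb upper01 contract_edge0.
    by rewrite -b12 !vertex_smap; congr (vertex _ b); exact: val_inj.
  by rewrite vertex_natural !pmap_natural pb upper01 contract_edge0.
have e12 : vertex ord0 (smap face12 a) = vertex ord_max (smap face01 a).
  by rewrite !vertex_smap; congr (vertex _ a); exact: val_inj.
have p12 : p 0%N (vertex ord0 (smap face12 a)) = (vertex ord_max ze, vertex ord_max om).
  by rewrite vertex_natural !pmap_natural pa lower12 contract_edge0.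
rewrite -e12; apply: (joined_inj _ j1); last by rewrite p12.
exists (smap face12 a); split=> //.
  by rewrite p12 !pmap_natural pa lower12.
have e : face12 ord_max = face02 ord_max by apply: val_inj; rewrite /= /bump inordK.
by rewrite -b12 !vertex_smap e -!vertex_smap a02.
Qed.

(** The simplices of a covering of the product that lie over the constant
    simplex at [w]; they form a covering of the first factor. *)
Definition over_base n : set (D n) := [set d | (p n d).2 = cst w n].

Lemma over_base_closed n : closed (@over_base n).
Proof.
apply: closed_eq; first exact: profinite_hausdorff.
  apply: (@comp_continuous _ _ _ (p n) snd); first exact: pmap_continuous.
  exact: snd_continuous.
exact: cst_continuous.
Qed.

Lemma over_base_smap m n (t : delta m n) d : over_base d -> over_base (smap t d).
Proof. rewrite /over_base /mkset => h; rewrite pmap_natural.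
by rewrite -(smap_cst w t) -h; case: (p n d). Qed.

Definition restricted : pspace := sub_pspace over_base_closed over_base_smap.
Definition restricted_incl : pmap restricted D := sub_incl _ _.
Definition restricted_proj : pmap restricted Z :=
  pmap_comp (prod_fst Z W) (pmap_comp p restricted_incl).

Lemma restricted_over n (d : restricted n) :
  p n (restricted_incl n d) = (restricted_proj n d, cst w n).
Proof.
have := sub_inclP d; rewrite /over_base /=.
by rewrite /= /pmap_comp_fun /=; case: (p n _) => z om /= ->.
Qed.

Lemma joined_continuous (Q : topologicalType) (a b : Q -> D 0%N) :
  continuous a -> (forall q, joined (a q) (b q)) -> continuous b.
Proof.
move=> ca jab.
have [e eP] := @choice Q (D 1%N) (fun q e => joined_by (a q) (b q) e) jab.
have -> : b = fun q => vertex ord_max (e q) by apply: funext => q; case: (eP q).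
apply: (@comp_continuous _ _ _ e); last exact: smap_continuous.
apply: (covering_section_continuous cov (i := ord0)
  (b := fun q => contract_edge (p 0%N (a q)).1 (p 0%N (a q)).2) (c0 := a)) => //.
- have cpa : continuous (fun q => p 0%N (a q)).
    by apply: comp_continuous ca _; exact: pmap_continuous.
  apply: pair_continuous.
    apply: (@comp_continuous _ _ _ (fun q => (p 0%N (a q)).1)).
      by apply: comp_continuous cpa _; exact: fst_continuous.
    exact: smap_continuous.
  apply: (@comp_continuous _ _ _ (fun q => (p 0%N (a q)).2)).
    by apply: comp_continuous cpa _; exact: snd_continuous.
  exact: contract_continuous.
- by move=> q; case: (eP q).
- by move=> q; case: (eP q).
Qed.

Lemma joined_continuous_inv (Q : topologicalType) (om : Q -> W 0%N) (a b : Q -> D 0%N) :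
  continuous b -> continuous om -> (forall q, joined (a q) (b q)) ->
  (forall q, (p 0%N (a q)).2 = om q) -> continuous a.
Proof.
move=> cb com jab pa.
have [e eP] := @choice Q (D 1%N) (fun q e => joined_by (a q) (b q) e) jab.
have -> : a = fun q => vertex ord0 (e q) by apply: funext => q; case: (eP q).
apply: (@comp_continuous _ _ _ e); last exact: smap_continuous.
apply: (covering_section_continuous cov (i := ord_max)
  (b := fun q => contract_edge (p 0%N (b q)).1 (om q)) (c0 := b)) => //.
- apply: pair_continuous.
    apply: (@comp_continuous _ _ _ (fun q => (p 0%N (b q)).1)).
      apply: (@comp_continuous _ _ _ (fun q => p 0%N (b q))); last exact: fst_continuous.
      by apply: comp_continuous cb _; exact: pmap_continuous.
    exact: smap_continuous.
  by apply: comp_continuous com _; exact: contract_continuous.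
- by move=> q; case: (eP q) => -> _ _; rewrite (joined_over (jab q)) pa.
- by move=> q; case: (eP q).
Qed.

Lemma retraction_exists : exists tr : pmap D restricted,
  (forall n d, p n (restricted_incl n (tr n d)) = ((p n d).1, cst w n)) /\
  (forall d, joined d (restricted_incl 0%N (tr 0%N d))).
Proof.
have [c0 c0P] := choice joined_ex.
have [|||c [pc cc]] := covering_lift cov
  (b := pair_pmap (pmap_comp (prod_fst Z W) p) (base_pmap D)) (c0 := c0).
- exact: joined_continuous (fun x => @cvg_id _ _) c0P.
- by move=> q; rewrite (joined_over (c0P q)) -[in LHS](cst0 w).
- move=> q; have [d [pd d0 d1]] := joined_edge (c0P (vertex ord0 q)) (c0P (vertex ord_max q)).
  by exists d.
have cb n d : over_base (c n d) by rewrite /over_base /= pc.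
exists (sub_corestr over_base_closed over_base_smap cb); split=> [n d|d].
  by rewrite /restricted_incl sub_corestrK pc.
by rewrite /restricted_incl sub_corestrK cc.
Qed.

(** Reversing the transport identifies the covering with the product of its
    restriction to the slice over [w] and the contractible factor. *)
Lemma trivialization_exists : exists ph : pmap (prod_pspace restricted W) D,
  (forall n d om, p n (ph n (d, om)) = (restricted_proj n d, om)) /\
  (forall d om, joined (ph 0%N (d, om)) (restricted_incl 0%N d)).
Proof.
have ex (q : prod_pspace restricted W 0%N) : exists x,
    joined x (restricted_incl 0%N q.1) /\ p 0%N x = (restricted_proj 0%N q.1, q.2).
  by apply: joined_ex_inv; rewrite restricted_over cst0.
have [c0 c0P] := choice ex.
have [|||c [pc cc]] := covering_lift cov
  (b := pair_pmap (pmap_comp restricted_proj (prod_fst restricted W)) (prod_snd restricted W)) (c0 := c0).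
- apply: (@joined_continuous_inv _ snd c0 (fun q => restricted_incl 0%N q.1)).
  + by apply: (@comp_continuous _ _ _ fst); [exact: fst_continuous|exact: pmap_continuous].
  + exact: snd_continuous.
  + by move=> q; case: (c0P q).
  + by move=> q; case: (c0P q) => _ ->.
- by move=> q; case: (c0P q).
- move=> q; apply: (@joined_edge_inv (restricted_incl 1%N q.1)).
  + exact: restricted_over.
  + by rewrite -vertex_natural; case: (c0P (vertex ord0 q)).
  + by rewrite -vertex_natural; case: (c0P (vertex ord_max q)).
  + by case: (c0P (vertex ord0 q)) => _ ->; rewrite -vertex_natural.
  + by case: (c0P (vertex ord_max q)) => _ ->; rewrite -vertex_natural.
exists c; split=> [n d om|d om]; first by rewrite pc.
by rewrite cc; case: (c0P (d, om)).
Qed.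

Definition retr : pmap D restricted := proj1_sig (cid retraction_exists).
Lemma retr_over n d : p n (restricted_incl n (retr n d)) = ((p n d).1, cst w n).
Proof. by rewrite /retr; case: cid => ? []. Qed.
Lemma retr_joined d : joined d (restricted_incl 0%N (retr 0%N d)).
Proof. by rewrite /retr; case: cid => ? []. Qed.

Definition triv : pmap (prod_pspace restricted W) D :=
  proj1_sig (cid trivialization_exists).
Lemma triv_over n d om : p n (triv n (d, om)) = (restricted_proj n d, om).
Proof. by rewrite /triv; case: cid => ? []. Qed.
Lemma triv_joined d om : joined (triv 0%N (d, om)) (restricted_incl 0%N d).
Proof. by rewrite /triv; case: cid => ? []. Qed.

Lemma restricted_incl_inj n : injective (restricted_incl n).
Proof. exact: sub_incl_inj. Qed.

Lemma retr_proj n d : restricted_proj n (retr n d) = (p n d).1.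
Proof. by have := retr_over d; rewrite restricted_over => -[]. Qed.

Lemma trivK n d : triv n (retr n d, (p n d).2) = d.
Proof.
apply: (covering_vertex_inj cov (i := ord0)).
  by rewrite triv_over retr_proj; case: (p n d).
rewrite -vertex_natural.
have -> : vertex ord0 ((retr n d, (p n d).2) : prod_pspace restricted W n) =
    (retr 0%N (vertex ord0 d), (p 0%N (vertex ord0 d)).2).
  by rewrite /vertex prod_smapE !pmap_natural.
apply: (joined_inj (triv_joined _ _) (retr_joined _)).
by rewrite triv_over retr_proj; case: (p 0%N _).
Qed.

Lemma retrK n d om : retr n (triv n (d, om)) = d.
Proof.
apply: restricted_incl_inj; apply: (covering_vertex_inj cov (i := ord0)).
  by rewrite retr_over triv_over restricted_over.
rewrite -!vertex_natural.
apply: (joined_fun (retr_joined _)).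
rewrite /vertex prod_smapE; exact: triv_joined.
Qed.

Lemma triv_base n d : triv n (d, cst w n) = restricted_incl n d.
Proof.
apply: (covering_vertex_inj cov (i := ord0)).
  by rewrite triv_over restricted_over.
rewrite -!vertex_natural.
have -> : vertex ord0 ((d, cst w n) : prod_pspace restricted W n) =
    (vertex ord0 d, w) by rewrite /vertex prod_smapE -/(vertex ord0 (cst w n)) vertex_cst.
set d0' := vertex ord0 d.
have pd : p 0%N (restricted_incl 0%N d0') = (restricted_proj 0%N d0', w).
  by rewrite restricted_over cst0.
apply: (joined_inj (triv_joined _ _) (joined_refl pd)).
by rewrite triv_over pd.
Qed.

Lemma retr_incl n d : retr n (restricted_incl n d) = d.
Proof. by rewrite -triv_base retrK. Qed.

Lemma restricted_covering : is_covering restricted_proj.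
Proof.
move=> n i s e vs.
have [|t [[pt vt] tU]] := cov (i := i) (s := ((s, cst w n) : T n)) (e := restricted_incl 0%N e).
  by rewrite restricted_over /vertex prod_smapE -/(vertex i s) vs -/(vertex i (cst w n)) vertex_cst cst0.
have bt : over_base t by rewrite /over_base /mkset pt.
exists (sub_elt over_base_closed over_base_smap bt); split.
  split; first by rewrite /restricted_proj /= /pmap_comp_fun /= /pmap_comp_fun /= pt.
  by apply: restricted_incl_inj; rewrite -vt vertex_natural.
move=> t' [pt' vt']; apply: restricted_incl_inj.
rewrite [LHS]sub_eltK; apply: tU; rewrite restricted_over pt'; split=> //.
by rewrite -vertex_natural vt'.
Qed.
End Cov.

End Transport.

Section Independence.
Variables (J : Type) (dim : J -> nat) (S : J -> profiniteType).
Local Notation W := (cofree dim S).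
Variable w : W 0%N.
Variables (E X V : pspace) (p : pmap E X) (al : pmap (prod_pspace V W) E).
Hypothesis cov : is_covering p.
Variable pi : pmap V X.
Hypothesis al_over : forall n v om, p n (al n (v, om)) = pi n v.

(** A lift to a covering of a map that ignores the contractible factor also
    ignores it: along the contraction of that factor it moves by lifts of
    degenerate edges. *)
Lemma covering_independent n v om : al n (v, om) = al n (v, cst w n).
Proof.
have v0 (v0 : V 0%N) om0 : al 0%N (v0, om0) = al 0%N (v0, w).
  pose e := contract_edge w v0 om0.
  have ee : al 1%N e = cst (al 0%N (v0, om0)) 1.
    apply: (covering_vertex_inj cov (i := ord0)).
      have -> : p 1%N (al 1%N e) = pi 1%N (cst v0 1) := al_over _ _.
      by rewrite pmap_cst pmap_cst al_over.
    by rewrite -vertex_natural contract_edge0 vertex_cst.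
  by rewrite -[in RHS](contract_edge1 w v0 om0) vertex_natural ee vertex_cst.
apply: (covering_vertex_inj cov (i := ord0)); first by rewrite !al_over.
rewrite -!vertex_natural /vertex !prod_smapE smap_cst cst0; exact: v0.
Qed.
End Independence.

(** * Galois coverings of the product *)

Section Galois.
Variables (Z : pspace) (J : Type) (dim : J -> nat) (S : J -> profiniteType).
Local Notation W := (cofree dim S).
Local Notation T := (prod_pspace Z W).

Definition times_id (A B : pspace) (f : pmap A B) : pmap (prod_pspace A W) (prod_pspace B W) :=
  pair_pmap (pmap_comp f (prod_fst A W)) (prod_snd A W).

Lemma times_id_iso (A B : pspace) (f : pmap A B) : pmap_iso f -> pmap_iso (times_id f).
Proof.
move=> [g [gf fg]]; exists (times_id g); split=> n [a om] /=.
  by rewrite /pmap_comp_fun /= /pmap_comp_fun /= gf.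
by rewrite /pmap_comp_fun /= /pmap_comp_fun /= fg.
Qed.

Section Slice.
Variable w : W 0%N.
Variables (A B : pspace) (al : pmap (prod_pspace A W) (prod_pspace B W)).
Definition slice : pmap A B :=
  pmap_comp (prod_fst B W) (pmap_comp al (pair_pmap (pmap_id A) (base_pmap w A))).
Lemma sliceE n a : slice n a = (al n (a, cst w n)).1.
Proof. by []. Qed.
End Slice.

Lemma slice_iso (w : W 0%N) (A B : pspace) (al : pmap (prod_pspace A W) (prod_pspace B W)) :
  (forall n q, (al n q).2 = q.2) -> pmap_iso al -> pmap_iso (slice w al).
Proof.
move=> al2 [g [gal alg]]; exists (slice w g); split=> n a; rewrite !sliceE.
  have -> : ((al n (a, cst w n)).1, cst w n) = al n (a, cst w n).
    by rewrite [RHS]surjective_pairing al2.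
  by rewrite gal.
have -> : ((g n (a, cst w n)).1, cst w n) = g n (a, cst w n).
  by rewrite [RHS]surjective_pairing -[(g n _).2]al2 alg.
by rewrite alg.
Qed.

Section Restrict.
Variables (x : Z 0%N) (w : W 0%N).
Let xw : T 0%N := (x, w).
Variable D : galois xw.
Local Notation p := (gal_proj D).
Local Notation cov := (@gal_covering _ _ D).
Local Notation D' := (restricted w p).
Local Notation p' := (restricted_proj w p).
Local Notation inc := (restricted_incl w p).

Lemma galois_base_pt : over_base w p (gal_pt D).
Proof. by rewrite /over_base /mkset gal_ptP cst0. Qed.

Definition restricted_pt : D' 0%N :=
  sub_elt (@over_base_closed _ _ _ _ w _ p) (@over_base_smap _ _ _ _ w _ p) galois_base_pt.

Lemma restricted_ptP : p' 0%N restricted_pt = x.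
Proof. by rewrite /restricted_proj /= /pmap_comp_fun /= /pmap_comp_fun /= gal_ptP. Qed.

Lemma restricted_connected : connected_pspace D'.
Proof.
split; first by exists restricted_pt.
move=> y y' Y h ch hE.
have := (gal_connected D).2 (inc 0%N y) (inc 0%N y') Y
  (fun d => h (retr w cov 0%N d)).
rewrite !retr_incl; apply.
  by apply: (@comp_continuous _ _ _ (retr w cov 0%N)) => //; exact: pmap_continuous.
by move=> e; have := hE (retr w cov 1%N e); rewrite /d0 /d1 /face -!pmap_natural.
Qed.

Lemma restricted_onto y : same_component x y -> exists e, p' 0%N e = y.
Proof.
move=> xy; have [|d pd] := @gal_onto _ _ D ((y, w) : T 0%N).
  move=> Y h ch hE; apply: (xy Y (fun z => h (z, w))).
    apply: (@comp_continuous _ _ _ (fun z : Z 0%N => (z, w) : T 0%N)) => //.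
    apply: pair_continuous; [exact: (fun x => @cvg_id _ _)|exact: cst_continuous].
  move=> e; have := hE (e, cst w 1).
  by rewrite /d0 /d1 /face !prod_smapE !smap_cst cst0.
have bd : over_base w p d by rewrite /over_base /mkset pd cst0.
exists (sub_elt (@over_base_closed _ _ _ _ w _ p) (@over_base_smap _ _ _ _ w _ p) bd).
by rewrite /restricted_proj /= /pmap_comp_fun /= /pmap_comp_fun /= pd.
Qed.

Lemma restricted_finite y : finite_set [set e | p' 0%N e = y].
Proof.
have := @gal_finite _ _ D ((y, w) : T 0%N).
move=> /(finite_preimage (f := inc 0%N)) H.
apply: sub_finite_set (H _); last by move=> a b _ _; exact: restricted_incl_inj.
by move=> e pe; rewrite /preimage /mkset restricted_over (pe : p' 0%N e = y) cst0.
Qed.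

Lemma deck_base (h : pmap D D) : is_deck p h ->
  forall n (d : D' n), over_base w p (h n (inc n d)).
Proof.
by move=> [_ hp] n d; rewrite /over_base /mkset hp restricted_over.
Qed.

Definition restrict_map (h : pmap D D) (hb : forall n (d : D' n), over_base w p (h n (inc n d))) :
    pmap D' D' :=
  sub_corestr (@over_base_closed _ _ _ _ w _ p) (@over_base_smap _ _ _ _ w _ p)
    (f := pmap_comp h inc) hb.

Lemma restrict_mapE h hb n d : inc n (@restrict_map h hb n d) = h n (inc n d).
Proof. by []. Qed.

Lemma deck_inverse (E X : pspace) (q : pmap E X) (h g : pmap E E) : is_deck q h ->
  (forall n e, g n (h n e) = e) -> (forall n e, h n (g n e) = e) -> is_deck q g.
Proof.
move=> [_ hp] gh hg; split; first by exists h.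
by move=> n e; rewrite -hp hg.
Qed.

Lemma restrict_deck h (dh : is_deck p h) : is_deck p' (restrict_map (deck_base dh)).
Proof.
have [[g [gh hg]] hp] := dh.
have dg := deck_inverse dh gh hg.
split; last first.
  move=> n d; have := hp n (inc n d).
  by rewrite -(restrict_mapE (deck_base dh)) !restricted_over => -[].
exists (restrict_map (deck_base dg)); split=> n d; apply: restricted_incl_inj;
  by rewrite !restrict_mapE ?gh ?hg.
Qed.

(** A deck transformation of the slice acts on the whole covering through the
    trivialization. *)
Definition extend_map (h : pmap D' D') : pmap D D :=
  pmap_comp (triv w cov) (pair_pmap (pmap_comp h (retr w cov))
    (pmap_comp (prod_snd Z W) p)).

Lemma extend_mapE h n d : extend_map h n d = triv w cov n (h n (retr w cov n d), (p n d).2).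
Proof. by []. Qed.

Lemma extend_map_incl h n d : extend_map h n (inc n d) = inc n (h n d).
Proof. by rewrite extend_mapE retr_incl restricted_over triv_base. Qed.

Lemma extend_deck h : is_deck p' h -> is_deck p (extend_map h).
Proof.
move=> [[g [gh hg]] hp].
have over (k : pmap D' D') n d : (forall n e, p' n (k n e) = p' n e) -> p n (extend_map k n d) = p n d.
  by move=> kp; rewrite extend_mapE triv_over kp retr_proj; case: (p n d).
have gp n e : p' n (g n e) = p' n e by rewrite -hp hg.
have comp (k l : pmap D' D') n d : (forall n e, p' n (l n e) = p' n e) -> (forall n e, k n (l n e) = e) ->
    extend_map k n (extend_map l n d) = d.
  move=> lp kl; rewrite [LHS]extend_mapE over // [extend_map l n d]extend_mapE retrK kl.
  by rewrite trivK.
split; last by move=> n e; exact: over.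
by exists (extend_map g); split=> n d; exact: comp.
Qed.

Lemma restricted_galois_axiom (e e' : D' 0%N) : p' 0%N e = p' 0%N e' ->
  exists! h : pmap D' D', is_deck p' h /\ h 0%N e = e'.
Proof.
move=> pe.
have [|h [[dh he] hU]] := @gal_galois _ _ D (inc 0%N e) (inc 0%N e').
  by rewrite !restricted_over pe.
exists (restrict_map (deck_base dh)); split.
  by split; [exact: restrict_deck|apply: restricted_incl_inj; rewrite restrict_mapE].
move=> k [dk ke].
have hk : h = extend_map k.
  by apply: hU; split; [exact: extend_deck|rewrite extend_map_incl ke].
apply: pmap_ext => n d; apply: restricted_incl_inj.
by rewrite restrict_mapE hk extend_map_incl.
Qed.

Definition restricted_galois : galois x :=
  @Galois Z x D' p' restricted_pt restricted_ptP restricted_connected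
    (restricted_covering cov) restricted_onto restricted_finite
    restricted_galois_axiom.
End Restrict.

Section ProductGalois.
Variables (x : Z 0%N) (w : W 0%N).
Let xw : T 0%N := (x, w).
Variable E : galois x.
Local Notation p := (gal_proj E).
Local Notation cov := (@gal_covering _ _ E).
Local Notation EW := (prod_pspace E W).
Local Notation pW := (times_id p).

Lemma product_covering : is_covering pW.
Proof.
move=> n i [s om] [e o] H.
have vs : vertex i s = p 0%N e := congr1 fst H.
have vo : vertex i om = o := congr1 snd H.
have [t [[pt vt] tU]] := cov vs.
exists (t, om); split.
  split; first by rewrite /= /pmap_comp_fun /= pt.
  by rewrite /vertex prod_smapE -/(vertex i t) vt -/(vertex i om) vo.
move=> [t' om'] [] /= -[+ ->] [+ _]; rewrite /pmap_comp_fun /= => pt' vt'.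
by rewrite (tU t').
Qed.

Lemma product_connected : connected_pspace EW.
Proof.
split; first by exists (gal_pt E, w).
move=> [y o] [y' o'] Y h ch hE.
have hb v om : h (v, om) = h (v, w).
  by have := hE (contract_edge w v om); rewrite d0E d1E contract_edge0 contract_edge1.
rewrite !hb.
apply: ((gal_connected E).2 y y' Y (fun v => h (v, w))).
  apply: (@comp_continuous _ _ _ (fun z : E 0%N => (z, w) : EW 0%N)) => //.
  apply: pair_continuous; [exact: (fun x => @cvg_id _ _)|exact: cst_continuous].
by move=> e; have := hE (e, cst w 1); rewrite /d0 /d1 /face !prod_smapE !smap_cst cst0.
Qed.

Lemma product_onto y : same_component xw y -> exists e, pW 0%N e = y.
Proof.
case: y => y o xy; have [|e pe] := @gal_onto _ _ E y.
  move=> Y h ch hE; apply: (xy Y (fun z => h z.1)).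
    by apply: (@comp_continuous _ _ _ fst) => //; exact: fst_continuous.
  by move=> [e e']; have := hE e.
by exists (e, o); rewrite /= /pmap_comp_fun /= pe.
Qed.

Lemma product_finite y : finite_set [set e | pW 0%N e = y].
Proof.
have := @gal_finite _ _ E y.1.
move=> /(finite_image (fun e => (e, y.2))); apply: sub_finite_set => -[e o] /= <- /=.
by exists e.
Qed.

(** A deck transformation [k] of the product is the identity on the second
    factor, and its first component is a lift to [E], hence independent of the
    contractible factor. So [k] comes from a deck transformation of [E]. *)
Lemma product_galois_axiom (e e' : EW 0%N) : pW 0%N e = pW 0%N e' ->
  exists! h : pmap EW EW, is_deck pW h /\ h 0%N e = e'.
Proof.
case: e e' => [e o] [e' o'] /= [+ <-]; rewrite /pmap_comp_fun /= => pe {o'}.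
have [h [[[hi hp] he] hU]] := gal_galois pe.
exists (times_id h); split.
  split; last by rewrite /= /pmap_comp_fun /= he.
  split; first exact: times_id_iso.
  by move=> n [v om]; rewrite /= /pmap_comp_fun /= /pmap_comp_fun /= hp.
move=> k [[ki kp] ke].
have k2 n q : (k n q).2 = q.2 by have /(congr1 snd) := kp n q.
have k1 n q : p n (k n q).1 = p n q.1 by have /(congr1 fst) := kp n q.
have ind n v om : (k n (v, om)).1 = slice w k n v.
  rewrite sliceE.
  apply: (@covering_independent _ _ _ w _ _ _ p (pmap_comp (prod_fst E W) k) cov p).
  by move=> m u o1; rewrite /= /pmap_comp_fun /= k1.
have hk : h = slice w k.
  apply: hU; split; first split.
  - by apply: slice_iso ki; exact: k2.
  - by move=> n v; rewrite sliceE k1.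
  - by rewrite -(ind _ _ o) ke.
apply: pmap_ext => n [v om]; rewrite /= /pmap_comp_fun /= hk.
by rewrite -(ind _ _ om) [RHS]surjective_pairing (k2 n (v, om)).
Qed.

Lemma product_ptP : pW 0%N (gal_pt E, w) = xw.
Proof. by rewrite /= /pmap_comp_fun /= gal_ptP. Qed.

Definition product_galois : galois xw :=
  @Galois T xw EW pW (gal_pt E, w) product_ptP product_connected
    product_covering product_onto product_finite product_galois_axiom.
End ProductGalois.
End Galois.

(** * Components *)
Section Component.
Variable X : pspace.

Definition edge_closed (P : set (X 0%N)) := forall e : X 1%N, P (d0 e) <-> P (d1 e).

Lemma same_componentP (x y : X 0%N) : same_component x y <->
  (forall P, clopen P -> edge_closed P -> P x -> P y).
Proof.
split=> [xy P [oP cP] eP Px|xy Y h ch hE].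
  pose h (z : X 0%N) : finite_space bool := `[< P z >].
  have ch : continuous h.
    apply: to_finite_continuous => -[].
      rewrite (_ : [set z | h z = true] = P) //.
      by apply/seteqP; split=> z; [move=> /asboolP|move=> Pz; exact/asboolP].
    rewrite (_ : [set z | h z = false] = ~` P); first exact: closed_openC.
    apply/seteqP; split=> z; first by move=> /asboolPn.
    by move=> nPz; apply/asboolPn.
  have := xy _ h ch; rewrite /h => H; apply/asboolP; rewrite -H; first exact/asboolP.
  by move=> e; apply/asboolP/asboolP => /eP.
apply: contrapT => /clopen_points [C [cC Cx]]; apply.
apply: (xy (h @^-1` C)) => //; first exact: preimage_clopen.
by move=> e; rewrite /preimage /= hE.
Qed.

Lemma same_component_refl (x : X 0%N) : same_component x x.
Proof. by move=> Y h. Qed.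

Lemma same_component_sym (x y : X 0%N) : same_component x y -> same_component y x.
Proof. by move=> xy Y h ch hE; rewrite (xy Y h). Qed.

Lemma same_component_trans (y x z : X 0%N) :
  same_component x y -> same_component y z -> same_component x z.
Proof. by move=> xy yz Y h ch hE; rewrite (xy Y h) // (yz Y h). Qed.

Lemma same_component_edge (e : X 1%N) : same_component (d0 e) (d1 e).
Proof. by move=> Y h ch hE; exact: hE. Qed.

Lemma same_component_vertex n (s : X n) (i : 'I_n.+1) :
  same_component (vertex ord0 s) (vertex i s).
Proof.
have := same_component_edge (smap (edge_to i) s).
rewrite d0E d1E !vertex_smap; apply: same_component_sym.
Qed.

Variable x : X 0%N.
Definition in_component n : set (X n) := [set s | same_component x (vertex ord0 s)].

Lemma in_component_closed n : closed (@in_component n).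
Proof.
rewrite -openC openE => s /= ns.
have [P [cP [eP [Px nPs]]]] : exists P, clopen P /\ (edge_closed P /\ (P x /\ ~ P (vertex ord0 s))).
  apply: contrapT => nex; apply: ns; apply/same_componentP => P cP eP Px.
  by apply: contrapT => nPs; apply: nex; exists P.
have : nbhs s (vertex ord0 @^-1` (~` P)).
  have cv : continuous (@vertex X n ord0) by exact: smap_continuous.
  by apply: open_nbhs_nbhs; split => //; apply: (open_preimage cv); apply: closed_openC; case: cP.
apply: filterS => s' nPs' /same_componentP /(_ P cP eP Px); exact: nPs'.
Qed.

Lemma in_component_smap m n (t : delta m n) s : in_component s -> in_component (smap t s).
Proof.
rewrite /in_component /mkset vertex_smap => xs.
exact: same_component_trans xs (same_component_vertex _ _).
Qed.

Definition component : pspace := sub_pspace in_component_closed in_component_smap.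
Definition component_incl : pmap component X := sub_incl _ _.

Lemma component_incl_inj n : injective (component_incl n).
Proof. exact: sub_incl_inj. Qed.

Lemma in_component0 (y : X 0%N) : in_component y <-> same_component x y.
Proof. by rewrite /in_component /mkset vertex0. Qed.

(** A separation of the component by [h] extends to a clopen set [A] of
    vertices. No edge over the component crosses the boundary of [A], so by
    compactness no edge over some edge-closed clopen set [P] around [x] does;
    then the intersection of [P] and [A] separates two points of one component. *)
Lemma component_connected_aux (y y' : component 0%N) (Y : profiniteType)
    (h : component 0%N -> Y) (B : set Y) : continuous h ->
  (forall e, h (d0 e) = h (d1 e)) -> clopen B -> B (h y) -> B (h y').
Proof.
move=> ch hE cB By; apply: contrapT => nBy'.
have clA (C : set Y) : closed C -> closed (component_incl 0%N @` (h @^-1` C)).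
  move=> cC; apply: compact_closed; first exact: profinite_hausdorff.
  apply: continuous_compact; first by apply: continuous_subspaceT; exact: pmap_continuous.
  apply: subclosed_compact (@profinite_compact _) _ => //.
  exact: closed_preimage.
have [|||A [cA A1 A2]] := @clopen_separate _ (component_incl 0%N @` (h @^-1` B))
    (component_incl 0%N @` (h @^-1` (~` B))).
- by apply: clA; case: cB.
- by apply: clA; apply: open_closedC; case: cB.
- by move=> _ [c /= Bc <-] [c' /= nBc'] /component_incl_inj e; apply: nBc'; rewrite e.
pose K : set (set (X 0%N)) := [set P | clopen P /\ (edge_closed P /\ P x)].
have KI P Q : K P -> K Q -> K (P `&` Q).
  move=> [cP [eP Px]] [cQ [eQ Qx]]; split; first exact: clopenI.
  by split=> // e; split=> -[/eP ? /eQ ?].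
have KT : K setT by split; [exact: clopenT|].
have cd0 : continuous (@d0 X) by exact: smap_continuous.
have cd1 : continuous (@d1 X) by exact: smap_continuous.
pose K' : set (set (X 1%N)) := [set @d0 X @^-1` P | P in K].
have [|||||_ [P [cP [eP Px]] <-] PO] := @clopen_family_inter (X 1%N) K'
    [set e | A (d0 e) <-> A (d1 e)] (@profinite_compact _).
- move=> _ [P [cP _] <-]; apply: closed_preimage => //; by case: cP.
- by exists setT.
- by move=> _ _ [P KP <-] [Q KQ <-]; exists (P `&` Q); [exact: KI|].
- rewrite openE => e /= ee.
  have n0 : nbhs e (@d0 X @^-1` [set z | A z <-> A (d0 e)]) by apply: cd0; exact: clopen_near.
  have n1 : nbhs e (@d1 X @^-1` [set z | A z <-> A (d1 e)]) by apply: cd1; exact: clopen_near.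
  by apply: filterS (filterI n0 n1) => e' [/= -> ->].
- move=> e He.
  have xe : same_component x (d0 e).
    apply/same_componentP => P cP eP Px.
    by apply: (He (@d0 X @^-1` P)); exists P.
  have xe1 : in_component e.
    rewrite /in_component /mkset -d1E.
    exact: same_component_trans xe (same_component_edge e).
  pose e1 : component 1%N := sub_elt in_component_closed in_component_smap xe1.
  have i0 : component_incl 0%N (d0 e1) = d0 e by [].
  have i1 : component_incl 0%N (d1 e1) = d1 e by [].
  have ab (c : component 0%N) : A (component_incl 0%N c) <-> B (h c).
    split=> [Ac|Bc]; last by apply: A1; exists c.
    by apply: contrapT => nBc; apply: (A2 _ _ Ac); exists c.
  by rewrite /= -i0 -i1 !ab hE.
have ePA : edge_closed (P `&` A).
  move=> e; split=> -[Pe Ae].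
    by split; [exact/eP|exact/(PO e)].
  have Pe0 : P (d0 e) by exact/eP.
  by split=> //; exact/(PO e).
have yx : same_component (component_incl 0%N y) (component_incl 0%N y').
  apply: (@same_component_trans x); first apply: same_component_sym; apply/in_component0; exact: sub_inclP.
have Py : P (component_incl 0%N y).
  have /in_component0/same_componentP : in_component (component_incl 0%N y) by exact: sub_inclP.
  by apply.
have [|_ Ay'] := (same_componentP _ _).1 yx (P `&` A) (clopenI cP cA) ePA.
  by split=> //; apply: A1; exists y.
by apply: A2 Ay'; exists y'.
Qed.

Lemma component_connected : connected_pspace component.
Proof.
split.
  by exists (sub_elt in_component_closed in_component_smap ((in_component0 x).2 (@same_component_refl x))).
move=> y y' Y h ch hE; apply: contrapT => /clopen_points [C [cC Cy]]; apply.
exact: component_connected_aux cC Cy.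
Qed.

Lemma component_covering : is_covering component_incl.
Proof.
move=> n i s e vs.
have xs : in_component s.
  have : in_component (component_incl 0%N e) by exact: sub_inclP.
  move=> /in_component0; rewrite -vs /in_component /mkset => xi.
  apply: same_component_trans xi _; apply: same_component_sym.
  exact: same_component_vertex.
exists (sub_elt in_component_closed in_component_smap xs); split.
  by split=> //; exact: component_incl_inj.
by move=> t [ts _]; apply: component_incl_inj.
Qed.

Definition component_pt : component 0%N :=
  sub_elt in_component_closed in_component_smap
    ((in_component0 x).2 (@same_component_refl x)).

Lemma component_onto y : same_component x y -> exists e, component_incl 0%N e = y.
Proof.
by move=> /in_component0 xy; exists (sub_elt in_component_closed in_component_smap xy).
Qed.

Lemma component_finite y : finite_set [set e | component_incl 0%N e = y].
Proof.
apply: sub_finite_set (finite_preimage (f := component_incl 0%N) _ (finite_set1 y)).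
  by [].
by move=> a b _ _; exact: component_incl_inj.
Qed.

Lemma component_galois_axiom (e e' : component 0%N) :
  component_incl 0%N e = component_incl 0%N e' ->
  exists! h : pmap component component, is_deck component_incl h /\ h 0%N e = e'.
Proof.
move=> /component_incl_inj <-; exists (pmap_id _); split.
  by split=> //; split=> //; exists (pmap_id _).
by move=> h [[_ hp] _]; apply: pmap_ext => n z; apply: component_incl_inj; rewrite hp.
Qed.

(** The component of [x], as a covering with trivial deck group, is terminal
    among the Galois coverings. All members of a cone over these coverings
    therefore have the same image in the base. *)
Definition component_galois : galois x :=
  @Galois X x component component_incl component_pt erefl component_connected
    component_covering component_onto component_finite component_galois_axiom.

Lemma galois_component (D : galois x) n (d : D n) : in_component (gal_proj D n d).
Proof.
rewrite /in_component /mkset -vertex_natural => Y h ch hE.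
transitivity (h (gal_proj D 0%N (gal_pt D))); first by rewrite gal_ptP.
apply: ((gal_connected D).2 _ _ Y (fun z => h (gal_proj D 0%N z))).
  by apply: (@comp_continuous _ _ _ (gal_proj D 0%N)) => //; exact: pmap_continuous.
by move=> e; have := hE (gal_proj D 1%N e); rewrite /d0 /d1 /face -!pmap_natural.
Qed.

Definition to_component (D : galois x) : pmap D component_galois :=
  sub_corestr in_component_closed in_component_smap (@galois_component D).

Lemma to_component_map (D : galois x) : galois_map (to_component D).
Proof.
split=> [n e|] //; apply: component_incl_inj.
by rewrite /component_incl [LHS]sub_corestrK gal_ptP.
Qed.
End Component.

Lemma uc_proj_pt (X : pspace) (x : X 0%N) (U : univ_cover x) : uc_proj U 0%N (uc_pt U) = x.
Proof. by rewrite -(uc_cone_proj (component_galois x)) uc_cone_pt gal_ptP. Qed.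

(** * Universal coverings of products with contractible spaces *)
Section UniversalProduct.
Variables (Z : pspace) (J : Type) (dim : J -> nat) (S : J -> profiniteType).
Local Notation W := (cofree dim S).
Local Notation T := (prod_pspace Z W).
Variables (x : Z 0%N) (w : W 0%N).
Let xw : T 0%N := (x, w).

Lemma joined_map (D E : galois xw) (m : pmap D E) : galois_map m ->
  forall y y', joined w (gal_proj D) y y' -> joined w (gal_proj E) (m 0%N y) (m 0%N y').
Proof.
move=> [mo _] y y' [e [pe e0 e1]]; exists (m 1%N e).
by split; rewrite ?mo // -vertex_natural ?e0 ?e1.
Qed.

Lemma restricted_map_base (D E : galois xw) (m : pmap D E) : galois_map m ->
  forall n (d : restricted w (gal_proj D) n),
    over_base w (gal_proj E) (m n (restricted_incl w (gal_proj D) n d)).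
Proof. by move=> [mo _] n d; rewrite /over_base /mkset mo restricted_over. Qed.

Definition restricted_map (D E : galois xw) (m : pmap D E) (gm : galois_map m) :
    pmap (restricted_galois D) (restricted_galois E) :=
  sub_corestr (@over_base_closed _ _ _ _ w _ _) (@over_base_smap _ _ _ _ w _ _)
    (f := pmap_comp m (restricted_incl w (gal_proj D))) (restricted_map_base gm).

Lemma restricted_mapE (D E : galois xw) (m : pmap D E) (gm : galois_map m) n d :
  restricted_incl w (gal_proj E) n (restricted_map gm n d) =
  m n (restricted_incl w (gal_proj D) n d).
Proof. by []. Qed.

Lemma restricted_map_galois (D E : galois xw) (m : pmap D E) (gm : galois_map m) :
  galois_map (restricted_map gm).
Proof.
have [mo mp] := gm; split=> [n d|]; last by apply: restricted_incl_inj; rewrite restricted_mapE.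
have := mo n (restricted_incl w (gal_proj D) n d).
by rewrite -(restricted_mapE gm) !restricted_over => -[].
Qed.

Local Notation cov D := (@gal_covering _ _ D).

Lemma triv_map (D E : galois xw) (m : pmap D E) (gm : galois_map m) n d om :
  m n (triv w (cov D) n (d, om)) = triv w (cov E) n (restricted_map gm n d, om).
Proof.
have ov k d' o : gal_proj E k (m k (triv w (cov D) k (d', o))) =
    gal_proj E k (triv w (cov E) k (restricted_map gm k d', o)).
  by rewrite gm.1 !triv_over [in RHS](restricted_map_galois gm).1.
apply: (covering_vertex_inj (cov E) (i := ord0)); first exact: ov.
rewrite -!vertex_natural /vertex !prod_smapE -[smap _ (restricted_map gm n d)]pmap_natural.
set d0 := smap _ d; set o0 := smap _ om.
apply: (joined_inj (cov E)); [|exact: triv_joined|exact: ov].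
by rewrite restricted_mapE; apply: (joined_map gm); exact: triv_joined.
Qed.

Lemma triv_galois (D : galois xw) :
  @galois_map _ _ (product_galois w (restricted_galois D)) D (triv w (cov D)).
Proof.
split=> [n [d om]|]; first by rewrite triv_over.
have := triv_base (w := w) (cov D) (gal_pt (restricted_galois D)).
by rewrite cst0.
Qed.

Lemma times_id_galois (E E' : galois x) (m : pmap E E') : galois_map m ->
  @galois_map _ _ (product_galois w E) (product_galois w E') (times_id _ _ m).
Proof.
move=> [mo mp]; split=> [n [e om]|]; rewrite /= /pmap_comp_fun /= /pmap_comp_fun /=.
  by rewrite mo.
by rewrite mp.
Qed.

Variable V : univ_cover x.
Local Notation VW := (prod_pspace V W).

Definition uw_proj : pmap VW T := times_id _ _ (uc_proj V).
Definition uw_cone (D : galois xw) : pmap VW D :=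
  pmap_comp (triv w (cov D)) (times_id _ _ (uc_cone V (restricted_galois D))).

Lemma uw_coneE D n v om : uw_cone D n (v, om) =
  triv w (cov D) n (uc_cone V (restricted_galois D) n v, om).
Proof. by []. Qed.

Lemma uw_cone_proj D n u : gal_proj D n (uw_cone D n u) = uw_proj n u.
Proof.
case: u => v om; rewrite uw_coneE triv_over.
by rewrite (uc_cone_proj (restricted_galois D)).
Qed.

Lemma uw_cone_pt D : uw_cone D 0%N (uc_pt V, w) = gal_pt D.
Proof. by rewrite uw_coneE uc_cone_pt (triv_galois D).2. Qed.

Lemma uw_cone_map (D E : galois xw) (m : pmap D E) : galois_map m ->
  forall n u, m n (uw_cone D n u) = uw_cone E n u.
Proof.
move=> gm n [v om]; rewrite !uw_coneE (triv_map gm).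
by rewrite (uc_cone_map (restricted_map_galois gm)).
Qed.

Section Limit.
Variables (Q : pspace) (z : forall D : galois xw, pmap Q D).
Hypothesis zm : forall (D E : galois xw) (m : pmap D E), galois_map m ->
  forall n q, m n (z D n q) = z E n q.

Lemma limit_proj (D : galois xw) n q :
  gal_proj D n (z D n q) =
  gal_proj (component_galois xw) n (z (component_galois xw) n q).
Proof. by rewrite -(zm (to_component_map D)) (to_component_map D).1. Qed.

Lemma restricted_product_map (E : galois x) :
  @galois_map _ _ (restricted_galois (product_galois w E)) E
    (pmap_comp (prod_fst E W) (restricted_incl w (gal_proj (product_galois w E)))).
Proof. by split. Qed.

Lemma triv_product (E : galois x) n d om :
  (triv w (cov (product_galois w E)) n (d, om)).1 =
  (restricted_incl w (gal_proj (product_galois w E)) n d).1.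
Proof.
pose PE := product_galois w E.
have H := @covering_independent _ _ _ w _ _ _ (gal_proj E)
  (pmap_comp (prod_fst E W) (triv w (cov PE))) (cov E)
  (restricted_proj w (gal_proj PE)) _ n d om.
have := H _; rewrite /= /pmap_comp_fun /= triv_base; apply.
move=> k d' o; have := congr1 fst (triv_over (w := w) (cov PE) d' o).
by [].
Qed.

(** A cone is determined by its first components on the coverings [E * W],
    since every covering of the product is of this form, and by its second
    component in [W], which is common to all of its members. *)
Lemma uw_limit : exists! h : pmap Q VW,
  forall (D : galois xw) n q, uw_cone D n (h n q) = z D n q.
Proof.
have [|h1 [h1P h1U]] := @uc_limit _ _ V Q
  (fun E => pmap_comp (prod_fst E W) (z (product_galois w E))).
  move=> E E' m gm n q; rewrite /= /pmap_comp_fun /=.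
  by rewrite -(zm (times_id_galois gm)).
pose h2 : pmap Q W := pmap_comp (prod_snd Z W)
  (pmap_comp (gal_proj (component_galois xw)) (z (component_galois xw))).
have h2E (D : galois xw) n q : (gal_proj D n (z D n q)).2 = h2 n q by rewrite limit_proj.
exists (pair_pmap h1 h2); split.
  move=> D n q; rewrite [LHS]uw_coneE h1P -(zm (triv_galois D)); congr (triv _ _ _ _).
  rewrite [RHS]surjective_pairing; congr (_, _).
  by rewrite -(h2E (product_galois w (restricted_galois D))).
move=> h hP.
have e1 : h1 = pmap_comp (prod_fst V W) h.
  apply: h1U => E n q; rewrite [RHS]/= /pmap_comp_fun -(hP (product_galois w E)).
  rewrite [h n q]surjective_pairing uw_coneE triv_product.
  by rewrite -(uc_cone_map (restricted_product_map E)).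
apply: pmap_ext => n q; rewrite [RHS]surjective_pairing.
transitivity (h1 n q, h2 n q) => //; rewrite e1; congr (_, _).
by rewrite -(h2E (component_galois xw)) -hP uw_cone_proj.
Qed.
End Limit.

Definition product_univ_cover : univ_cover xw :=
  @UnivCover T xw VW uw_proj (uc_pt V, w) uw_cone uw_cone_proj uw_cone_pt
    uw_cone_map uw_limit.
End UniversalProduct.

(** * The prism homotopy *)

Section MkDelta.
Variables (m n : nat) (f : nat -> nat).
Hypothesis fm : {homo f : i j / (i <= j)%N}.
Definition mkdelta_fun (j : 'I_m.+1) : 'I_n.+1 := inord (minn (f j) n).
Lemma mkdelta_val j : mkdelta_fun j = minn (f j) n :> nat.
Proof. by rewrite inordK // ltnS geq_minr. Qed.
Lemma mkdelta_mono : {homo mkdelta_fun : i j / (i <= j)%N}.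
Proof. by move=> i j /fm ij; rewrite !mkdelta_val leq_min geq_minr andbT (leq_trans (geq_minl _ _)). Qed.
Definition mkdelta : delta m n := Delta mkdelta_mono.
Lemma mkdeltaE j : mkdelta j = minn (f j) n :> nat. Proof. exact: mkdelta_val. Qed.
End MkDelta.

Definition collapse (i j : nat) : nat := (j - (i < j))%N.
Lemma collapse_mono i : {homo collapse i : j k / (j <= k)%N}.
Proof. by move=> j k; rewrite /collapse; lia. Qed.
Definition from (c j : nat) : nat := (c <= j)%N.
Lemma from_mono c : {homo from c : j k / (j <= k)%N}.
Proof. by move=> j k; rewrite /from; lia. Qed.
Lemma cofaceE n (i : 'I_n.+2) (k : 'I_n.+1) : coface i k = ((i <= k) + k)%N :> nat.
Proof. by []. Qed.

Section Prism.
Variables (A : pspace) (J : Type) (dim : J -> nat) (S : J -> profiniteType).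
Local Notation W := (cofree dim S).
Local Notation AW := (prod_pspace A W).
Variable w : W 0%N.

(** The prism operator [prism i] repeats the vertex [i] and contracts from the
    second copy on; [cut c] contracts from the vertex [c] on. *)
Definition prism n (i : nat) (y : AW n) : AW n.+1 :=
  (smap (mkdelta n.+1 n (@collapse_mono i)) y.1,
   contract w (mkdelta n.+1 n (@collapse_mono i)) (mkdelta n.+1 1 (@from_mono i.+1)) y.2).

Definition cut n (c : nat) (y : AW n) : AW n :=
  (y.1, contract w (delta_id n) (mkdelta n 1 (@from_mono c)) y.2).

Lemma face_prod n (i : 'I_n.+2) (v : A n.+1) (om : W n.+1) :
  face i ((v, om) : AW n.+1) = (face i v, face i om).
Proof. by []. Qed.

Lemma face_prism_lt r (i : nat) (j : 'I_r.+3) (y : AW r.+1) (ji : (j < i)%N) (ir : (i <= r.+1)%N) :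
  face j (prism i y) = prism i.-1 (face (inord j : 'I_r.+2) y).
Proof.
have jr : (j < r.+2)%N by lia.
have E (k : 'I_r.+2) : mkdelta r.+2 r.+1 (@collapse_mono i) (coface j k) =
    coface (inord j) (mkdelta r.+1 r (@collapse_mono i.-1) k) :> nat.
  rewrite mkdeltaE !cofaceE mkdeltaE inordK // /collapse.
  by have := ltn_ord k; lia.
case: y => v om; rewrite /prism !face_prod; congr (_, _); first exact: smap_comp2.
rewrite /face (contract_comp (delta_comp (coface (inord j)) (mkdelta r.+1 r (@collapse_mono i.-1)))) //.
apply: contract_smap => k; first exact: E.
by rewrite !mkdeltaE !cofaceE /from; have := ltn_ord k; lia.
Qed.

Lemma face_prism_gt r (i : nat) (j : 'I_r.+3) (y : AW r.+1) (ji : (i.+1 < j)%N) :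
  face j (prism i y) = prism i (face (inord j.-1 : 'I_r.+2) y).
Proof.
have jr : (j.-1 < r.+2)%N by have := ltn_ord j; lia.
have E (k : 'I_r.+2) : mkdelta r.+2 r.+1 (@collapse_mono i) (coface j k) =
    coface (inord j.-1) (mkdelta r.+1 r (@collapse_mono i) k) :> nat.
  rewrite mkdeltaE !cofaceE mkdeltaE inordK // /collapse.
  by have := ltn_ord k; have := ltn_ord j; lia.
case: y => v om; rewrite /prism !face_prod; congr (_, _); first exact: smap_comp2.
rewrite /face (contract_comp (delta_comp (coface (inord j.-1)) (mkdelta r.+1 r (@collapse_mono i)))) //.
apply: contract_smap => k; first exact: E.
by rewrite !mkdeltaE !cofaceE /from; have := ltn_ord k; lia.
Qed.

Lemma face_prism_eq n (i : nat) (j : 'I_n.+2) (y : AW n) : i = j :> nat -> (i <= n)%N ->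
  face j (prism i y) = cut i y.
Proof.
move=> ij hin.
have E (k : 'I_n.+1) : mkdelta n.+1 n (@collapse_mono i) (coface j k) = k :> nat.
  by rewrite mkdeltaE cofaceE /collapse; have := ltn_ord k; lia.
case: y => v om; rewrite /prism /cut face_prod; congr (_, _).
  by rewrite /face (smap_compE (r := delta_id n)) ?smap_id.
apply: contract_smap => k; first exact: E.
by rewrite !mkdeltaE !cofaceE /from; have := ltn_ord k; lia.
Qed.

Lemma face_prism_succ n (i : nat) (j : 'I_n.+2) (y : AW n) : j = i.+1 :> nat ->
  face j (prism i y) = cut i.+1 y.
Proof.
move=> ij.
have E (k : 'I_n.+1) : mkdelta n.+1 n (@collapse_mono i) (coface j k) = k :> nat.
  by rewrite mkdeltaE cofaceE /collapse; have := ltn_ord k; lia.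
case: y => v om; rewrite /prism /cut face_prod; congr (_, _).
  by rewrite /face (smap_compE (r := delta_id n)) ?smap_id.
apply: contract_smap => k; first exact: E.
by rewrite !mkdeltaE !cofaceE /from; have := ltn_ord k; lia.
Qed.

Lemma cut0 n (y : AW n) : cut 0 y = (y.1, cst w n).
Proof. by rewrite /cut contract1 // => i; rewrite mkdeltaE /from. Qed.

Lemma cut_all n (y : AW n) c : (n < c)%N -> cut c y = y.
Proof.
case: y => v om nc; rewrite /cut contract0 ?smap_id // => i.
by rewrite mkdeltaE /from; have := ltn_ord i; lia.
Qed.
End Prism.

Local Open Scope ring_scope.

Section Signs.
Variable M : zmodType.
Definition sgn (i : nat) (x : M) : M := if odd i then - x else x.
Lemma sgnE i x : x *~ ((-1) ^+ i) = sgn i x.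
Proof.
by rewrite /sgn -signr_odd; case: (odd i); rewrite /= ?expr0 ?expr1 ?mulrNz.
Qed.
Lemma sgnS i x : sgn i.+1 x = - sgn i x.
Proof. by rewrite /sgn /=; case: (odd i) => //; rewrite opprK. Qed.
Lemma sgn_add i j x : sgn i (sgn j x) = sgn (i + j) x.
Proof. by rewrite /sgn oddD; case: (odd i); case: (odd j); rewrite ?opprK. Qed.
Lemma sgnN i x : sgn i (- x) = - sgn i x.
Proof. by rewrite /sgn; case: (odd i). Qed.
Lemma sgn_sum i (I : finType) (F : I -> M) : sgn i (\sum_k F k) = \sum_k sgn i (F k).
Proof. by rewrite /sgn; case: (odd i); rewrite // -sumrN. Qed.

(** The telescoping count behind the prism homotopy. *)
Lemma prism_sum (a : nat -> nat -> M) (c : nat -> M) (G : nat -> nat -> M) n :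
  (forall i j, (j < i)%N -> G i j = - a i.-1 j) ->
  (forall i, G i i = c i) -> (forall i, G i i.+1 = - c i.+1) ->
  (forall i j, (i.+1 < j)%N -> G i j = - a i j.-1) ->
  \sum_(i < n.+1) \sum_(j < n.+2) G i j =
  c 0%N - c n.+1 - \sum_(i < n) \sum_(j < n.+1) a i j.
Proof.
move=> Glt Geq Gsucc Ggt; elim: n => [|n IHn].
  by rewrite big_ord_recr big_ord0 /= !big_ord_recr !big_ord0 /= Geq Gsucc !add0r subr0.
rewrite big_ord_recr /=.
have -> : \sum_(i < n.+1) \sum_(j < n.+3) G i j =
    \sum_(i < n.+1) \sum_(j < n.+2) G i j - \sum_(i < n.+1) a i n.+1.
  rewrite -sumrB; apply: eq_bigr => i _; rewrite big_ord_recr /=; congr (_ + _).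
  by rewrite Ggt // ltnS; case: i.
rewrite IHn.
have -> : \sum_(j < n.+3) G n.+1 j = - (\sum_(j < n.+1) a n j) + c n.+1 - c n.+2.
  rewrite big_ord_recr big_ord_recr /= Geq Gsucc; congr (_ + _ - _).
  by rewrite -sumrN; apply: eq_bigr => j _; rewrite Glt.
rewrite [\sum_(i < n.+1) \sum_(j < n.+2) a i j]big_ord_recr /=.
have -> : \sum_(i < n) \sum_(j < n.+2) a i j =
    \sum_(i < n) \sum_(j < n.+1) a i j + \sum_(i < n) a i n.+1.
  by rewrite -big_split /=; apply: eq_bigr => i _; rewrite big_ord_recr.
rewrite [\sum_(j < n.+2) a n j]big_ord_recr [\sum_(i < n.+1) a i n.+1]big_ord_recr /=.
set x := \sum_(i < n) \sum_(j < n.+1) a i j.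
set y := \sum_(i < n) a i n.+1; set z := \sum_(j < n.+1) a n j.
rewrite !opprD !addrA [LHS](ACl (1*3*4*5*6*8*2*7))%AC /= subrK.
by rewrite [LHS](ACl (1*6*2*3*5*4))%AC.
Qed.
End Signs.

Section PrismHomotopy.
Variables (A : pspace) (J : Type) (dim : J -> nat) (S : J -> profiniteType).
Local Notation W := (cofree dim S).
Local Notation AW := (prod_pspace A W).
Variables (w : W 0%N) (M : zmodType).

Definition prism_op n (D : AW n.+1 -> M) (y : AW n) : M :=
  \sum_(i < n.+1) sgn i (D (prism w i y)).

(** On a cocycle the alternating sum of the prisms is a homotopy between the
    identity and the contraction of the second factor: the inner faces cancel
    against the faces of [y], and the cuts telescope. *)
Lemma prism_homotopy n (D : AW n.+1 -> M) :
  (forall y, \sum_(j < n.+3) sgn j (D (face j y)) = 0) ->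
  forall y, D y - D (y.1, cst w n.+1) =
    - \sum_(j < n.+2) sgn j (prism_op D (face j y)).
Proof.
move=> D0 y.
pose a i j := sgn (i + j) (D (prism w i (face (inord j : 'I_n.+2) y))).
pose c i := D (cut w i y).
pose G i j := if (j < i)%N then - a i.-1 j else if j == i then c i else
   if j == i.+1 then - c i.+1 else - a i j.-1.
have PS : \sum_(i < n.+2) \sum_(j < n.+3) G i j =
    c 0%N - c n.+2 - \sum_(i < n.+1) \sum_(j < n.+2) a i j.
  apply: prism_sum.
  - by move=> i j ji; rewrite /G ji.
  - by move=> i; rewrite /G ltnn eqxx.
  - by move=> i; rewrite /G ltnNge leqnSn /= -[i.+1 == i]negbK neq_ltn ltnSn orbT /= eqxx.
  - move=> i j ij; rewrite /G; case: ifP => [|_]; first by lia.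
    by case: eqP => [|_]; [lia|case: eqP => [|_]; [lia|]].
have G0 : \sum_(i < n.+2) \sum_(j < n.+3) G i j = 0.
  apply: big1 => i _; transitivity (sgn i (\sum_(j < n.+3) sgn j (D (face j (prism w i y))))); last first.
    by rewrite D0 /sgn oppr0; case: odd.
  rewrite sgn_sum; apply: eq_bigr => j _; rewrite sgn_add /G.
  have in2 := ltn_ord i; have jn3 := ltn_ord j.
  case: ltnP => ji.
    rewrite face_prism_lt // /a; case: (nat_of_ord i) ji => // k _.
    by rewrite addSn sgnS.
  case: eqP => [ij|nij].
    by rewrite face_prism_eq // /c /sgn ij addnn odd_double.
  case: eqP => [ij|nij'].
    by rewrite face_prism_succ // /c ij addnS sgnS /sgn addnn odd_double.
  rewrite face_prism_gt /a; last by lia.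
  case: (nat_of_ord j) ji nij nij' => [|k] ji nij nij'; first by lia.
  by rewrite addnS sgnS.
have aE : \sum_(i < n.+1) \sum_(j < n.+2) a i j =
    \sum_(j < n.+2) sgn j (prism_op D (face j y)).
  rewrite exchange_big; apply: eq_bigr => j _; rewrite sgn_sum; apply: eq_bigr => i _.
  by rewrite sgn_add addnC /a inord_val.
move: PS; rewrite G0 aE /c cut0 cut_all // => /esym /eqP.
rewrite subr_eq add0r => /eqP <-; rewrite opprB //.
Qed.

Lemma contract_homotopy0 (D : AW 0%N -> M) :
  (forall y, \sum_(j < 2) sgn j (D (face j y)) = 0) ->
  forall y, D y = D (y.1, w).
Proof.
move=> D0 [v om]; have := D0 (contract_edge w v om).
rewrite big_ord_recl big_ord_recl big_ord0 addr0.
rewrite -[sgn _ (D (face ord0 _))]/(D (d0 _)) d0E contract_edge1.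
have -> : lift ord0 ord0 = ord_max :> 'I_2 by exact: val_inj.
rewrite -[sgn _ _]/(- D (d1 _)) d1E contract_edge0.
by move=> /eqP; rewrite subr_eq0 => /eqP ->.
Qed.
End PrismHomotopy.

(** * Local systems and cochains *)

Lemma pi1_ext (X : pspace) (U : univ_covers X) x y (a b : pi1 U x y) :
  (forall n u, a n u = b n u) -> a = b.
Proof.
case: a b => [a ao ai] [b bo bi] /= /pmap_ext ab; subst b.
by rewrite (Prop_irrelevance ao bo) (Prop_irrelevance ai bi).
Qed.

Lemma open_fun_out (X : topologicalType) (M : finType) (c : X -> M) (P : set M) :
  (forall m, open [set x | c x = m]) -> open [set x | P (c x)].
Proof.
move=> oc; have -> : [set x | P (c x)] = \bigcup_(m in P) [set x | c x = m].
  by apply/seteqP; split=> [x Px|x [m Pm /= ->]] //; exists (c x).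
by apply: bigcup_open => m _; exact: oc.
Qed.

Section AdditiveMaps.
Variables (M N : zmodType) (f : M -> N).
Hypothesis fD : {morph f : m m' / m + m'}.
Lemma morph0 : f 0 = 0.
Proof. by apply: (addrI (f 0)); rewrite -fD !addr0. Qed.
Lemma morphN x : f (- x) = - f x.
Proof. by apply: (addrI (f x)); rewrite -fD !subrr morph0. Qed.
Lemma morph_sgn i x : f (sgn i x) = sgn i (f x).
Proof. by rewrite /sgn; case: odd; rewrite ?morphN. Qed.
Lemma morph_sum n (F : 'I_n -> M) : f (\sum_i F i) = \sum_i f (F i).
Proof. exact: (big_morph f fD morph0). Qed.
End AdditiveMaps.

Lemma differentialE (X : pspace) (U : univ_covers X) (M : local_system U) q
    (c : family M q) x u :
  differential c (x := x) u = \sum_(i < q.+2) sgn i (c x (face i u)).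
Proof. by apply: eq_bigr => i _; rewrite sgnE. Qed.

Section Families.
Variables (X : pspace) (U : univ_covers X) (M : local_system U).

Lemma coboundary_eq q (c d : family M q) : (forall x u, c x u = d x u) ->
  coboundary c -> coboundary d.
Proof.
case: q c d => [|q] c d cd; first by move=> H x u; rewrite -cd; exact: H.
by move=> [b cb H]; exists b => // x u; rewrite -cd H.
Qed.

Lemma open_pair (Q : topologicalType) (N N' : finType) (c : Q -> N) (d : Q -> N') P :
  (forall m, open [set x | c x = m]) -> (forall m, open [set x | d x = m]) ->
  open [set x | P (c x) (d x)].
Proof.
move=> oc od.
have -> : [set x | P (c x) (d x)] = \bigcup_m ([set x | c x = m] `&` [set x | P m (d x)]).
  by apply/seteqP; split=> [x Px|x [m _ [/= <-]]] //; exists (c x).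
apply: bigcup_open => m _; apply: openI => //; exact: (open_fun_out (fun y => P m y)).
Qed.

Lemma cochainD q (b c : family M q) : cochain b -> cochain c ->
  cochain (fun x u => b x u + c x u).
Proof.
move=> [ob nb] [oc nc]; split=> [x m|x y a u]; last by rewrite nb nc -ls_add.
exact: (open_pair (fun k l => k + l = m)).
Qed.

Lemma cochainN q (b : family M q) : cochain b -> cochain (fun x u => - b x u).
Proof.
move=> [ob nb]; split=> [x m|x y a u]; last by rewrite nb morphN //; exact: ls_add.
exact: (open_fun_out (fun k => - k = m)).
Qed.

Lemma coboundaryD q (c d : family M q) : coboundary c -> coboundary d ->
  coboundary (fun x u => c x u + d x u).
Proof.
case: q c d => [|q] c d; first by move=> c0 d0 x u; rewrite c0 d0 addr0.
move=> [b cb bc] [b' cb' bd]; exists (fun x u => b x u + b' x u); first exact: cochainD.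
move=> x u; rewrite bc bd !differentialE -big_split; apply: eq_bigr => i _ /=.
by rewrite /sgn; case: odd; rewrite // opprD.
Qed.

Lemma coboundaryN q (c : family M q) : coboundary c -> coboundary (fun x u => - c x u).
Proof.
case: q c => [|q] c; first by move=> c0 x u; rewrite c0 oppr0.
move=> [b cb bc]; exists (fun x u => - b x u); first exact: cochainN.
move=> x u; rewrite bc !differentialE -sumrN; apply: eq_bigr => i _ /=.
by rewrite sgnN.
Qed.
End Families.

Section LocalSystemMorphism.
Variables (X : pspace) (U : univ_covers X) (M N : local_system U).
Variable th : forall x, M x -> N x.
Arguments th : clear implicits.
Hypothesis th_add : forall x, {morph th x : m m' / m + m'}.
Hypothesis th_nat : forall x y (a : pi1 U x y) m,
  th y (ls_map M a m) = ls_map N a (th x m).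

Lemma morphism_cochain q (c : family M q) : cochain c ->
  cochain (fun x u => th x (c x u) : N x).
Proof.
move=> [oc nc]; split=> [x m|x y a u]; last by rewrite nc th_nat.
exact: (open_fun_out (fun k => th x k = m)).
Qed.

Lemma morphism_differential q (c : family M q) x u :
  differential (fun x u => th x (c x u) : N x) u = th x (differential c (x := x) u).
Proof.
rewrite !differentialE (morph_sum (@th_add x)); apply: eq_bigr => i _.
by rewrite (morph_sgn (@th_add x)).
Qed.

Lemma morphism_cocycle q (c : family M q) : cocycle c ->
  cocycle (fun x u => th x (c x u) : N x).
Proof.
move=> [cc dc]; split; first exact: morphism_cochain.
by move=> x u; rewrite morphism_differential dc (morph0 (@th_add x)).
Qed.

Lemma morphism_coboundary q (c : family M q) : coboundary c ->
  coboundary (fun x u => th x (c x u) : N x).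
Proof.
case: q c => [|q] c; first by move=> c0 x u; rewrite c0 (morph0 (@th_add x)).
move=> [b cb bc]; exists (fun x u => th x (b x u)); first exact: morphism_cochain.
by move=> x u; rewrite bc morphism_differential.
Qed.
End LocalSystemMorphism.

Section PullCoboundary.
Variables (X Y : pspace) (f : pmap X Y) (U : univ_covers X) (V : univ_covers Y).
Variables (F : induced f U V) (M : local_system V).

Lemma pull_cochain q (c : family M q) : cochain c -> cochain (pull_family F c).
Proof.
move=> [oc nc]; split=> [x m|x y a u].
  have := oc (f 0%N x) m.
  by move=> /(open_preimage (@pmap_continuous _ _ (ind_lift F x) q)).
by rewrite /pull_family -ind_mapE nc.
Qed.

Lemma pull_differential q (c : family M q) x u :
  differential (pull_family F c) (x := x) u =
  differential c (ind_lift F x q.+1 u).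
Proof.
rewrite !differentialE; apply: eq_bigr => i _.
by rewrite /pull_family /face pmap_natural.
Qed.

Lemma pull_coboundary q (c : family M q) : coboundary c -> coboundary (pull_family F c).
Proof.
case: q c => [|q] c; first by move=> c0 x u; exact: c0.
move=> [b cb bc]; exists (pull_family F b); first exact: pull_cochain.
by move=> x u; rewrite pull_differential -bc.
Qed.

End PullCoboundary.

(** Maps into a universal covering are compared in the Galois coverings of
    which it is the limit. *)
Lemma uc_ext (X : pspace) (x : X 0%N) (U : univ_cover x) (Q : pspace) (f g : pmap Q U) :
  (forall (E : galois x) n q, uc_cone U E n (f n q) = uc_cone U E n (g n q)) -> f = g.
Proof.
move=> fg; have [|h [_ hU]] := @uc_limit _ _ U Q (fun E => pmap_comp (uc_cone U E) g).
  by move=> E E' m gm n q; exact: uc_cone_map.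
by rewrite -(hU f) ?(hU g).
Qed.

(** * Products with contractible spaces *)
Section ProductGroupoid.
Variables (Z : pspace) (J : Type) (dim : J -> nat) (S : J -> profiniteType).
Local Notation W := (cofree dim S).
Local Notation T := (prod_pspace Z W).
Variable V : univ_covers Z.
Variable w0 : W 0%N.

Definition product_covers : univ_covers T :=
  fun t => match t return @univ_cover T t with (x, w) => product_univ_cover w (V x) end.
Local Notation UT := product_covers.

Section UpDown.
Variables (x x' : Z 0%N) (w w' : W 0%N).
Local Notation t := ((x, w) : T 0%N).
Local Notation t' := ((x', w') : T 0%N).

Section Up.
Variable b : pi1 V x x'.
Definition up_map : pmap (UT t) (UT t') := times_id dim S b.
Lemma up_over n u : uc_proj (UT t') n (up_map n u) = uc_proj (UT t) n u.
Proof.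
by case: u => v om; rewrite /= /pmap_comp_fun /= /pmap_comp_fun /= pi1_over.
Qed.
Lemma up_iso : pmap_iso up_map.
Proof. by apply: times_id_iso; exact: pi1_iso. Qed.
Definition up : pi1 UT t t' := Pi1 up_over up_iso.
Lemma upE n v om : up n (v, om) = (b n v, om).
Proof. by []. Qed.
End Up.

Section Down.
Variable a : pi1 UT t t'.
Let al : pmap (prod_pspace (V x) W) (prod_pspace (V x') W) := a.

Lemma down_snd n q : (al n q).2 = q.2.
Proof. by have /(congr1 snd) := pi1_over a q. Qed.

Lemma down_fst n q : uc_proj (V x') n (al n q).1 = uc_proj (V x) n q.1.
Proof. by have /(congr1 fst) := pi1_over a q. Qed.

Definition down_map : pmap (V x) (V x') := slice w0 al.
Lemma down_over n u : uc_proj (V x') n (down_map n u) = uc_proj (V x) n u.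
Proof. by rewrite sliceE down_fst. Qed.
Lemma down_iso : pmap_iso down_map.
Proof. by apply: slice_iso; [exact: down_snd|exact: pi1_iso a]. Qed.
Definition down : pi1 V x x' := Pi1 down_over down_iso.

(** Both sides have the same image in every finite Galois covering. *)
Lemma down_independent n v om : (al n (v, om)).1 = down n v.
Proof.
pose f := pmap_comp (prod_fst (V x') W) al.
pose g := pmap_comp down_map (prod_fst (V x) W).
suff fg : f = g by rewrite -[LHS]/(f n (v, om)) fg.
apply: uc_ext => E k [u o].
have := @covering_independent _ _ _ w0 _ _ _ (gal_proj E)
  (pmap_comp (uc_cone (V x') E) f) (@gal_covering _ _ E) (uc_proj (V x)) _ k u o.
apply=> m u' o'; rewrite [LHS]uc_cone_proj; exact: down_fst.
Qed.

Lemma pi1E n v om : a n (v, om) = (down n v, om).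
Proof. by rewrite -(down_independent v om) [LHS]surjective_pairing (@down_snd n (v, om)). Qed.

Lemma up_down : up down = a.
Proof. by apply: pi1_ext => n [v om]; rewrite upE pi1E. Qed.
End Down.

Lemma down_up b : down (up b) = b.
Proof. by apply: pi1_ext => n v. Qed.
End UpDown.

Lemma up_id x w : up w w (pi1_id V x) = pi1_id UT (x, w).
Proof. by apply: pi1_ext => n [v om]. Qed.

Lemma up_comp x x' x'' w w' w'' (b : pi1 V x' x'') (a : pi1 V x x') :
  up w w'' (pi1_comp b a) = pi1_comp (up w' w'' b) (up w w' a).
Proof. by apply: pi1_ext => n [v om]. Qed.

Lemma down_id x w : down (pi1_id UT (x, w)) = pi1_id V x.
Proof. by rewrite -up_id down_up. Qed.

Lemma down_comp x x' x'' w w' w'' (b : pi1 UT (x', w') (x'', w''))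
    (a : pi1 UT (x, w) (x', w')) : down (pi1_comp b a) = pi1_comp (down b) (down a).
Proof.
rewrite -{1}(up_down b) -{1}(up_down a) -up_comp; exact: down_up.
Qed.

(** ** The projection *)
Local Notation pr := (prod_fst Z W).

Definition proj_lift (t : T 0%N) : pmap (UT t) (V (pr 0%N t)) :=
  match t return pmap (UT t) (V (pr 0%N t)) with (x, w) => prod_fst (V x) W end.

Definition proj_map (t t' : T 0%N) : pi1 UT t t' -> pi1 V (pr 0%N t) (pr 0%N t') :=
  match t, t' return pi1 UT t t' -> pi1 V (pr 0%N t) (pr 0%N t') with
  (x, w), (x', w') => fun a => down a end.

Lemma proj_lift_over t n u : uc_proj (V (pr 0%N t)) n (proj_lift t n u) = pr n (uc_proj (UT t) n u).
Proof. by case: t u => x w [v om]. Qed.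
Lemma proj_lift_pt t : proj_lift t 0%N (uc_pt (UT t)) = uc_pt (V (pr 0%N t)).
Proof. by case: t. Qed.
Lemma proj_mapE t t' (a : pi1 UT t t') n u :
  proj_map a n (proj_lift t n u) = proj_lift t' n (a n u).
Proof. by case: t t' a u => x w [x' w'] a [v om]; rewrite pi1E. Qed.
Lemma proj_map_id t : proj_map (pi1_id UT t) = pi1_id V (pr 0%N t).
Proof. by case: t => x w; exact: down_id. Qed.
Lemma proj_map_comp t t' t'' (b : pi1 UT t' t'') (a : pi1 UT t t') :
  proj_map (pi1_comp b a) = pi1_comp (proj_map b) (proj_map a).
Proof. by case: t t' t'' b a => x w [x' w'] [x'' w'']; exact: down_comp. Qed.

Definition proj_induced : induced pr UT V :=
  Induced proj_lift_over proj_lift_pt proj_mapE proj_map_id proj_map_comp.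

(** ** Cochains on the product *)
Section Cochains.
Variable M : local_system UT.

(** Transport along the contractible factor: the universal coverings at the two
    points have the same underlying space. *)
Definition shift x w w' : pi1 UT (x, w) (x, w') := up w w' (pi1_id V x).

Lemma shiftE x w w' n u : shift x w w' n u = u.
Proof. by case: u. Qed.

Lemma shift_comp x w w' w'' : pi1_comp (shift x w' w'') (shift x w w') = shift x w w''.
Proof. by apply: pi1_ext => n [v om]. Qed.

Lemma shift_id x w : shift x w w = pi1_id UT (x, w).
Proof. by apply: pi1_ext => n [v om]. Qed.

Definition slice_obj (x : Z 0%N) : finZmodType := M (x, w0).
Definition slice_ls_map x y (a : pi1 V x y) : slice_obj x -> slice_obj y :=
  ls_map M (up w0 w0 a).

Lemma slice_ls_add x y (a : pi1 V x y) : {morph slice_ls_map a : m m' / m + m'}.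
Proof. exact: ls_add. Qed.
Lemma slice_ls_id x m : slice_ls_map (pi1_id V x) m = m.
Proof. by rewrite /slice_ls_map up_id ls_id. Qed.
Lemma slice_ls_comp x y z (b : pi1 V y z) (a : pi1 V x y) m :
  slice_ls_map (pi1_comp b a) m = slice_ls_map b (slice_ls_map a m).
Proof. by rewrite /slice_ls_map (up_comp _ w0) ls_comp. Qed.

Lemma up_continuous x y : continuous (@up x y w0 w0 : pi1 V x y -> pi1 UT (x, w0) (y, w0)).
Proof.
apply/continuousP => _ [A oA <-].
exists ((fun v : V y 0%N => (v, w0) : prod_pspace (V y) W 0%N) @^-1` A).
  apply: open_preimage oA; apply: pair_continuous.
    exact: (fun x => @cvg_id _ _).
  exact: cst_continuous.
by [].
Qed.

Lemma slice_ls_continuous x y m m' : open [set a : pi1 V x y | slice_ls_map a m = m'].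
Proof.
have := ls_continuous (l := M) (x := (x, w0)) (y := (y, w0)) m m'.
by move=> /(open_preimage (@up_continuous x y)).
Qed.

Definition slice_system : local_system V :=
  @LocalSystem Z V slice_obj slice_ls_map slice_ls_add slice_ls_id slice_ls_comp
    slice_ls_continuous.

Definition res_family q (d : family M q) : family slice_system q :=
  fun x v => d (x, w0) (v, cst w0 q).

Definition ext_family q (c : family slice_system q) : family M q :=
  fun t => match t return UT t q -> M t with
    (x, w) => fun u => ls_map M (shift x w0 w) (c x u.1) end.

Lemma res_cochain q (d : family M q) : cochain d -> cochain (res_family d).
Proof.
move=> [od nd]; split=> [x m|x y a u].
  have := od (x, w0) m; apply: open_preimage.
  by apply: pair_continuous; [exact: (fun x => @cvg_id _ _)|exact: cst_continuous].
by rewrite /res_family -[ls_map _ _ _]nd.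
Qed.

Lemma res_differential q (d : family M q) x u :
  differential (res_family d) (x := x) u = res_family (differential d) u.
Proof.
rewrite differentialE [RHS]differentialE; apply: eq_bigr => i _.
by rewrite /res_family /face prod_smapE smap_cst.
Qed.

Lemma res_cocycle q (d : family M q) : cocycle d -> cocycle (res_family d).
Proof.
move=> [cd dd]; split; first exact: res_cochain.
by move=> x u; rewrite res_differential; exact: dd.
Qed.

Lemma ext_cochain q (c : family slice_system q) : cochain c -> cochain (ext_family c).
Proof.
move=> [oc nc]; split=> [[x w] m|[x w] [y w'] a [u om]].
  have := open_fun_out (fun k => ls_map M (shift x w0 w) k = m) (oc x).
  by move=> /(open_preimage (@fst_continuous (V x q) (W q))).
rewrite -[LHS]/(ls_map M (shift y w0 w') (c y (a q (u, om)).1)) pi1E nc.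
rewrite -[LHS]/(ls_map M _ (ls_map M (up w0 w0 (down a)) (c x u))).
rewrite -[RHS]/(ls_map M a (ls_map M (shift x w0 w) (c x u))).
rewrite -[RHS]ls_comp -[LHS]ls_comp; congr (ls_map M _ _).
by apply: pi1_ext => n [v o]; exact: esym (pi1E a v o).
Qed.

Lemma ext_differential q (c : family slice_system q) t u :
  differential (ext_family c) (x := t) u = ext_family (differential c) u.
Proof.
case: t u => x w [u om]; rewrite differentialE /= differentialE (morph_sum (ls_add _)).
by apply: eq_bigr => i _; rewrite (morph_sgn (ls_add _)).
Qed.

Lemma ext_cocycle q (c : family slice_system q) : cocycle c -> cocycle (ext_family c).
Proof.
move=> [cc dc]; split; first exact: ext_cochain.
by move=> [x w] u; rewrite ext_differential /= dc (morph0 (ls_add _)).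
Qed.

Lemma ext_coboundary q (c : family slice_system q) : coboundary c -> coboundary (ext_family c).
Proof.
case: q c => [|q] c; first by move=> c0 [x w] u; rewrite /= c0 (morph0 (ls_add _)).
move=> [b cb bc]; exists (ext_family b); first exact: ext_cochain.
by move=> [x w] u; rewrite ext_differential /= bc.
Qed.

Lemma cochain_shift q (d : family M q) x w w' u : cochain d ->
  ls_map M (shift x w w') (d (x, w) u) = d (x, w') u.
Proof. by move=> [_ nd]; rewrite -nd shiftE. Qed.

Lemma prism_continuous (A : pspace) n i : continuous (@prism A J dim S w0 n i).
Proof.
apply: pair_continuous.
  by apply: comp_continuous (@fst_continuous _ _) _; exact: smap_continuous.
by apply: comp_continuous (@snd_continuous _ _) _; exact: contract_continuous.
Qed.

Definition prism_family q (d : family M q.+1) : family M q :=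
  fun t => match t return (UT t q.+1 -> M t) -> UT t q -> M t with
    (x, w) => fun D u => - prism_op w0 D u end (d t).

Lemma prism_cochain q (d : family M q.+1) : cochain d -> cochain (prism_family d).
Proof.
move=> [od nd]; split=> [[x w] m|[x w] [y w'] a [u om]].
  rewrite openE => y /= <-.
  have : nbhs y [set y' : UT (x, w) q | forall i : 'I_q.+1,
      d (x, w) (prism w0 i y') = d (x, w) (prism w0 i y)].
    apply: finite_open_forall => i; apply: open_nbhs_nbhs; split=> //.
    exact: (open_preimage (@prism_continuous (V x) q i) (od (x, w) _)).
  by apply: filterS => y' H; congr (- _); apply: eq_bigr => i _; rewrite H.
rewrite /= morphN; last exact: ls_add.
congr (- _); rewrite /prism_op (morph_sum (ls_add _)); apply: eq_bigr => i _.
rewrite (morph_sgn (ls_add _)) -nd; congr (sgn _ (d _ _)).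
by rewrite pi1E /prism /= [RHS]pi1E pmap_natural.
Qed.

(** Restricting a cocycle to the slice over [w0] and extending it back is
    homotopic to the identity: by the prism operators in positive degrees, and
    along the contracting edge in degree zero. *)
Lemma res_homotopy q (d : family M q) : cocycle d ->
  coboundary (fun t u => d t u - ext_family (res_family d) (x := t) u).
Proof.
case: q d => [|q] d [cd dd].
  move=> [x w] [v om]; rewrite /= /res_family cochain_shift // cst0.
  apply/eqP; rewrite subr_eq0; apply/eqP.
  apply: (@contract_homotopy0 (V x) J dim S w0 _ (d (x, w)) _ (v, om)).
  by move=> y; rewrite -differentialE dd.
exists (prism_family d); first exact: prism_cochain.
move=> [x w] [v om]; rewrite differentialE /= /res_family cochain_shift //.
rewrite (@prism_homotopy (V x) J dim S w0 _ q (d (x, w))); last first.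
  by move=> y; rewrite -differentialE dd.
by rewrite -sumrN; apply: eq_bigr => j _; rewrite sgnN.
Qed.
End Cochains.

Lemma product_edge (x : Z 0%N) (w : W 0%N) : exists e : T 1%N,
  d1 e = (x, w) /\ d0 e = (x, w0).
Proof.
by exists (contract_edge w0 x w); rewrite d1E d0E contract_edge0 contract_edge1.
Qed.

Lemma product_pi0 (P : profiniteType) (r : Z 0%N -> P) :
  is_pi0 r -> @is_pi0 T P (fun t => r t.1).
Proof.
move=> [cr rE rU]; split.
- by apply: (@comp_continuous _ _ _ fst); [exact: fst_continuous|].
- by move=> [e o]; exact: rE.
move=> Y h ch hE.
have hw x w : h (x, w) = h (x, w0).
  by have [e [e1 e0]] := product_edge x w; have := hE e; rewrite e1 e0.
have [||k [[ck kr] kU]] := rU Y (fun x => h (x, w0)).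
- apply: (@comp_continuous _ _ _ (fun z : Z 0%N => (z, w0) : T 0%N)) => //.
  apply: pair_continuous; [exact: (fun x => @cvg_id _ _)|exact: cst_continuous].
- by move=> e; have := hE (e, cst w0 1); rewrite /d0 /d1 /face !prod_smapE !smap_cst cst0.
exists k; split; first by split=> // -[x w]; rewrite kr hw.
by move=> k' [ck' k'r]; apply: kU; split=> // x; exact: (k'r (x, w0)).
Qed.

Lemma proj_map_bijective t t' : bijective (@proj_map t t').
Proof.
case: t t' => x w [x' w']; exists (up w w').
  exact: up_down.
exact: down_up.
Qed.

Lemma proj_cohomology_iso (M : local_system V) q : cohomology_iso proj_induced M q.
Proof.
pose N := pull proj_induced M.
have resE a c (b : pi1 V a c) m : slice_ls_map (M := N) b m = ls_map M b m.
  by rewrite /slice_ls_map /= down_up.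
have res_diff k (b : family N k) x v :
    differential (X := Z) (U := V) (M := M) (fun x v => b (x, w0) (v, cst w0 k)) (x := x) v =
    differential b (x := (x, w0)) (v, cst w0 k.+1).
  rewrite differentialE [RHS]differentialE; apply: eq_bigr => i _.
  by rewrite /face prod_smapE smap_cst.
have res_coch k (b : family N k) : cochain b ->
    cochain (X := Z) (U := V) (M := M) (fun x v => b (x, w0) (v, cst w0 k)).
  move=> /res_cochain [ob nb]; split=> [x m|x y a u]; first exact: ob.
  by have := nb x y a u; rewrite [ls_map _ _ _]resE.
split.
  move=> c [cc dc]; case: q c cc dc => [|q] c cc dc.
    by move=> c0 x v; exact: (c0 (x, w0) (v, cst w0 0)).
  move=> [b cb bc]; exists (fun x v => b (x, w0) (v, cst w0 q)); first exact: res_coch.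
  by move=> x v; rewrite res_diff -bc.
move=> d [cd dd]; exists (fun x v => d (x, w0) (v, cst w0 q)).
  split; first exact: res_coch.
  by move=> x v; rewrite res_diff dd.
apply: coboundary_eq (res_homotopy (conj cd dd)) => -[x w] [v om] /=.
by rewrite /shift down_up ls_id.
Qed.

Lemma projection_weak_equivalence (P : profiniteType) (r : Z 0%N -> P) :
  is_pi0 r -> weak_equivalence pr.
Proof.
move=> pr0; split.
  exists P, (fun t : T 0%N => r t.1), P, r, id; split=> //.
  - exact: product_pi0.
  - exact: (fun x => @cvg_id _ _).
  - by exists id.
exists UT, V, proj_induced; split; first by move=> t; exact: proj_map_bijective.
exact: proj_cohomology_iso.
Qed.

(** ** Maps into the product *)
Section GraphMap.
Variables (E : pspace) (p : pmap E Z) (e : pmap E W) (U : univ_covers E).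
Variable F : induced p U V.
Local Notation j := (pair_pmap p e).

Definition graph_lift x : pmap (U x) (UT (j 0%N x)) :=
  pair_pmap (ind_lift F x) (pmap_comp e (uc_proj (U x))).
Definition graph_map x y (a : pi1 U x y) : pi1 UT (j 0%N x) (j 0%N y) :=
  up (e 0%N x) (e 0%N y) (ind_map F a).

Lemma graph_lift_over x n u : uc_proj (UT (j 0%N x)) n (graph_lift x n u) = j n (uc_proj (U x) n u).
Proof. by rewrite /= /pmap_comp_fun /= /pmap_comp_fun /= ind_lift_over. Qed.
Lemma graph_lift_pt x : graph_lift x 0%N (uc_pt (U x)) = uc_pt (UT (j 0%N x)).
Proof. by rewrite /= /pmap_comp_fun /= ind_lift_pt uc_proj_pt. Qed.
Lemma graph_mapE x y (a : pi1 U x y) n u :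
  graph_map a n (graph_lift x n u) = graph_lift y n (a n u).
Proof. by rewrite /= /pmap_comp_fun /= /pmap_comp_fun /= ind_mapE pi1_over. Qed.
Lemma graph_map_id x : graph_map (pi1_id U x) = pi1_id UT (j 0%N x).
Proof. by rewrite /graph_map ind_map_id up_id. Qed.
Lemma graph_map_comp x y z (b : pi1 U y z) (a : pi1 U x y) :
  graph_map (pi1_comp b a) = pi1_comp (graph_map b) (graph_map a).
Proof. by rewrite /graph_map ind_map_comp (up_comp _ (e 0%N y)). Qed.

Definition graph_induced : induced j U UT :=
  Induced graph_lift_over graph_lift_pt graph_mapE graph_map_id graph_map_comp.

Lemma graph_map_bijective x y : bijective (@ind_map _ _ _ _ _ F x y) ->
  bijective (@graph_map x y).
Proof.
move=> bF; apply: (@bij_comp _ _ _ (up (e 0%N x) (e 0%N y)) (@ind_map _ _ _ _ _ F x y)) => //.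
by exists (@down _ _ _ _); [exact: down_up|exact: up_down].
Qed.

Section GraphCohomology.
Variable M : local_system UT.
Local Notation M' := (slice_system M).

Definition to_slice (x : E 0%N) : pull graph_induced M x -> pull F M' x :=
  ls_map M (shift (p 0%N x) (e 0%N x) w0).
Definition of_slice (x : E 0%N) : pull F M' x -> pull graph_induced M x :=
  ls_map M (shift (p 0%N x) w0 (e 0%N x)).

Lemma to_sliceK x : cancel (@to_slice x) (@of_slice x).
Proof. by move=> m; rewrite /of_slice /to_slice -ls_comp shift_comp shift_id ls_id. Qed.
Lemma of_sliceK x : cancel (@of_slice x) (@to_slice x).
Proof. by move=> m; rewrite /of_slice /to_slice -ls_comp shift_comp shift_id ls_id. Qed.
Lemma to_slice_add x : {morph @to_slice x : m m' / m + m'}.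
Proof. exact: (@ls_add _ _ M _ _ (shift (p 0%N x) (e 0%N x) w0)). Qed.
Lemma of_slice_add x : {morph @of_slice x : m m' / m + m'}.
Proof. exact: (@ls_add _ _ M _ _ (shift (p 0%N x) w0 (e 0%N x))). Qed.

Lemma to_slice_nat x y (a : pi1 U x y) m :
  to_slice (ls_map (pull graph_induced M) a m) = ls_map (pull F M') a (to_slice m).
Proof.
rewrite /to_slice /= /slice_ls_map -!ls_comp; congr (ls_map M _ _).
by apply: pi1_ext => n [v om].
Qed.
Lemma of_slice_nat x y (a : pi1 U x y) m :
  of_slice (ls_map (pull F M') a m) = ls_map (pull graph_induced M) a (of_slice m).
Proof.
rewrite /of_slice /= /slice_ls_map -!ls_comp; congr (ls_map M _ _).
by apply: pi1_ext => n [v om].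
Qed.

(** Transport identifies a local system on the product with the pull-back of
    its slice, which reduces the claim for the graph to the one for [p]. *)
Lemma graph_cohomology_iso q : cohomology_iso F M' q -> cohomology_iso graph_induced M q.
Proof.
move=> [inj surj]; split.
  move=> c cc pc.
  have hc := res_homotopy cc.
  have rc : cocycle (res_family c) by exact: res_cocycle.
  have pe : coboundary (pull_family graph_induced (ext_family (res_family c))).
    have := coboundaryD pc (coboundaryN (pull_coboundary graph_induced hc)).
    by apply: coboundary_eq => x u; rewrite /pull_family opprB addrC subrK.
  have cr : coboundary (res_family c).
    apply: inj => //; have := morphism_coboundary to_slice_add to_slice_nat pe.
    by apply: coboundary_eq => x u; exact: of_sliceK.
  have := coboundaryD hc (ext_coboundary cr).
  by apply: coboundary_eq => x u; rewrite subrK.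
move=> d cd.
have [c cc H] := surj _ (morphism_cocycle to_slice_add to_slice_nat cd).
exists (ext_family c); first exact: ext_cocycle.
have := morphism_coboundary of_slice_add of_slice_nat H.
apply: coboundary_eq => x u; rewrite of_slice_add to_sliceK; congr (_ + _).
by rewrite (morphN (@of_slice_add x)).
Qed.
End GraphCohomology.
End GraphMap.
End ProductGroupoid.

(** Two out of three, for a weak equivalence factored through a projection with
    contractible fibre. *)
Lemma graph_weak_equivalence (E Z : pspace) (p : pmap E Z) (J : Type) (dim : J -> nat)
    (S : J -> profiniteType) (e : pmap E (cofree dim S)) (w0 : cofree dim S 0%N) :
  weak_equivalence p -> weak_equivalence (pair_pmap p e).
Proof.
move=> [[P [r [Q [s [g [pr ps cg gE bg]]]]]] [U [V [F [bF hF]]]]].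
split.
  by exists P, r, Q, (fun t => s t.1), g; split=> //; exact: (product_pi0 w0 ps).
exists U, (@product_covers Z J dim S V), (@graph_induced Z J dim S V E p e U F).
split=> [x|M q].
  exact: (@graph_map_bijective Z J dim S V w0 E p e U F x x (bF x)).
exact: (@graph_cohomology_iso Z J dim S V w0 E p e U F M q (hF _ _)).
Qed.

(** * The point *)
Definition point_pspace : pspace :=
  @PSpace (fun _ => finite_space unit) (fun _ _ _ x => x)
    (fun _ _ _ x => @cvg_id _ _) (fun _ _ => erefl) (fun _ _ _ _ _ _ => erefl).

Lemma point_eq n (x y : point_pspace n) : x = y.
Proof. by case: x y => -[]. Qed.

Section PointCover.
Variable x : point_pspace 0%N.

(** Edges over the degenerate edge of the point are degenerate by unique
    lifting, so connectedness leaves a single vertex. *)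
Lemma galois_point (E : galois x) n (a b : E n) : a = b.
Proof.
have ver (y y' : E 0%N) : y = y'.
  apply: ((gal_connected E).2 y y' (E 0%N) id).
    exact: (fun x => @cvg_id _ _).
  move=> e; rewrite d0E d1E.
  have -> : e = cst (vertex ord0 e) 1; last by rewrite !vertex_cst.
  apply: (covering_vertex_inj (@gal_covering _ _ E) (i := ord0)); first exact: point_eq.
  by rewrite vertex_cst.
apply: (covering_vertex_inj (@gal_covering _ _ E) (i := ord0)); first exact: point_eq.
exact: ver.
Qed.

Definition point_cone (E : galois x) : pmap point_pspace E :=
  @PMap point_pspace E (fun n _ => cst (gal_pt E) n) (fun n => @cst_continuous _ _ _)
    (fun m n t _ => esym (smap_cst (gal_pt E) t)).

Lemma point_limit (Q : pspace) (z : forall E : galois x, pmap Q E) :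
  (forall (E E' : galois x) (m : pmap E E'), galois_map m ->
     forall n q, m n (z E n q) = z E' n q) ->
  exists! h : pmap Q point_pspace,
    forall (E : galois x) n q, point_cone E n (h n q) = z E n q.
Proof.
move=> _; exists (@PMap Q point_pspace (fun n _ => tt) (fun n => @cst_continuous _ _ _)
   (fun _ _ _ _ => erefl)).
split; first by move=> E n q; exact: galois_point.
by move=> h _; apply: pmap_ext => n q; exact: point_eq.
Qed.

Definition point_univ_cover : univ_cover x :=
  @UnivCover point_pspace x point_pspace (pmap_id _) x point_cone
    (fun E n u => point_eq _ _) (fun E => galois_point _ _)
    (fun E E' m _ n u => galois_point _ _) point_limit.
End PointCover.

Lemma point_pi0 : @is_pi0 point_pspace (finite_space unit) id.
Proof.
split=> //; first exact: (fun x => @cvg_id _ _).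
move=> Y h ch _; exists h; split; first by split.
by move=> k [_ kh]; apply: funext => y; rewrite kh.
Qed.

(** The universal covering of the point, multiplied by two contractible factors,
    serves for both sides. *)
Lemma contractible_projection (J J' : Type) (dim : J -> nat) (S : J -> profiniteType)
    (dim' : J' -> nat) (S' : J' -> profiniteType)
    (w : cofree dim S 0%N) (w' : cofree dim' S' 0%N) :
  weak_equivalence (prod_fst (prod_pspace point_pspace (cofree dim S)) (cofree dim' S')).
Proof.
apply: (@projection_weak_equivalence _ J' dim' S'
  (@product_covers point_pspace J dim S point_univ_cover) w' _ _
  (product_pi0 w point_pi0)).
Qed.

Local Close Scope ring_scope.

(** * Profinite G-sets *)

Record gset (G : profiniteGroupType) := GSet {
  gset_space :> profiniteType;
  ga : G -> gset_space -> gset_space;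
  ga_continuous : continuous (fun p : G * gset_space => ga p.1 p.2);
  ga1 : forall y, ga 1%g y = y;
  gaM : forall g h y, ga (g * h)%g y = ga g (ga h y) }.
Arguments ga {G g0} g y : rename.

Section GSetTheory.
Variables (G : profiniteGroupType) (Y : gset G).

Lemma gaK g : cancel (@ga G Y g) (ga g^-1%g).
Proof. by move=> y; rewrite -gaM mulVg ga1. Qed.
Lemma gaKV g : cancel (@ga G Y g^-1%g) (ga g).
Proof. by move=> y; rewrite -gaM mulgV ga1. Qed.

Lemma ga_continuous_r g : continuous (@ga G Y g).
Proof.
apply: (@comp_continuous _ _ _ (fun y : Y => (g, y)) (fun p : G * Y => ga p.1 p.2)).
  by apply: pair_continuous; [exact: cst_continuous|exact: (fun x => @cvg_id _ _)].
exact: ga_continuous.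
Qed.

Lemma ga_continuous_l (y : Y) : continuous (fun g : G => ga g y).
Proof.
apply: (@comp_continuous _ _ _ (fun g : G => (g, y)) (fun p : G * Y => ga p.1 p.2)).
  by apply: pair_continuous; [exact: (fun x => @cvg_id _ _)|exact: cst_continuous].
exact: ga_continuous.
Qed.

(** The neighbourhood of [h] can be chosen uniformly in [y] because [Y] is
    compact. *)
Lemma clopen_locally_constant (C : set Y) (h : G) : clopen C ->
  nbhs h [set g | forall y, C (ga g y) <-> C (ga h y)].
Proof.
move=> cC.
have H := (iffLR (compact_near_coveringP [set: Y]) (@profinite_compact Y)) G (nbhs h)
  (fun g y => C (ga g y) <-> C (ga h y)) (nbhs_filter h).
have /H : forall y, [set: Y] y -> \forall y' \near y & g \near h,
    C (ga g y') <-> C (ga h y').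
  move=> y _.
  have n1 : nbhs (h, y) [set p : G * Y | C (ga p.1 p.2) <-> C (ga h y)].
    exact: (@ga_continuous G Y (h, y) _ (clopen_near (ga h y) cC)).
  have n2 : nbhs y [set y' | C (ga h y') <-> C (ga h y)].
    exact: (@ga_continuous_r h y _ (clopen_near (ga h y) cC)).
  case: n1 => -[A B] /= [Ah By] AB.
  exists (B `&` [set y' | C (ga h y') <-> C (ga h y)], A).
    by split => //=; exact: filterI.
  by move=> [y' g] /= [[By' ->] Ag]; exact: (AB (g, y')).
by apply: filterS => g Hg y; exact: Hg.
Qed.

(** The translate of a clopen set depends locally constantly on the group
    element, and the group is compact. *)
Lemma clopen_finite_orbit (C : set Y) : clopen C ->
  exists s : seq G, forall g, exists2 h, h \in s & forall y, C (ga g y) <-> C (ga h y).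
Proof.
move=> cC.
suff [s sP] : exists s : seq G, forall g, [set: G] g ->
    exists2 h, h \in s & forall y, C (ga g y) <-> C (ga h y).
  by exists s => g; exact: sP.
apply: (@compact_union_ind _ (fun A => exists s : seq G, forall g, A g ->
    exists2 h, h \in s & forall y, C (ga g y) <-> C (ga h y))).
- exact: profinite_compact.
- by exists [::].
- move=> A B [s sA] [t tB]; exists (s ++ t) => g [/sA|/tB] [h hs hP];
  by exists h => //; rewrite mem_cat hs ?orbT.
move=> h; exists [set g | forall y, C (ga g y) <-> C (ga h y)].
  exact: clopen_locally_constant.
by exists [:: h] => g gP; exists h; rewrite ?inE.
Qed.

Lemma orbit_clopen (N : set Y) : clopen N -> clopen [set y | exists g, N (ga g y)].
Proof.
move=> [oN cN]; split.
  have -> : [set y | exists g, N (ga g y)] = \bigcup_g (ga g @^-1` N).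
    by apply/seteqP; split=> [y [g Ny]|y [g _ Ny]]; exists g.
  by apply: bigcup_open => g _; apply: open_preimage oN; exact: ga_continuous_r.
apply: (@closed_proj1 Y G [set p : Y * G | N (ga p.2 p.1)]); first exact: profinite_compact.
apply: (@closed_preimage _ _ (fun p : Y * G => ga p.2 p.1)) => //.
apply: (@comp_continuous _ _ _ (fun p : Y * G => (p.2, p.1)) (fun p : G * Y => ga p.1 p.2)).
  by apply: pair_continuous; [exact: snd_continuous|exact: fst_continuous].
exact: ga_continuous.
Qed.
End GSetTheory.

(** * Coordinates *)
(** A point of a profinite set is recorded by the clopen sets that contain it,
    which embeds the profinite set into a cube. *)
Section Coordinates.
Variable E : profiniteType.

Definition coords := {classic {A : set E | clopen A}}.
Definition cube : profiniteType := prod_topology (fun _ : coords => finite_space bool).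

Definition code (e : E) : cube := fun k => `[< sval k e >].

Lemma codeP (e : E) (k : coords) : code e k <-> sval k e.
Proof. by rewrite /code; split=> /asboolP. Qed.

Lemma code_inj : injective code.
Proof.
move=> e e' ee; apply: contrapT => /clopen_points [A [cA Ae]]; apply.
by apply/(codeP e' (exist _ A cA)); rewrite -ee; apply/codeP.
Qed.

Lemma coord_near (e : E) (k : coords) : nbhs e [set e' | code e' k = code e k].
Proof.
apply: filterS (clopen_near e (svalP k)) => e' H.
by apply/idP/idP => /codeP /H /codeP.
Qed.

Lemma code_continuous : continuous code.
Proof.
apply: fun_continuous => k e U Ue.
by apply: filterS (coord_near e k) => e' /= ->; exact: nbhs_singleton.
Qed.

Lemma continuous_coords (X : topologicalType) (f : X -> E) :
  (forall k : coords, open [set x | code (f x) k]) -> continuous f.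
Proof.
move=> of_ x U /clopen_nbhs [A [cA Ax AU]].
have : nbhs x [set x | code (f x) (exist _ A cA : coords)].
  by apply: open_nbhs_nbhs; split; [exact: of_|apply/codeP].
by apply: filterS => x' /codeP /AU.
Qed.

Definition agree (s : seq coords) (w w' : cube) := forall k, k \in s -> w k = w' k.

Lemma cube_nbhs (w : cube) (U : set cube) : nbhs w U ->
  exists s, forall w', agree s w w' -> U w'.
Proof.
rewrite nbhsE => -[O [oO Ow] OU].
pose K : set (set cube) := [set A | exists s, A = [set w' | agree s w w']].
have cl s : closed [set w' | agree s w w'].
  rewrite -openC openE => w' /= /existsNP[k /not_implyP[ks ww]].
  have : nbhs w' [set v | v k = w' k].
    apply: (@eval_continuous _ (fun _ : coords => finite_space bool) k w' [set b | b = w' k]).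
    by apply: open_nbhs_nbhs; split=> //; exact: finite_space_open.
  by apply: filterS => v vk H; apply: ww; rewrite (H k ks).
have [|||||A [s ->] AO] := @clopen_family_inter cube K O (@profinite_compact _).
- by move=> _ [s ->].
- by exists [::]; apply/seteqP; split.
- move=> _ _ [s ->] [t ->]; exists (s ++ t); apply/seteqP; split=> v /=.
    by move=> [sv tv] k; rewrite mem_cat => /orP[/sv|/tv].
  by move=> H; split=> k ks; apply: H; rewrite mem_cat ks ?orbT.
- by [].
- move=> v H; suff <- : w = v by [].
  apply: functional_extensionality_dep => k.
  by have /(_ _) := H [set w' | agree [:: k] w w']; apply; [exists [:: k]|rewrite inE].
by exists s => w' /AO /OU.
Qed.

(** A basic neighbourhood constrains finitely many coordinates, and finitely
    many basic neighbourhoods suffice. *)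
Lemma finite_dependence (Y : profiniteType) (B : set (Y * cube)) : clopen B ->
  exists s, forall y w w', agree s w w' -> (B (y, w) <-> B (y, w')).
Proof.
move=> cB.
suff [s sP] : exists s, forall y w w', [set: Y * cube] (y, w) -> agree s w w' ->
    (B (y, w) <-> B (y, w')).
  by exists s => y w w'; exact: sP.
apply: (@compact_union_ind _ (fun A => exists s, forall y w w', A (y, w) -> agree s w w' ->
    (B (y, w) <-> B (y, w')))).
- exact: (@profinite_compact (Y * cube)%type).
- by exists [::].
- move=> A A' [s sA] [t tA]; exists (s ++ t) => y w w' [Ay|Ay] H.
    by apply: sA => // k ks; apply: H; rewrite mem_cat ks.
  by apply: tA => // k ks; apply: H; rewrite mem_cat ks orbT.
move=> [y w]; have [[M N] /= [My Nw] MN] := clopen_near (y, w) cB.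
have [s sN] := cube_nbhs Nw.
exists (M `*` [set w' | agree s w w']).
  exists (M, [set w' | agree s w w']) => //=; split=> //.
  apply: open_nbhs_nbhs; split=> //; rewrite openE => w' /= ww'.
  elim: s {sN} ww' => [|k s IHs] ww'; first by apply: filterS filterT.
  have n1 : nbhs w' [set v | v k = w' k].
    apply: (@eval_continuous _ (fun _ : coords => finite_space bool) k w' [set b | b = w' k]).
    by apply: open_nbhs_nbhs; split=> //; exact: finite_space_open.
  have n2 : nbhs w' [set v | agree s w v].
    by apply: IHs => j js; apply: ww'; rewrite inE js orbT.
  apply: filterS (filterI n1 n2) => v [/= vk sv] j.
  by rewrite inE => /orP[/eqP ->|/sv //]; rewrite vk ww' // inE eqxx.
exists s => y' v v' [/= My' wv] vv'.
have h1 := MN (y', v) (conj My' (sN _ wv)).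
have wv' : agree s w v' by move=> k ks; rewrite wv // vv'.
have h2 := MN (y', v') (conj My' (sN _ wv')).
by rewrite /= in h1 h2; rewrite h1 h2.
Qed.
End Coordinates.

(** * Equivariant lifting *)
(** An equivariant function is sought whose values satisfy [adm] and are the
    ones prescribed by [forced]; the action is free wherever nothing is
    prescribed. The map [r] completes any choice of coordinates to an admissible
    value and keeps the coordinates of values that are already admissible.

    Coordinates are chosen in stages. A stage [lifted I l] settles those in a
    stable set [I], compatibly with a solution at each single point. It can be
    enlarged when [I] is [independent], meaning that completing does not let
    coordinates outside [I] influence those in [I]: then [r] produces nearby
    solutions that agree with the stage. *)
Section EquivariantLifting.
Variables (G : profiniteGroupType) (Y E : gset G) (adm forced : Y -> E -> Prop).
Local Notation K := (coords E).
Local Notation cube := (cube E).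
Variable r : Y * cube -> E.
Hypothesis adm_act : forall g y e, adm y e -> adm (ga g y) (ga g e).
Hypothesis forced_act : forall g y e, forced y e -> forced (ga g y) (ga g e).
Hypothesis forced_adm : forall y e, forced y e -> adm y e.
Hypothesis forced_unique : forall y e e', forced y e -> forced y e' -> e = e'.
Hypothesis forced_closed : closed [set p : Y * E | forced p.1 p.2].
Hypothesis r_cont : continuous r.
Hypothesis r_adm : forall y w, adm y (r (y, w)).
Hypothesis r_code : forall y e, adm y e -> r (y, code e) = e.
Hypothesis free_or_forced : forall y,
  (forall g, ga g y = y -> g = 1%g) \/ exists e, forced y e.

Definition allowed y e := adm y e /\ forall e', forced y e' -> e = e'.
Local Notation C := allowed.

Lemma allowed_act g y e : C y e -> C (ga g y) (ga g e).
Proof.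
move=> [Be Fe]; split; first exact: adm_act.
move=> e' /(forced_act g^-1%g); rewrite gaK => /Fe ->; exact: gaKV.
Qed.

Lemma allowed_forced y e : forced y e -> C y e.
Proof. by move=> Fe; split=> [|e']; [exact: forced_adm|exact: forced_unique]. Qed.

Definition gk_set (g : G) (k : K) : set E := [set e | sval k (ga g^-1%g e)].
Lemma gk_clopen g k : clopen (gk_set g k).
Proof. by apply: preimage_clopen; [exact: svalP k|exact: ga_continuous_r]. Qed.
Definition gk (g : G) (k : K) : K := exist _ (gk_set g k) (gk_clopen g k).

Lemma coords_eq (k k' : K) : (forall e, code e k = code e k') -> k = k'.
Proof.
case: k k' => [A cA] [B cB] H.
have AB : A = B.
  apply/seteqP; split=> e.
    by move=> Ae; apply/(codeP e (exist _ B cB)); rewrite -H; exact/codeP.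
  by move=> Be; apply/(codeP e (exist _ A cA)); rewrite H; exact/codeP.
by subst B; rewrite (Prop_irrelevance cA cB).
Qed.

Lemma code_gk g e k : code e (gk g k) = code (ga g^-1%g e) k.
Proof. by apply/idP/idP => /codeP H; exact/codeP. Qed.
Lemma code_ga g e k : code (ga g e) (gk g k) = code e k.
Proof. by rewrite code_gk gaK. Qed.

Lemma gk1 k : gk 1%g k = k.
Proof. by apply: coords_eq => e; rewrite code_gk invg1 ga1. Qed.
Lemma gkM g h k : gk (g * h)%g k = gk g (gk h k).
Proof. by apply: coords_eq => e; rewrite !code_gk invgM gaM. Qed.
Lemma gkK g k : gk g^-1%g (gk g k) = k.
Proof. by rewrite -gkM mulVg gk1. Qed.
Lemma gkKV g k : gk g (gk g^-1%g k) = k.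
Proof. by rewrite -gkM mulgV gk1. Qed.

Definition stable (I : set K) := forall g k, I k -> I (gk g k).
Definition finitary (F : set K) := exists s : seq K, forall k, F k -> k \in s.

Definition orbit_of (F : set K) : set K := [set k | exists g k', F k' /\ k = gk g k'].

Lemma orbit_stable F : stable (orbit_of F).
Proof. by move=> g _ [h [k [Fk ->]]]; exists (g * h)%g, k; rewrite gkM. Qed.

Lemma orbit_finitary F : finitary F -> finitary (orbit_of F).
Proof.
move=> [s]; elim: s F => [|k s IHs] F Fs.
  by exists [::] => x [g [k [Fk _]]]; have := Fs k Fk; rewrite in_nil.
have [t tP] := clopen_finite_orbit (svalP k).
have [u uP] := IHs (fun k' => k' \in s) (fun k' H => H).
exists ([seq gk h^-1%g k | h <- t] ++ u) => _ [g [k' [/Fs + ->]]].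
rewrite inE mem_cat => /orP[/eqP ->|k's]; last by rewrite uP ?orbT //; exists g, k'.
have [h ht hP] := tP g^-1%g.
apply/orP; left; apply/mapP; exists h => //; apply: coords_eq => e.
by rewrite !code_gk invgK; apply/idP/idP => /codeP /hP /codeP.
Qed.

Record lifted (I : set K) (l : Y -> K -> bool) : Prop := Lifted {
  lifted_stable : stable I;
  lifted_clopen : forall k, I k -> clopen [set y | l y k];
  lifted_act : forall k g y, I k -> l (ga g y) (gk g k) = l y k;
  lifted_ex : forall y, exists2 e, C y e & forall k, I k -> code e k = l y k }.

Definition independent (I : set K) := forall y (w w' : cube),
  (forall k, I k -> w k = w' k) ->
  forall k, I k -> code (r (y, w)) k = code (r (y, w')) k.

Lemma allowed_closed y : closed [set e | C y e].
Proof.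
have [[e0 F0]|nF] := pselect (exists e, forced y e).
  have -> : [set e | C y e] = [set e0].
    apply/seteqP; split=> [e [_ /(_ _ F0)] //|_ ->]; exact: allowed_forced.
  by apply: accessible_closed_set1; apply: hausdorff_accessible; exact: profinite_hausdorff.
have -> : [set e | C y e] = [set e | r (y, code e) = e].
  apply/seteqP; split=> e /=; first by move=> [Be _]; exact: r_code.
  by move=> <-; split=> // e' Fe'; case: nF; exists e'.
apply: closed_eq; first exact: profinite_hausdorff; last exact: (fun x => @cvg_id _ _).
apply: (@comp_continuous _ _ _ (fun e : E => (y, code e)) r) => //.
by apply: pair_continuous; [exact: cst_continuous|exact: code_continuous].
Qed.

(** Prescribed values form a closed relation, so those near [y0] are close to
    the one at [y0], by compactness of [E]. *)
Lemma forced_near y0 e0 k : C y0 e0 ->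
  nbhs y0 [set y | forall e, forced y e -> code e k = code e0 k].
Proof.
move=> [_ e0F]; pose V := [set e : E | ~ code e k = code e0 k].
have cV : closed V.
  rewrite /V -openC openE => e /= /contrapT ek.
  by apply: filterS (coord_near e k) => e' /= e'k; rewrite e'k ek.
have : closed [set y | exists e, [set p : Y * E | forced p.1 p.2 /\ V p.2] (y, e)].
  apply: closed_proj1; first exact: profinite_compact.
  apply: closedI => //; apply: (closed_preimage (f := snd)) => //; exact: snd_continuous.
move=> cN; have : open_nbhs y0 (~` [set y | exists e, forced y e /\ V e]).
  split; first exact: closed_openC.
  by move=> [e [/= /e0F <-]]; exact.
move=> /open_nbhs_nbhs; apply: filterS => y ny e Fe.
by apply: contrapT => ne; apply: ny; exists e.
Qed.

(** Values with given coordinates form a closed set, so finitely many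
    coordinates at a time suffice by compactness. *)
Lemma lifted_of_finite (I : set K) (l : Y -> K -> bool) y :
  (forall s : seq K, (forall k, k \in s -> I k) ->
     exists2 e, C y e & forall k, k \in s -> code e k = l y k) ->
  exists2 e, C y e & forall k, I k -> code e k = l y k.
Proof.
move=> H; apply: contrapT => nex.
pose P (A : set E) := exists2 s : seq K, (forall k, k \in s -> I k) &
  forall e, A e -> C y e -> ~ (forall k, k \in s -> code e k = l y k).
suff [s sI sP] : P setT.
  by have [e Ce he] := H s sI; exact: (sP e Logic.I).
apply: compact_union_ind; first exact: profinite_compact.
- by exists [::].
- move=> A B [s sI sA] [t tI tB]; exists (s ++ t) => [k|e].
    by rewrite mem_cat => /orP[/sI|/tI].
  move=> [Ae|Be] Ce He; [apply: (sA e)|apply: (tB e)] => // k ks; apply: He;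
    by rewrite mem_cat ks ?orbT.
move=> e; have [Ce|nCe] := pselect (C y e).
  have [k /not_implyP[Ik nk]] : exists k, ~ (I k -> code e k = l y k).
    by apply/existsNP => He; apply: nex; exists e.
  exists [set e' | code e' k = code e k]; first exact: coord_near.
  exists [:: k] => [j|e' e'e _ He]; first by rewrite inE => /eqP ->.
  by apply: nk; rewrite -e'e He // inE.
exists (~` [set e | C y e]); last by exists [::].
by apply: open_nbhs_nbhs; split=> //; apply: closed_openC; exact: allowed_closed.
Qed.

(** The finite step: once finitely many coordinates separate the part already
    lifted from an independent set, the next coordinates can be chosen locally
    constantly, equivariantly along orbits. *)
Section FiniteStep.
Variables (I J : set K) (l : Y -> K -> bool).
Hypothesis I_indep : independent I.
Hypothesis IJ : forall k, I k -> J k.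
Hypothesis J_fin : finitary (fun k => J k /\ ~ I k).
Hypothesis Jl : lifted J l.
Variable L : set K.
Hypothesis L_stable : stable L.
Hypothesis L_fin : finitary L.

(** Completing the coordinates of the stage in [I], and those of [e0] elsewhere,
    gives a continuous choice of admissible values that passes through [e0].
    Close to [y0] it has the required coordinates in the finite sets [J \ I] and
    [L], and independence takes care of those in [I]. Where a value is
    prescribed, it has the coordinates of the stage, and those in [L] by
    closeness to [e0]. *)
Lemma local_coordinates y0 e0 : C y0 e0 -> (forall k, J k -> code e0 k = l y0 k) ->
  nbhs y0 [set y | exists2 e, C y e &
    (forall k, J k -> code e k = l y k) /\ (forall k, L k -> code e k = code e0 k)].
Proof.
move=> C0 e0J.
pose wy y : cube := fun k => if pselect (I k) then l y k else code e0 k.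
have wyI y j : I j -> wy y j = l y j by rewrite /wy => Ij; case: pselect.
have w0 : wy y0 = code e0.
  apply: functional_extensionality_dep => k; rewrite /wy; case: pselect => // Ik.
  by rewrite e0J //; exact: IJ.
have cr : continuous (fun y => r (y, wy y)).
  apply: (@comp_continuous _ _ _ (fun y => (y, wy y)) r) => //.
  apply: pair_continuous; first exact: (fun x => @cvg_id _ _).
  apply: fun_continuous => k; rewrite /wy; case: (pselect (I k)) => [Ik|nIk]; last exact: cst_continuous.
  move=> y U Uy; apply: filterS (clopen_near y (lifted_clopen Jl (IJ Ik))) => y' /= H.
  suff -> : (l y' k = l y k) by exact: nbhs_singleton.
  by apply/idP/idP => /H.
have rE : r (y0, wy y0) = e0 by rewrite w0 r_code //; case: C0.
have near_s (s : seq K) : nbhs y0 [set y | forall k, k \in s -> code (r (y, wy y)) k = code e0 k].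
  elim: s => [|k s IHs]; first by apply: filterS filterT.
  have n1 : nbhs y0 [set y | code (r (y, wy y)) k = code e0 k].
    by have := cr y0 _ (coord_near (r (y0, wy y0)) k); rewrite rE.
  apply: filterS (filterI n1 IHs) => y [/= yk ys] j.
  by rewrite inE => /orP[/eqP ->|/ys].
have near_l (s : seq K) : (forall k, k \in s -> J k) ->
    nbhs y0 [set y | forall k, k \in s -> l y k = l y0 k].
  elim: s => [|k s IHs] sJ; first by apply: filterS filterT.
  have n1 := clopen_near y0 (lifted_clopen Jl (sJ k (mem_head _ _))).
  have n2 : nbhs y0 [set y | forall k, k \in s -> l y k = l y0 k].
    by apply: IHs => j js; apply: sJ; rewrite inE js orbT.
  apply: filterS (filterI n1 n2) => y [/= yk ys] j.
  by rewrite inE => /orP[/eqP ->|/ys //]; apply/idP/idP => /yk.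
case: J_fin => s sJ; case: L_fin => t tF.
pose s' := [seq k <- s | `[< J k >]].
have nl : nbhs y0 [set y | forall k, k \in s' -> l y k = l y0 k].
  by apply: near_l => k; rewrite mem_filter => /andP[/asboolP].
have nf (u : seq K) : nbhs y0 [set y | forall e, forced y e -> forall k, k \in u -> code e k = code e0 k].
  elim: u => [|k u IHu]; first by apply: filterS filterT.
  apply: filterS (filterI (forced_near k C0) IHu) => y [/= yk yu] e Fe j.
  by rewrite inE => /orP[/eqP ->|]; [exact: yk|exact: yu].
apply: filterS (filterI nl (filterI (near_s s) (filterI (near_s t) (nf t)))) => y.
move=> [/= yl [ys [yt yf]]].
have [e Ce eJ] := lifted_ex Jl y.
have [[e1 F1]|nF] := pselect (exists e, forced y e).
  exists e => //; split=> // k /tF; apply: yf.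
  by case: Ce => _ /(_ _ F1) ->.
exists (r (y, wy y)); first by split=> // e' Fe'; case: nF; exists e'.
split=> [k Jk|k /tF /yt //].
have [Ik|nIk] := pselect (I k); last first.
  have ks : k \in s by exact: sJ.
  rewrite ys // yl ?e0J // mem_filter ks andbT; exact/asboolP.
have -> : code (r (y, wy y)) k = code (r (y, code e)) k.
  by apply: I_indep => // j Ij; rewrite wyI // eJ //; exact: IJ.
by rewrite r_code; [apply: eJ; exact: IJ|case: Ce].
Qed.

(** If the stabilizer of [y0] is not trivial, then [e0] is the prescribed value,
    and the stabilizer fixes it too. *)
Lemma stabilizer_fixes y0 e0 g : C y0 e0 -> ga g y0 = y0 -> forall k, code e0 (gk g k) = code e0 k.
Proof.
move=> C0 gy k; case: (free_or_forced y0) => [fr|[e1 F1]].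
  by rewrite (fr g gy) gk1.
have ge : ga g e0 = e0.
  have e01 : e0 = e1 by case: C0 => _; exact.
  by rewrite {}e01; apply: (forced_unique (y := y0)) => //; have := forced_act g F1; rewrite gy.
by rewrite -{1}ge code_ga.
Qed.

(** Group elements moving [y0] move a neighbourhood of [y0] off itself, and
    those close to the stabilizer fix the coordinates in [L] of [e0]; compactness
    of the group makes the neighbourhood uniform. *)
Lemma small_translates y0 e0 : C y0 e0 -> exists2 N : set Y, nbhs y0 N &
  forall g y, N y -> N (ga g y) -> forall k, L k -> code e0 (gk g k) = code e0 k.
Proof.
move=> C0.
suff [N Ny NP] : exists2 N : set Y, nbhs y0 N & forall g y, [set: G] g -> N y -> N (ga g y) ->
    forall k, L k -> code e0 (gk g k) = code e0 k.
  by exists N => // g y; exact: NP.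
apply: (@compact_union_ind _ (fun A => exists2 N : set Y, nbhs y0 N &
  forall g y, A g -> N y -> N (ga g y) -> forall k, L k -> code e0 (gk g k) = code e0 k)).
- exact: profinite_compact.
- by exists setT; first exact: filterT.
- move=> A B [N nN NA] [M nM MB]; exists (N `&` M); first exact: filterI.
  by move=> g y [Ag|Bg] [Ny My] [Ngy Mgy]; [exact: (NA g y)|exact: (MB g y)].
move=> g; have [gy|/clopen_points [D [cD Dg nD]]] := pselect (ga g y0 = y0).
  case: L_fin => s sF.
  exists [set h | forall k, k \in s -> code e0 (gk h k) = code e0 (gk g k)]; last first.
    exists setT; first exact: filterT.
    by move=> h y /= hP _ _ k Lk; rewrite hP ?sF // (stabilizer_fixes C0 gy).
  elim: s {sF} => [|k s IHs]; first by apply: filterS filterT.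
  have ci : continuous (fun h : G => ga h^-1%g e0).
    apply: (@comp_continuous _ _ _ (fun h : G => h^-1%g) (fun h : G => ga h e0)).
      exact: invg_continuous.
    exact: ga_continuous_l.
  have n1 : nbhs g [set h | code e0 (gk h k) = code e0 (gk g k)].
    rewrite (_ : [set h | _] = (fun h => ga h^-1%g e0) @^-1`
        [set e | code e k = code (ga g^-1%g e0) k]).
      exact: (ci g _ (coord_near (ga g^-1%g e0) k)).
    by apply/seteqP; split=> h; rewrite /= !code_gk.
  by apply: filterS (filterI n1 IHs) => h [/= hk hs] j; rewrite inE => /orP[/eqP ->|/hs].
case: (@ga_continuous G Y (g, y0) D (open_nbhs_nbhs (conj cD.1 Dg))) => -[A B] /= [Ag By] AB.
exists A => //; exists (B `&` ~` D).
  by apply: filterI => //; apply: open_nbhs_nbhs; split=> //; apply: closed_openC; case: cD.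
by move=> h y Ah [yB _] [_ nDh]; case: nDh; exact: (AB (h, y)).
Qed.

Definition solved (M : set Y) := [/\ clopen M, forall g y, M y -> M (ga g y) &
  exists psi : Y -> K -> bool, [/\
    forall k, L k -> clopen [set y | M y /\ psi y k],
    forall k g y, L k -> M y -> psi (ga g y) (gk g k) = psi y k &
    forall y, M y -> exists2 e, C y e & (forall k, J k -> code e k = l y k) /\
      (forall k, L k -> code e k = psi y k)]].

(** The coordinates in [L] of the value [e0] at [y0] serve on a small clopen
    neighbourhood [N], and their translates on the translates of [N]. They agree
    on overlaps, where only small translations are involved. *)
Lemma solved_local (y0 : Y) : exists2 M : set Y, nbhs y0 M & solved M.
Proof.
have [e0 C0 e0J] := lifted_ex Jl y0.
have n1 := local_coordinates C0 e0J.
have [N2 n2 N2P] := small_translates C0.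
have [N [cN Ny0 NN]] := clopen_nbhs (filterI n1 n2).
pose M := [set y | exists g, N (ga g y)].
have cM : clopen M by exact: orbit_clopen.
exists M; first by apply: open_nbhs_nbhs; split; [case: cM|exists 1%g; rewrite ga1].
have M_act g y : M y -> M (ga g y).
  by move=> [h Nh]; exists (h * g^-1)%g; rewrite -gaM -mulgA mulVg mulg1.
pose psi y k := `[< exists g, N (ga g y) /\ code e0 (gk g k) >].
have psiE y g k : L k -> N (ga g y) -> psi y k = code e0 (gk g k).
  move=> Lk Ng; apply/asboolP/idP; last by exists g.
  move=> [h [Nh]]; have := N2P (g * h^-1)%g (ga h y) (NN _ Nh).2.
  rewrite -gaM -mulgA mulVg mulg1 => /(_ (NN _ Ng).2 (gk h k) (L_stable h Lk)).
  by rewrite -gkM -mulgA mulVg mulg1 => ->.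
split=> //; exists psi; split.
- move=> k Lk.
  have -> : [set y | M y /\ psi y k] = [set y | exists g, N (ga g y) /\ code e0 (gk g k)].
    by apply/seteqP; split=> y /=; [move=> [_ /asboolP]|move=> H; split;
      [case: H => g [Ng _]; exists g|apply/asboolP]].
  split.
    have -> : [set y | exists g, N (ga g y) /\ code e0 (gk g k)] =
        \bigcup_(g in [set g | code e0 (gk g k)]) (ga g @^-1` N).
      by apply/seteqP; split=> [y [g [Ny cg]]|y [g cg Ny]]; exists g.
    by apply: bigcup_open => g _; apply: open_preimage; [exact: ga_continuous_r|case: cN].
  apply: (@closed_proj1 Y G [set p : Y * G | N (ga p.2 p.1) /\ code e0 (gk p.2 k)]).
    exact: profinite_compact.
  apply: closedI.
    apply: (@closed_preimage _ _ (fun p : Y * G => ga p.2 p.1)); last by case: cN.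
    apply: (@comp_continuous _ _ _ (fun p : Y * G => (p.2, p.1)) (fun p : G * Y => ga p.1 p.2)).
      by apply: pair_continuous; [exact: snd_continuous|exact: fst_continuous].
    exact: ga_continuous.
  have -> : (fun p : Y * G => is_true (code e0 (gk p.2 k))) =
      (fun p : Y * G => ga p.2^-1%g e0) @^-1` sval k.
    apply/seteqP; split=> p /=; rewrite code_gk; first by move=> /codeP.
    by move=> H; apply/codeP.
  apply: closed_preimage; last by case: (svalP k).
  apply: (@comp_continuous _ _ _ snd (fun h : G => ga h^-1%g e0)); first exact: snd_continuous.
  apply: (@comp_continuous _ _ _ (fun h : G => h^-1%g) (fun h : G => ga h e0)).
    exact: invg_continuous.
  exact: ga_continuous_l.
- move=> k g y Lk [h Nh].
  rewrite (psiE y h k) // (psiE (ga g y) (h * g^-1)%g (gk g k)).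
  + by rewrite gkM gkK.
  + exact: L_stable.
  + by rewrite -gaM -mulgA mulVg mulg1.
- move=> y [h Nh]; have [[e Ce [eJ eF]] _] := NN _ Nh.
  exists (ga h^-1%g e); first by rewrite -[y](gaK h); exact: allowed_act.
  split=> k kP.
    have := eJ (gk h k) (lifted_stable Jl h kP).
    by rewrite code_gk (lifted_act Jl).
  by rewrite (psiE _ h) // -eF ?code_gk //; exact: L_stable.
Qed.

Lemma solved_all : solved setT.
Proof.
apply: (@compact_union_ind _ solved); first exact: profinite_compact.
- split=> //; first exact: clopen0.
  exists (fun _ _ => false); split=> // k _.
  rewrite (_ : [set y | set0 y /\ false] = set0); first exact: clopen0.
  by apply/seteqP; split=> y [].
- move=> A B [cA sA [pA [A1 A2 A3]]] [cB sB [pB [B1 B2 B3]]]; split.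
  + exact: clopenU.
  + by move=> g y [/(sA g)|/(sB g)]; [left|right].
  have nA g y : ~ A y -> ~ A (ga g y).
    by move=> nAy Agy; apply: nAy; rewrite -[y](gaK g); exact: sA.
  exists (fun y => if pselect (A y) then pA y else pB y); split.
  + move=> k Lk.
    rewrite (_ : [set y | _] = [set y | A y /\ pA y k] `|` ([set y | B y /\ pB y k] `&` ~` A)).
      apply: clopenU; first exact: A1.
      by apply: clopenI; [exact: B1|exact: clopenC].
    apply/seteqP; split=> y /=.
      case: pselect => [Ay|nAy] [+ py]; first by left.
      by case=> // By; right; split.
    case: pselect => [Ay|nAy]; first by case=> [[_ py]|[_ /(_ Ay)]]; split=> //; left.
    by case=> [[]|[[By py] _]] //; split=> //; right.
  + move=> k g y Lk ABy; case: pselect => [Agy|nAgy]; case: pselect => [Ay|nAy].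
    * exact: A2.
    * by case: (nA g y nAy).
    * by case: nAgy; exact: sA.
    * by apply: B2 => //; case: ABy.
  + move=> y ABy; case: pselect => [Ay|nAy]; first exact: A3.
    by apply: B3; case: ABy.
- exact: solved_local.
Qed.

Lemma finite_step : exists l', lifted (J `|` L) l' /\ forall y k, J k -> l' y k = l y k.
Proof.
have [_ _ [psi [p1 p2 p3]]] := solved_all.
exists (fun y k => if pselect (J k) then l y k else psi y k); split; last first.
  by move=> y k Jk; case: pselect.
have nJ g k : ~ J k -> ~ J (gk g k).
  by move=> nJk Jgk; apply: nJk; rewrite -(gkK g k); exact: (lifted_stable Jl).
split.
- by move=> g k [/(lifted_stable Jl g)|/(L_stable g)]; [left|right].
- move=> k JLk; case: pselect => [Jk|nJk]; first exact: (lifted_clopen Jl Jk).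
  have Lk : L k by case: JLk.
  have := p1 k Lk; rewrite (_ : [set y | _ /\ _] = [set y | psi y k]) //.
  by apply/seteqP; split=> y //= [].
- move=> k g y JLk; case: (pselect (J k)) => [Jk|nJk]; case: pselect => [Jgk|nJgk].
  + exact: (lifted_act Jl).
  + by case: nJgk; exact: (lifted_stable Jl).
  + by case: (nJ g k nJk).
  + by apply: p2 => //; case: JLk.
- move=> y; have [e Ce [eJ eF]] := p3 y Logic.I; exists e => // k JLk.
  by case: pselect => [/eJ //|nJk]; apply: eF; case: JLk.
Qed.
End FiniteStep.

(** ** The countable step *)

Lemma r_dependence (k : K) : exists s : seq K, forall y w w', agree s w w' ->
  code (r (y, w)) k = code (r (y, w')) k.
Proof.
have [|s sP] := @finite_dependence E Y [set p | sval k (r p)].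
  exact: preimage_clopen (svalP k) r_cont.
by exists s => y w w' /(sP y) H; apply/idP/idP => /codeP /H /codeP.
Qed.

Definition dep (k : K) : seq K := sval (cid (r_dependence k)).
Lemma depP k y w w' : agree (dep k) w w' -> code (r (y, w)) k = code (r (y, w')) k.
Proof. by move=> H; exact: (svalP (cid (r_dependence k))). Qed.

Section CountableStep.
Variables (I : set K) (l : Y -> K -> bool) (k0 : K).
Hypothesis I_indep : independent I.
Hypothesis Il : lifted I l.

(** To keep the enlarged set independent, all coordinates have to be added on
    which the completion of an added coordinate depends. Each layer consists of
    finitely many orbits, but only the union of all layers is independent. *)
Fixpoint layer n : set K :=
  match n with
  | 0 => orbit_of [set k0]
  | n.+1 => orbit_of [set k' | exists2 k, layer n k & k' \in dep k]
  end.

Lemma layer_stable n : stable (layer n).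
Proof. by case: n => [|n]; exact: orbit_stable. Qed.

Lemma layer_finitary n : finitary (layer n).
Proof.
elim: n => [|n [s sP]]; apply: orbit_finitary.
  by exists [:: k0] => k ->; rewrite inE.
exists (flatten [seq dep k | k <- s]) => k' [k /sP ks k'd].
by apply/flattenP; exists (dep k) => //; apply/mapP; exists k.
Qed.

Lemma layer_dep n k k' : layer n k -> k' \in dep k -> layer n.+1 k'.
Proof. by move=> nk k'd; exists 1%g, k'; rewrite gk1; split=> //; exists k. Qed.

Fixpoint stage n : set K := match n with 0 => I | n.+1 => stage n `|` layer n end.

Lemma stage_sub m n : (m <= n)%N -> forall k, stage m k -> stage n k.
Proof.
elim: n => [|n IHn]; first by rewrite leqn0 => /eqP ->.
rewrite leq_eqVlt => /orP[/eqP -> //|]; rewrite ltnS => /IHn H k /H; by left.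
Qed.

Lemma stage_finitary n : finitary (fun k => stage n k /\ ~ I k).
Proof.
elim: n => [|n [s sP]]; first by exists [::] => k [].
have [t tP] := layer_finitary n.
exists (s ++ t) => k [[nk|/tP kt] nIk]; rewrite mem_cat; first by rewrite sP.
by rewrite kt orbT.
Qed.

Lemma stage_lifts : exists f : nat -> Y -> K -> bool, f 0 = l /\
  forall n, lifted (stage n) (f n) /\ forall y k, stage n k -> f n.+1 y k = f n y k.
Proof.
have ex n l' : exists l'', lifted (stage n) l' ->
    lifted (stage n.+1) l'' /\ forall y k, stage n k -> l'' y k = l' y k.
  have [Hl|nH] := pselect (lifted (stage n) l'); last by exists l'.
  have [l'' [H1 H2]] := finite_step I_indep (@stage_sub 0 n isT)
    (stage_finitary n) Hl (@layer_stable n) (layer_finitary n).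
  by exists l''.
have [sg sgP] := choice (fun nl : nat * (Y -> K -> bool) => ex nl.1 nl.2).
pose f := fix f n := match n with 0 => l | n.+1 => sg (n, f n) end.
have fl n : lifted (stage n) (f n) by elim: n => // n /(sgP (n, f n))[].
by exists f; split=> // n; split=> //; have [] := sgP (n, f n) (fl n).
Qed.

Lemma countable_step : exists I' l', [/\ lifted I' l', independent I', I' k0 &
  forall k, I k -> I' k /\ forall y, l' y k = l y k].
Proof.
have [f [f0 fP]] := stage_lifts.
have fE m n y k : (m <= n)%N -> stage m k -> f n y k = f m y k.
  move=> + mk; elim: n => [|n IHn]; first by rewrite leqn0 => /eqP ->.
  rewrite leq_eqVlt => /orP[/eqP -> //|]; rewrite ltnS => mn.
  by rewrite (fP n).2 ?IHn //; exact: stage_sub mn _ mk.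
pose I' : set K := [set k | exists n, stage n k].
pose l' y k := if pselect (exists n, stage n k) is left H then f (sval (cid H)) y k else false.
have l'E n y k : stage n k -> l' y k = f n y k.
  move=> nk; rewrite /l'; case: pselect => [H|[]]; last by exists n.
  case: (cid H) => m mk /=.
  by case/orP: (leq_total m n) => mn; [rewrite (fE m n)|rewrite -(fE n m)].
exists I', l'; split.
- split.
  + by move=> g k [n nk]; exists n; exact: (lifted_stable (fP n).1).
  + move=> k [n nk]; rewrite (_ : [set y | l' y k] = [set y | f n y k]).
      exact: (lifted_clopen (fP n).1).
    by apply/seteqP; split=> y /=; rewrite (l'E n).
  + move=> k g y [n nk]; rewrite !(l'E n) //; first exact: (lifted_act (fP n).1).
    exact: (lifted_stable (fP n).1).
  + move=> y; apply: lifted_of_finite => s sI.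
    have [n nP] : exists n, forall k, k \in s -> stage n k.
      elim: s sI => [|k s IHs] sI; first by exists 0.
      have [m mk] := sI k (mem_head _ _).
      have [|n nP] := IHs; first by move=> j js; apply: sI; rewrite inE js orbT.
      exists (maxn m n) => j; rewrite inE => /orP[/eqP ->|/nP].
        by apply: stage_sub mk; exact: leq_maxl.
      by apply: stage_sub; exact: leq_maxr.
    have [e Ce eP] := lifted_ex (fP n).1 y; exists e => // k ks.
    by rewrite eP ?(l'E n) //; exact: nP.
- move=> y w w' ww' k [n nk].
  have [Ik|nIk] := pselect (I k).
    by apply: I_indep => // j Ij; apply: ww'; exists 0.
  have [m mk] : exists m, layer m k.
    elim: n nk => // n IHn [|]; first exact: IHn.
    by exists n.
  apply: depP => j /(layer_dep mk) mj; apply: ww'; exists m.+2; right; exact: mj.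
- by exists 1; right; exists 1%g, k0; rewrite gk1.
- by move=> k Ik; split=> [|y]; [exists 0|rewrite (l'E 0) // f0].
Qed.
End CountableStep.

(** ** Maximal partial lifts *)

Record partial := Partial {
  part_dom : set K;
  part_fun : Y -> K -> bool;
  part_lifted : lifted part_dom part_fun;
  part_indep : independent part_dom }.

Definition extends (p q : partial) := forall k, part_dom p k ->
  part_dom q k /\ forall y, part_fun q y k = part_fun p y k.

Lemma empty_lifted : lifted set0 (fun _ _ => false).
Proof.
split=> // y; have [[e Fe]|nF] := pselect (exists e, forced y e).
  by exists e => //; exact: allowed_forced.
by exists (r (y, fun=> false)) => //; split=> // e Fe; case: nF; exists e.
Qed.
Definition empty_partial : partial := @Partial set0 _ empty_lifted (fun _ _ _ _ _ f => match f with end).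

Lemma extends_refl p : extends p p. Proof. by move=> k pk. Qed.
Lemma extends_trans q p t : extends p q -> extends q t -> extends p t.
Proof.
move=> pq qt k /pq [/qt [tk tE] qE]; split=> // y; by rewrite tE qE.
Qed.

Lemma chain_bound (A : set partial) : total_on A extends -> exists t, forall p, A p -> extends p t.
Proof.
move=> tot; have [[p0 Ap0]|nA] := pselect (exists p, A p); last first.
  by exists empty_partial => p Ap; case: nA; exists p.
pose I : set K := [set k | exists p, A p /\ part_dom p k].
pose l y k := if pselect (exists p, A p /\ part_dom p k) is left H
  then part_fun (sval (cid H)) y k else false.
have lE p y k : A p -> part_dom p k -> l y k = part_fun p y k.
  move=> Ap pk; rewrite /l; case: pselect => [H|[]]; last by exists p.
  case: (cid H) => q [Aq qk] /=.
  by case: (tot _ _ Ap Aq) => [/(_ k pk)[_ ->]|/(_ k qk)[_ ->]].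
have Il : lifted I l.
  split.
  - by move=> g k [p [Ap pk]]; exists p; split=> //; exact: (lifted_stable (part_lifted p)).
  - move=> k [p [Ap pk]]; rewrite (_ : [set y | l y k] = [set y | part_fun p y k]).
      exact: (lifted_clopen (part_lifted p)).
    by apply/seteqP; split=> y /=; rewrite (lE p).
  - move=> k g y [p [Ap pk]]; rewrite !(lE p) //; first exact: (lifted_act (part_lifted p)).
    exact: (lifted_stable (part_lifted p)).
  - move=> y; apply: lifted_of_finite => s sI.
    have [p [Ap pP]] : exists p, A p /\ forall k, k \in s -> part_dom p k.
      elim: s sI => [|k s IHs] sI; first by exists p0.
      have [p [Ap pk]] := sI k (mem_head _ _).
      have [|q [Aq qP]] := IHs; first by move=> j js; apply: sI; rewrite inE js orbT.
      case: (tot _ _ Ap Aq) => H.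
        by exists q; split=> // j; rewrite inE => /orP[/eqP ->|/qP //]; case: (H k pk).
      by exists p; split=> // j; rewrite inE => /orP[/eqP -> //|/qP /H []].
    have [e Ce eP] := lifted_ex (part_lifted p) y; exists e => // k ks.
    by rewrite eP ?(lE p) //; exact: pP.
have Ii : independent I.
  move=> y w w' ww' k [p [Ap pk]]; apply: (part_indep (p := p)) => // j pj.
  by apply: ww'; exists p.
exists (Partial Il Ii) => p Ap k pk; split; first by exists p.
by move=> y /=; exact: lE.
Qed.

(** A maximal stage settles every coordinate: any missing one could be added
    together with countably many others. *)
Theorem equivariant_lifting : exists lam : Y -> E, [/\ continuous lam,
  (forall g y, lam (ga g y) = ga g (lam y)), (forall y, adm y (lam y)) &
  forall y e, forced y e -> lam y = e].
Proof.
have [||A tot|p pmax] := @ZL_preorder partial empty_partial (fun p q => `[< extends p q >]).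
- by move=> p; apply/asboolP; exact: extends_refl.
- by move=> p q t /asboolP pq /asboolP qt; apply/asboolP; exact: extends_trans pq qt.
- have [t tP] : exists t, forall p, A p -> extends p t.
    by apply: chain_bound => p q Ap Aq; case: (tot p q Ap Aq) => /asboolP; [left|right].
  by exists t => p /tP H; apply/asboolP.
have full k : part_dom p k.
  apply: contrapT => nk.
  have [I' [l' [Il' Ii' I'k H]]] := countable_step k (part_indep (p := p)) (part_lifted p).
  have /pmax/asboolP/(_ k I'k)[] : `[< extends p (Partial Il' Ii') >] by apply/asboolP.
  by [].
have pl := part_lifted p.
have ex y : exists e, C y e /\ forall k, code e k = part_fun p y k.
  by have [e Ce eP] := lifted_ex pl y; exists e; split=> // k; exact: eP.
have [lam lamP] := choice ex.
exists lam; split=> [|g y|y|y]; try by case: (lamP y) => -[].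
  apply: continuous_coords => k.
  rewrite (_ : [set x | _] = [set y | part_fun p y k]).
    by case: (lifted_clopen pl (full k)).
  by apply/seteqP; split=> y /=; rewrite (lamP y).2.
apply: code_inj; apply: functional_extensionality_dep => k.
by rewrite -(gkKV g k) (lamP _).2 (lifted_act pl) ?code_ga ?(lamP _).2.
Qed.
End EquivariantLifting.

(** * Faces and degeneracies generate the simplex category *)

Section Codegeneracy.
Variables (n : nat) (i : 'I_n.+2).
Lemma codeg_mono : {homo (fun x : 'I_n.+2 => inord (minn n (unbump i x)) : 'I_n.+1) :
  x y / (x <= y)%N}.
Proof. by move=> x y xy; rewrite !inordK ?ltnS ?geq_minl // /unbump; lia. Qed.
Definition codeg : delta n.+1 n := Delta codeg_mono.
Lemma codegE x : codeg x = minn n (unbump i x) :> nat.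
Proof. by rewrite /= inordK // ltnS geq_minl. Qed.
End Codegeneracy.

Lemma delta_compE l m n (s : delta m n) (t : delta l m) x : delta_comp s t x = s (t x).
Proof. by []. Qed.

Lemma codegK n (i x : 'I_n.+2) : x <> i :> nat -> coface i (codeg i x) = x :> nat.
Proof.
move=> xi; rewrite cofaceE codegE /bump /unbump.
by case: i x xi => [i i2] [x x2] /= xi; lia.
Qed.

Lemma cofaceK n (i : 'I_n.+2) x : codeg i (coface i x) = x :> nat.
Proof.
by rewrite codegE cofaceE /bump /unbump; case: i x => [i i2] [x x2] /=; lia.
Qed.

Definition misses l n (i : 'I_n.+1) (t : delta l n) := forall x, t x <> i :> nat.

Lemma smap_misses (X : pspace) l n (i : 'I_n.+2) (t : delta l n.+1) (y : X n.+1) :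
  misses i t -> smap t y = smap (delta_comp (codeg i) t) (face i y).
Proof. by move=> ti; rewrite /face (smap_compE (r := t)) // => x; rewrite codegK. Qed.

Definition collapses m n (i : 'I_m.+2) (t : delta m.+1 n) :=
  forall x, t (coface i (codeg i x)) = t x :> nat.

Lemma smap_collapses (X : pspace) m n (i : 'I_m.+2) (t : delta m.+1 n) (y : X n) :
  collapses i t -> smap t y = smap (codeg i) (smap (delta_comp t (coface i)) y).
Proof. by move=> ti; rewrite (smap_compE (r := t)). Qed.

(** The section of the image that picks the last preimage of the largest value
    not exceeding the argument *)
Section QuasiInverse.
Variables (l n : nat) (t : delta l n).
Definition qinv_fun (x : 'I_n.+1) : 'I_l.+1 := inord (\max_(k < l.+1 | (t k <= x)%N) k).
Lemma qinvE x : qinv_fun x = (\max_(k < l.+1 | (t k <= x)%N) k)%N :> nat.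
Proof. by rewrite /qinv_fun inordK // ltnS; apply/bigmax_leqP => k _; rewrite -ltnS. Qed.
Lemma qinv_mono : {homo qinv_fun : x y / (x <= y)%N}.
Proof.
move=> x y xy; rewrite !qinvE; apply/bigmax_leqP => k kx.
by apply: (leq_bigmax_cond (F := fun k : 'I_l.+1 => k : nat) (P := fun k => (t k <= y)%N) k); exact: leq_trans xy.
Qed.
Definition qinv : delta n l := Delta qinv_mono.

Lemma qinvK x : t (qinv (t x)) = t x.
Proof.
apply/val_inj/eqP; rewrite eqn_leq; apply/andP; split.
  have [k kx E] : {k : 'I_l.+1 | (t k <= t x)%N &
      (\max_(k < l.+1 | (t k <= t x)%N) k)%N = k}.
    apply: (@eq_bigmax_cond _ (fun k : 'I_l.+1 => t k <= t x)%N (fun k => k : nat)).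
    by apply/card_gt0P; exists x; exact: leqnn.
  by have -> : qinv (t x) = k; first by apply: val_inj; rewrite /= qinvE.
apply: delta_mono; rewrite /= qinvE.
exact: (leq_bigmax_cond (F := fun k : 'I_l.+1 => k : nat) (P := fun k => (t k <= t x)%N) x).
Qed.
End QuasiInverse.

Lemma no_miss_leq m n (t : delta m n) :
  ~ (exists i : 'I_n.+1, misses i t) -> (n <= m)%N.
Proof.
move=> nmiss; rewrite -ltnS -[n.+1]card_ord -[m.+1]card_ord.
rewrite -(_ : #|codom t| = #|'I_n.+1|); first exact: leq_image_card.
apply: eq_card => i; rewrite [RHS]inE; apply/codomP.
apply: contrapT => H; apply: nmiss; exists i => x xi; apply: H; exists x.
exact/val_inj/esym.
Qed.

Lemma strict_growth m n (t : delta m n) :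
  ~ (exists i : 'I_m, t (inord i) = t (inord i.+1)) -> forall x y : nat,
  (x <= y <= m)%N -> (t (inord x) + (y - x) <= t (inord y))%N.
Proof.
move=> ncol x; elim=> [|y IHy] xy; first by have -> : x = 0%N; [lia|rewrite addn0].
have [->|xy'] := eqVneq x y.+1; first by rewrite subnn addn0.
have ym : (y < m)%N by lia.
have le1 : (t (inord y) <= t (inord y.+1))%N.
  by apply: delta_mono; rewrite !inordK; lia.
have ne : (t (inord y) : nat) <> t (inord y.+1).
  by move=> e; apply: ncol; exists (Ordinal ym); exact: val_inj.
have := IHy; lia.
Qed.

Lemma short_collapses m n (t : delta m n) : (n < m)%N ->
  exists i : 'I_m, t (inord i) = t (inord i.+1).
Proof.
move=> nm; apply: contrapT => /strict_growth /(_ 0%N m).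
have := ltn_ord (t (inord m)); lia.
Qed.

Lemma delta_cases m n (t : delta m n) : [\/ exists i : 'I_n.+1, misses i t,
  exists i : 'I_m, t (inord i) = t (inord i.+1) | m = n /\ forall x, t x = x :> nat].
Proof.
have [|nmiss] := pselect (exists i : 'I_n.+1, misses i t); first by constructor 1.
have [|/strict_growth step] := pselect (exists i : 'I_m, t (inord i) = t (inord i.+1)).
  by constructor 2.
constructor 3.
have nm := no_miss_leq nmiss.
have mE : m = n.
  have := step 0%N m; have := ltn_ord (t (inord m)); lia.
split=> // x; have xm := ltn_ord x.
have := step 0%N x; have := step x m; rewrite inord_val.
have := ltn_ord (t (inord m)); lia.
Qed.

Lemma collapses_at m n (t : delta m.+1 n) (i : 'I_m.+1) :
  t (inord i) = t (inord i.+1) -> collapses (inord i) t.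
Proof.
move=> ti x; have im := ltn_ord i; have xm := ltn_ord x.
have [xi|xi] := pselect (x = i :> nat); last first.
  congr (val (t _)); apply: val_inj; apply: codegK; rewrite inordK //; lia.
have -> : x = inord i by apply: val_inj; rewrite /= xi inordK //; lia.
rewrite ti; congr (val (t _)); apply: val_inj => /=.
by rewrite /bump /unbump !inordK; lia.
Qed.

(** A surjective endomap that collapses two vertices would factor through a
    surjection from a smaller simplex. *)
Lemma endo_cases n (s : delta n n) :
  (exists i : 'I_n.+1, misses i s) \/ forall x, s x = x :> nat.
Proof.
have [|nmiss] := pselect (exists i : 'I_n.+1, misses i s); first by left.
case: (delta_cases s) => [|[i si]|[]]; [by left| |by right].
case: n => [|n] in s nmiss i si *; first by case: i {si}.
have /no_miss_leq : ~ exists k, misses k (delta_comp s (coface (inord i : 'I_n.+2))).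
  move=> [k km]; apply: nmiss; exists k => x xk.
  by apply: (km (codeg (inord i) x)); rewrite delta_compE (collapses_at si).
by rewrite ltnn.
Qed.

Section Generators.
Variables (Y E : pspace) (h : forall n, Y n -> E n).
Hypothesis h_face : forall n (i : 'I_n.+2) y, h (face i y) = face i (h y).
Hypothesis h_codeg : forall n (i : 'I_n.+2) (y : Y n),
  h (smap (codeg i) y) = smap (codeg i) (h y).

(** A map that misses a vertex factors through a face, one that collapses two
    neighbours through a degeneracy, and any other map is the identity. *)
Lemma natural_of_generators m n (t : delta m n) y : h (smap t y) = smap t (h y).
Proof.
have [k] := ubnP (m + n); elim: k => // k IHk in m n t y *; rewrite ltnS => mn.
case: (delta_cases t) => [[i ti]|[i ti]|[nm tE]].
- case: n => [|n] in t i y ti mn *.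
    by case: (ti ord0); rewrite (ord1 (t ord0)) (ord1 i).
  by rewrite !(smap_misses _ ti) IHk ?h_face //; lia.
- case: m => [|m] in t i ti mn *; first by case: i {ti}.
  rewrite !(smap_collapses _ (collapses_at ti)) h_codeg IHk //; lia.
by subst n; rewrite !smap_idE.
Qed.
End Generators.

(** * Trivial fibrations are retracts of cofree projections *)

Section Embedding.
Variable E : pspace.
(** Coordinates of all simplices at once: the clopen sets of all the profinite
    sets [E n] *)
Definition all_coords := {n : nat & coords (E n)}.
Definition all_dim (j : all_coords) : nat := tag j.
Definition all_val (j : all_coords) : profiniteType := finite_space bool.
Definition hull : pspace := cofree all_dim all_val.

Lemma all_code_continuous (j : all_coords) :
  continuous (fun x : E (all_dim j) => code x (tagged j) : all_val j).
Proof.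
apply: (@comp_continuous _ _ _ (@code _) (fun w : cube _ => w (tagged j))).
  exact: code_continuous.
exact: eval_continuous.
Qed.

Definition emb : pmap E hull := to_cofree all_code_continuous.

Lemma embE m (x : E m) (j : all_coords) t : emb m x j t = code (smap t x) (tagged j).
Proof. by []. Qed.

Variables (Z : pspace) (p : pmap E Z).
(** The graph of the embedding into the contractible hull is a level-wise
    monomorphism and a weak equivalence, so [p] lifts against it. The lift
    exhibits [p] as a retract of the projection from [Z * hull E]. *)
Lemma trivial_fibration_retract : fibration p -> weak_equivalence p ->
  exists r : pmap (prod_pspace Z hull) E,
    (forall n e, r n (p n e, emb n e) = e) /\ (forall n q, p n (r n q) = q.1).
Proof.
move=> fp wp.
have j_mono : levelwise_mono (pair_pmap p emb).
  move=> n e e' /= [_ ee]; apply: code_inj; apply: functional_extensionality_dep => k.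
  pose j : all_coords := Tagged (fun n => coords (E n)) k.
  have := congr1 (fun w : hull n => w j (delta_id _)) ee.
  by rewrite /= /to_cofree_fun !smap_id.
have j_we := graph_weak_equivalence emb (fun _ _ => false) wp.
have [|r [rj pr]] := fp _ _ _ j_mono j_we (pmap_id E) (prod_fst Z hull).
  by [].
by exists r; split=> [n e|n q]; [exact: rj|exact: pr].
Qed.
End Embedding.

Section PartialCoordinates.
Variables (E : pspace) (n : nat) (A : profiniteType) (R : A -> E n -> Prop).
Hypothesis R_closed : closed [set z : A * E n | R z.1 z.2].
Hypothesis R_unique : forall a e e', R a e -> R a e' -> e = e'.
Variable T : forall m, delta m n -> Prop.
Variable c : forall (j : all_coords E), delta (all_dim j) n -> A -> finite_space bool.
Hypothesis c_continuous : forall j (t : delta (all_dim j) n), T t -> continuous (c t).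
Hypothesis c_R : forall a e j (t : delta (all_dim j) n), T t -> R a e ->
  c t a = emb E n e j t.

(** The coordinates with index in [T] are given; each of the others is a
    function to a two-point space prescribed on a closed set. *)
Lemma partial_coordinates : exists w : A -> hull E n, [/\ continuous w,
  forall a j (t : delta (all_dim j) n), T t -> w a j t = c t a &
  forall a e, R a e -> w a = emb E n e].
Proof.
have ex j (t : delta (all_dim j) n) : exists g : A -> finite_space bool, [/\ continuous g,
    T t -> g =1 c t & forall a e, R a e -> g a = emb E n e j t].
  have [Tt|nT] := pselect (T t).
    by exists (c t); split=> //; [exact: c_continuous|move=> a e; exact: c_R].
  have [||g cg gE] := @finite_extension A bool false
      (fun b => [set a | exists e, [set z : A * E n | R z.1 z.2 /\ emb E n z.2 j t = b] (a, e)]).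
  - move=> b; apply: closed_proj1; first exact: profinite_compact.
    apply: closedI => //.
    apply: (closed_preimage (f := fun z : A * E n => emb E n z.2 j t) (A := [set b])).
      apply: (@comp_continuous _ _ _ snd (fun e => emb E n e j t)); first exact: snd_continuous.
      apply: (@comp_continuous _ _ _ (emb E n) (fun w : hull E n => w j t)).
        exact: pmap_continuous.
      exact: cofree_eval_continuous.
    by case: (@finite_fiber_clopen bool _ id [set b] (fun x => @cvg_id _ _)).
  - by move=> s s' a [e [/= Re <-]] [e' [/= Re' <-]]; rewrite (R_unique Re Re').
  by exists g; split=> // a e Re; apply: gE; exists e.
have [g gP] := dependent_choice (fun j => dependent_choice (ex j)).
exists (fun a j t => g j t a); split.
- by apply: cofree_continuous => j t; case: (gP j t).
- by move=> a j t Tt; case: (gP j t) => _ /(_ Tt) ->.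
- by move=> a e Re; apply: cofree_ext => j t; case: (gP j t) => _ _; exact.
Qed.
End PartialCoordinates.

(** * Lifting one skeletal level *)

Section Lifting.
Variables (G : profiniteGroupType) (X Y E Z : gspace G).
Variables (f : gmap X Y) (u : gmap X E) (v : gmap Y Z) (p : gmap E Z).
Hypothesis f_mono : levelwise_mono f.
Hypothesis f_free : forall n, acts_freely_on (~` range (f n)).
Hypothesis pu : forall n x, p n (u n x) = v n (f n x).
Variable r : pmap (prod_pspace Z (hull E)) E.
Hypothesis r_emb : forall n e, r n (p n e, emb E n e) = e.
Hypothesis p_r : forall n q, p n (r n q) = q.1.

Definition level (W : gspace G) n : gset G :=
  GSet (@gact_continuous G W n) (@gact1 G W n) (@gactM G W n).

Section Level.
Variables (n : nat) (T : forall m, delta m n -> Prop).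
Variable c : forall j : all_coords E, delta (all_dim j) n -> Y n -> finite_space bool.
Variables bd forced : Y n -> E n -> Prop.
Hypothesis c_continuous : forall j (t : delta (all_dim j) n), T t -> continuous (c t).
Hypothesis bd_closed : closed [set z : Y n * E n | bd z.1 z.2].
Hypothesis bd_act : forall g y e, bd y e -> bd (gact g y) (gact g e).
Hypothesis bd_c : forall y e j (t : delta (all_dim j) n), T t -> bd y e ->
  c t y = emb E n e j t.
Hypothesis bd_r : forall y (w : hull E n),
  (forall j (t : delta (all_dim j) n), T t -> w j t = c t y) -> bd y (r n (v n y, w)).
Hypothesis forced_closed : closed [set z : Y n * E n | forced z.1 z.2].
Hypothesis forced_act : forall g y e, forced y e -> forced (gact g y) (gact g e).
Hypothesis forced_unique : forall y e e', forced y e -> forced y e' -> e = e'.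
Hypothesis forced_p : forall y e, forced y e -> p n e = v n y.
Hypothesis forced_bd : forall y e, forced y e -> bd y e.
Hypothesis forced_u : forall x, forced (f n x) (u n x).

(** The equivariant section theorem, applied to the values lying over [v] with
    boundary condition [bd]. The coordinates [c] encode that condition: filling
    in the others and applying the retraction [r] completes arbitrary
    coordinates to those of such a value. *)
Lemma level_lift : exists h : Y n -> E n, [/\ continuous h,
  forall g y, h (gact g y) = gact g (h y), forall y, p n (h y) = v n y,
  forall y, bd y (h y) & forall y e, forced y e -> h y = e].
Proof.
pose A : profiniteType := (Y n * cube (E n))%type.
pose R (a : A) e := [/\ p n e = v n a.1, bd a.1 e & code e = a.2].
have c1 : continuous (fun z : A * E n => z.1.1).
  by apply: (@comp_continuous _ _ _ fst (fun a : A => a.1)); exact: fst_continuous.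
have c2 : continuous (fun z : A * E n => z.1.2).
  by apply: (@comp_continuous _ _ _ fst (fun a : A => a.2));
    [exact: fst_continuous|exact: snd_continuous].
have [||||w [cw wT wR]] := @partial_coordinates E n A R _ _ T (fun j t a => c t a.1).
- have -> : [set z : A * E n | R z.1 z.2] = [set z : A * E n | p n z.2 = v n z.1.1] `&`
      ([set z : A * E n | bd z.1.1 z.2] `&` [set z : A * E n | code z.2 = z.1.2]).
    by apply/seteqP; split=> z [] //= ? [].
  apply: closedI; last apply: closedI.
  + apply: closed_eq; first exact: profinite_hausdorff.
      apply: (@comp_continuous _ _ _ snd (p n)); [exact: snd_continuous|exact: pmap_continuous].
    by apply: (@comp_continuous _ _ _ (fun z : A * E n => z.1.1) (v n)) => //; exact: pmap_continuous.
  + apply: (@closed_preimage _ _ (fun z : A * E n => (z.1.1, z.2)) [set z | bd z.1 z.2]) => //.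
    by apply: pair_continuous => //; exact: snd_continuous.
  + apply: closed_eq; first exact: profinite_hausdorff.
      by apply: (@comp_continuous _ _ _ snd (@code _)); [exact: snd_continuous|exact: code_continuous].
    exact: c2.
- by move=> a e e' [_ _ ae] [_ _ ae']; apply: code_inj; rewrite ae.
- move=> j t Tt; apply: (@comp_continuous _ _ _ (fun a : A => a.1) (c t)).
    exact: fst_continuous.
  exact: c_continuous.
- by move=> a e j t Tt [_ be _]; exact: bd_c.
have [|||||||||h [ch h1 h2 h3]] := @equivariant_lifting G (level Y n) (level E n)
  (fun y e => p n e = v n y /\ bd y e) forced (fun q => r n (v n q.1, w q)).
- move=> g y e [pe be]; split; last exact: bd_act.
  by rewrite /= gmap_equivariant pe gmap_equivariant.
- exact: forced_act.
- by move=> y e fe; split; [exact: forced_p|exact: forced_bd].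
- exact: forced_unique.
- exact: forced_closed.
- apply: (@comp_continuous _ _ _ (fun q : A => (v n q.1, w q)) (r n)).
    apply: pair_continuous => //.
    by apply: (@comp_continuous _ _ _ fst (v n)); [exact: fst_continuous|exact: pmap_continuous].
  exact: (@pmap_continuous _ _ r n).
- move=> y k; split; first by rewrite p_r.
  by apply: bd_r => j t Tt; rewrite wT.
- by move=> y e [pe be] /=; rewrite -pe (wR _ e) //; split.
- move=> y; have [[x _ <-]|ny] := pselect (range (f n) y).
    by right; exists (u n x).
  by left=> g; apply: f_free ny g.
by exists h; split=> // y; case: (h2 y).
Qed.
End Level.

(** Compatibility with the endomaps of the simplex of dimension [n] is what the
    next level requires from this one: it implies that the values demanded on
    the boundary and on degenerate simplices are consistent. *)
Definition good n (h : Y n -> E n) := [/\ continuous h,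
  forall g y, h (gact g y) = gact g (h y), forall y, p n (h y) = v n y,
  forall x, h (f n x) = u n x & forall (s : delta n n) y, h (smap s y) = smap s (h y)].

Lemma range_closed n : closed [set z : Y n * E n | exists x, f n x = z.1 /\ u n x = z.2].
Proof.
have -> : [set z : Y n * E n | exists x, f n x = z.1 /\ u n x = z.2] =
    [set z | exists x, [set q : (Y n * E n) * X n | f n q.2 = q.1.1 /\ u n q.2 = q.1.2] (z, x)].
  by [].
apply: closed_proj1; first exact: profinite_compact.
apply: closedI; (apply: closed_eq; first exact: profinite_hausdorff).
- by apply: (@comp_continuous _ _ _ snd (f n)); [exact: snd_continuous|exact: pmap_continuous].
- by apply: (@comp_continuous _ _ _ fst fst); exact: fst_continuous.
- by apply: (@comp_continuous _ _ _ snd (u n)); [exact: snd_continuous|exact: pmap_continuous].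
- by apply: (@comp_continuous _ _ _ fst snd); [exact: fst_continuous|exact: snd_continuous].
Qed.

Lemma level0_lift : exists h, good (n := 0) h.
Proof.
have [|||||||||||h [h1 h2 h3 _ h5]] := @level_lift 0 (fun _ _ => False)
  (fun _ _ _ => false) (fun _ _ => True)
  (fun y e => exists x, f 0 x = y /\ u 0 x = e).
- by [].
- by rewrite (_ : [set z | True] = setT); [exact: closedT|apply/seteqP; split].
- by [].
- by [].
- by [].
- exact: range_closed.
- by move=> g _ _ [x [<- <-]]; exists (gact g x); rewrite !gmap_equivariant.
- by move=> y e e' [x [<- <-]] [x' [/f_mono -> <-]].
- by move=> y e [x [<- <-]].
- by [].
- by move=> x; exists x.
exists h; split=> // [x|s y]; first by apply: h5; exists x.
by rewrite !smap_idE // => i; rewrite (ord1 i) (ord1 (s _)).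
Qed.

Section NextLevel.
Variables (n : nat) (h : Y n -> E n).
Hypothesis h_good : good h.

Lemma h_cont : continuous h. Proof. by case: h_good. Qed.
Lemma h_act g y : h (gact g y) = gact g (h y). Proof. by case: h_good. Qed.
Lemma p_h y : p n (h y) = v n y. Proof. by case: h_good. Qed.
Lemma h_f x : h (f n x) = u n x. Proof. by case: h_good. Qed.
Lemma h_smap (s : delta n n) y : h (smap s y) = smap s (h y). Proof. by case: h_good. Qed.

(** When [t] misses [i] and [j], the two expressions are the restrictions along
    [t] of the lift that the [i]-th and the [j]-th face demand. Both are equal to
    the one obtained from the quasi-inverse of [t], by naturality with respect to
    endomaps of the simplex of dimension [n]. *)
Lemma missed_independent l (t : delta l n.+1) (i j : 'I_n.+2) (y : Y n.+1) :
  misses i t -> misses j t ->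
  smap (delta_comp (codeg i) t) (h (face i y)) = smap (delta_comp (codeg j) t) (h (face j y)).
Proof.
move=> ti tj.
have key (k : 'I_n.+2) : misses k t ->
    smap (delta_comp (codeg k) t) (h (face k y)) =
    smap (delta_comp (codeg i) t) (h (smap (delta_comp (delta_comp t (qinv t)) (coface i)) y)).
  move=> tk; pose ka : delta n n :=
    delta_comp (delta_comp (codeg k) t) (delta_comp (qinv t) (coface i)).
  have -> : smap (delta_comp (delta_comp t (qinv t)) (coface i)) y = smap ka (face k y).
    apply: esym; apply: smap_compE => x.
    by rewrite !delta_compE codegK //; exact: tk.
  rewrite h_smap; apply: esym; apply: smap_compE => x.
  rewrite !delta_compE.
  have -> : coface i (codeg i (t x)) = t x by apply: val_inj; exact: codegK (ti x).
  by rewrite qinvK.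
by rewrite (key i) // (key j).
Qed.

Definition degenerate_value (y : Y n.+1) (e : E n.+1) (i : 'I_n.+2) :=
  y = smap (codeg i) (face i y) /\ e = smap (codeg i) (h (face i y)).

Definition next_bd (y : Y n.+1) (e : E n.+1) := forall i, face i e = h (face i y).
Definition next_forced (y : Y n.+1) (e : E n.+1) :=
  (exists x, f n.+1 x = y /\ u n.+1 x = e) \/
  (exists i : 'I_n.+2, (i <= n)%N /\ degenerate_value y e i).

Definition next_coord (j : all_coords E) (t : delta (all_dim j) n.+1) (y : Y n.+1) :
    finite_space bool :=
  if pselect (exists i, misses i t) is left H then
    let i := sval (cid H) in emb E n (h (face i y)) j (delta_comp (codeg i) t)
  else false.

Lemma next_coordE (j : all_coords E) (t : delta (all_dim j) n.+1) y i : misses i t ->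
  next_coord t y = emb E n (h (face i y)) j (delta_comp (codeg i) t).
Proof.
move=> ti; rewrite /next_coord; case: pselect => [H|[]]; last by exists i.
case: (cid H) => k tk /=; rewrite -[LHS]/(emb E n (h (face k y)) j _) !embE.
by rewrite (missed_independent _ tk ti).
Qed.

Lemma next_coord_continuous (j : all_coords E) (t : delta (all_dim j) n.+1) :
  (exists i, misses i t) -> continuous (next_coord t).
Proof.
move=> [i ti]; have -> : next_coord t =
    (fun y => emb E n (h (face i y)) j (delta_comp (codeg i) t)).
  by apply: funext => y; exact: next_coordE.
apply: (@comp_continuous _ _ _ (fun y => h (face i y)) (fun e => emb E n e j _)).
  apply: (@comp_continuous _ _ _ (face i) h); [exact: smap_continuous|exact: h_cont].
apply: (@comp_continuous _ _ _ (emb E n) (fun w : hull E n => w j _)).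
  exact: pmap_continuous.
exact: cofree_eval_continuous.
Qed.

Lemma next_bd_coord y e (j : all_coords E) (t : delta (all_dim j) n.+1) :
  (exists i, misses i t) -> next_bd y e -> next_coord t y = emb E n.+1 e j t.
Proof.
by move=> [i ti] ye; rewrite (next_coordE _ ti) -ye !embE (smap_misses _ ti).
Qed.

Lemma misses_coface i l (s : delta l n) : misses i (delta_comp (coface i) s).
Proof. by move=> x /= /esym/eqP; rewrite (negbTE (neq_bump i (s x))). Qed.

Lemma next_bd_r y (w : hull E n.+1) :
  (forall j (t : delta (all_dim j) n.+1), (exists i, misses i t) -> w j t = next_coord t y) ->
  next_bd y (r n.+1 (v n.+1 y, w)).
Proof.
move=> wE i; rewrite /face -pmap_natural -/(face i y) prod_smapE.
rewrite -[RHS]r_emb p_h /face pmap_natural; congr (r n (_, _)).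
apply: cofree_ext => j s; rewrite -[LHS]/(w j (delta_comp (coface i) s)) wE; last by exists i; exact: misses_coface.
rewrite (next_coordE _ (i := i)); last exact: misses_coface.
rewrite /face; congr (emb E n _ j _); apply: delta_eqP => x.
by rewrite !delta_compE cofaceK.
Qed.

(** For [i < j], a simplex degenerate at [i] is invariant under the idempotent
    that raises the vertex [i], one degenerate at [j] under the idempotent that
    lowers the vertex [j + 1], and these idempotents commute. On simplices with
    the same faces they also take the same values. *)
Lemma degenerate_unique y e e' (i j : 'I_n.+2) : (i <= n)%N -> (j <= n)%N ->
  next_bd y e -> next_bd y e' -> e = smap (codeg i) (face i e) ->
  e' = smap (codeg j) (face j e') -> e = e'.
Proof.
wlog ij : e e' i j / (i <= j)%N => [H|].
  by case/orP: (leq_total i j) => ij lin ljn *; [exact: (H e e' i j)|exact/esym/(H e' e j i)].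
move=> lin ljn be be' ei ej.
have fe k : face k e = face k e' by rewrite be be'.
have [eij|nij] := eqVneq i j; first by rewrite ei ej -eij fe.
(* the other section of the codegeneracy at j *)
pose j1 : 'I_n.+2 := inord j.+1.
have j1E : j1 = j.+1 :> nat by rewrite inordK; lia.
have ej1 (k : E n.+1) z : k = smap (codeg j) z -> k = smap (codeg j) (face j1 k).
  move=> ->; rewrite /face -!smap_comp; congr (smap _ z); apply: delta_eqP => x.
  by rewrite !(delta_compE, codegE, cofaceE) j1E /bump /unbump; case: x => x /= x2; lia.
have eE : e = smap (codeg i) (face i e') by rewrite {1}ei fe.
have e'E : e' = smap (codeg j) (face j1 e) by rewrite {1}(ej1 _ _ ej) fe.
have {}e'E : e' = smap (delta_comp (delta_comp (coface i) (codeg i)) (delta_comp (coface j1) (codeg j))) e'.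
  by rewrite {1}e'E eE /face -!smap_comp; congr (smap _ e'); exact: delta_eqP.
rewrite eE [RHS]e'E {1}(ej1 _ _ ej) /face -!smap_comp; congr (smap _ e').
apply: delta_eqP => x; rewrite !(delta_compE, codegE, cofaceE) j1E -!/(bump _ _).
have ni : (i : nat) <> j by move/val_inj/eqP; rewrite (negbTE nij).
have upE z : (z <= n.+1)%N -> bump i (minn n (unbump i z)) = if z == i then i.+1 else z.
  by move=> zn; rewrite /bump /unbump; case: eqP; lia.
have downE z : (z <= n.+1)%N -> bump j.+1 (minn n (unbump j z)) = if z == j.+1 then j : nat else z.
  by move=> zn; rewrite /bump /unbump; case: eqP; lia.
have xn : (x <= n.+1)%N by rewrite -ltnS.
rewrite (upE x) // (downE x) // upE; last by case: eqP; lia.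
rewrite downE; last by case: eqP; lia.
by case: (@eqP _ (x : nat) i) => xi; case: (@eqP _ (x : nat) j.+1) => xj;
  do ?[case: eqP => ?]; lia.
Qed.
End NextLevel.

Section NextLevelLift.
Variables (n : nat) (h : Y n -> E n).
Hypothesis h_good : good h.

Lemma next_forced_p y e : next_forced h y e -> p n.+1 e = v n.+1 y.
Proof.
move=> [[x [<- <-]] //|[i [_ [yE ->]]]].
by rewrite pmap_natural p_h // {2}yE /face !pmap_natural.
Qed.

Lemma next_forced_bd y e : next_forced h y e -> next_bd h y e.
Proof.
move=> [[x [<- <-]] k|[i [_ [yE ->]]] k].
  by rewrite /face -!pmap_natural h_f.
rewrite /face in yE *; rewrite {2}yE.
have E1 (W : pspace) (z : W n) : smap (coface k) (smap (codeg i) z) =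
    smap (delta_comp (codeg i) (coface k)) z by rewrite smap_comp.
by rewrite !E1 h_smap.
Qed.

(** If [f x] is degenerate, then so is [x], because [f] is injective; two
    degenerate descriptions agree because the prescribed values have the same
    faces. *)
Lemma next_forced_unique y e e' : next_forced h y e -> next_forced h y e' -> e = e'.
Proof.
have mixed x e0 i : degenerate_value h (f n.+1 x) e0 i -> u n.+1 x = e0.
  move=> [xE ->]; rewrite -/(face i _) /face -pmap_natural (h_f h_good) -pmap_natural.
  congr (u n.+1 _); apply: (f_mono (n := n.+1)).
  by rewrite {1}xE /face !pmap_natural.
move=> F F'; have be := next_forced_bd F; have be' := next_forced_bd F'.
case: F F' => [[x [yx <-]]|[i [lin Di]]] [[x' [yx' <-]]|[j [ljn Dj]]].
- by congr (u n.+1 _); apply: (f_mono (n := n.+1)); rewrite yx.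
- by apply: (mixed _ _ j); rewrite yx.
- by apply/esym/(mixed _ _ i); rewrite yx'.
- apply: (degenerate_unique (h := h) (y := y) (i := i) (j := j)) => //.
    by rewrite be; case: Di.
  by rewrite be'; case: Dj.
Qed.

Lemma next_forced_closed : closed [set z : Y n.+1 * E n.+1 | next_forced h z.1 z.2].
Proof.
apply: closedU; first exact: range_closed.
apply: finite_closed_exists => i; have [lin|lin] := boolP (i <= n)%N; last first.
  by rewrite (_ : (fun _ => _) = set0); [exact: closed0|apply/seteqP; split=> z []].
rewrite (_ : (fun _ => _) = [set z : Y n.+1 * E n.+1 | z.1 = smap (codeg i) (face i z.1)] `&`
    [set z | z.2 = smap (codeg i) (h (face i z.1))]); last first.
  by apply/seteqP; split=> z; [case=> _ []|case].
have c1 : continuous (fun z : Y n.+1 * E n.+1 => face i z.1).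
  apply: (@comp_continuous _ _ _ fst (face i)); [exact: fst_continuous|exact: smap_continuous].
apply: closedI; apply: closed_eq; try exact: profinite_hausdorff.
- exact: fst_continuous.
- apply: (@comp_continuous _ _ _ _ (smap (codeg i))) c1 _; exact: smap_continuous.
- exact: snd_continuous.
- apply: (@comp_continuous _ _ _ (fun z => h (face i z.1)) (smap (codeg i))).
    by apply: (@comp_continuous _ _ _ _ h) c1 _; case: h_good.
  exact: smap_continuous.
Qed.

Lemma next_lift : exists h' : Y n.+1 -> E n.+1, [/\ good h',
  forall i y, h (face i y) = face i (h' y) &
  forall i y, h' (smap (codeg i) y) = smap (codeg i) (h y)].
Proof.
have [|||||||||||h' [h1 h2 h3 h4 h5]] := @level_lift n.+1 (fun _ t => exists i, misses i t)
  (next_coord h) (next_bd h) (next_forced h).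
- move=> j t; exact: next_coord_continuous.
- rewrite (_ : [set z | _] = \bigcap_(i in setT)
      [set z : Y n.+1 * E n.+1 | face i z.2 = h (face i z.1)]); last first.
    by apply/seteqP; split=> [z zP i _|z zP i]; [exact: zP|exact: (zP i Logic.I)].
  apply: closed_bigI => i _; apply: closed_eq; first exact: profinite_hausdorff.
    by apply: (@comp_continuous _ _ _ snd (face i)); [exact: snd_continuous|exact: smap_continuous].
  apply: (@comp_continuous _ _ _ (fun z => face i z.1) h); last by case: h_good.
  by apply: (@comp_continuous _ _ _ fst (face i)); [exact: fst_continuous|exact: smap_continuous].
- by move=> g y e ye i; rewrite /face !gact_natural (h_act h_good) -/(face i e) ye.
- by move=> y e j t Tt; exact: next_bd_coord.
- exact: next_bd_r.
- exact: next_forced_closed.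
- move=> g y e [[x [<- <-]]|[i [lin [yE eE]]]].
    by left; exists (gact g x); rewrite !gmap_equivariant.
  right; exists i; split=> //; split.
    by rewrite /face !gact_natural {1}yE.
  by rewrite /face gact_natural (h_act h_good) gact_natural eE.
- exact: next_forced_unique.
- exact: next_forced_p.
- exact: next_forced_bd.
- by move=> x; left; exists x.
have h_deg (i : 'I_n.+2) y : h' (smap (codeg i) y) = smap (codeg i) (h y).
  wlog lin : i / (i <= n)%N => [H|].
    have [lin|lin] := boolP (i <= n)%N; first exact: H.
    have -> : codeg i = codeg (inord n : 'I_n.+2).
      apply: delta_eqP => x; rewrite !codegE /unbump inordK //.
      by have := ltn_ord i; have := ltn_ord x; lia.
    by apply: H; rewrite inordK.
  have fy (W : pspace) (z : W n) : face i (smap (codeg i) z) = z.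
    rewrite /face -smap_comp; apply: smap_idE => x; exact: cofaceK.
  apply: h5; right; exists i; split=> //; split; by rewrite fy.
exists h'; split=> // [|i y]; last by rewrite h4.
split=> // [x|s y]; first by apply: h5; left; exists x.
have [[i si]|sE] := endo_cases s; last by rewrite !smap_idE.
have [j] := short_collapses (delta_comp (codeg i) s) (leqnn _).
move=> /collapses_at cj; rewrite !(smap_misses _ si) !(smap_collapses _ cj).
by rewrite h_deg (h_smap h_good) h4.
Qed.
End NextLevelLift.

(** The lift is built one level at a time. Each level extends the previous one
    along faces and degeneracies, which gives naturality. *)
Lemma equivariant_lift : exists h : gmap Y E,
  (forall n x, h n (f n x) = u n x) /\ (forall n y, p n (h n y) = v n y).
Proof.
have step n (h : {h : Y n -> E n | good h}) : exists h' : {h' : Y n.+1 -> E n.+1 | good h'},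
    (forall i y, sval h (face i y) = face i (sval h' y)) /\
    (forall i y, sval h' (smap (codeg i) y) = smap (codeg i) (sval h y)).
  by have [h' [gh' hf hd]] := next_lift (svalP h); exists (exist _ h' gh').
have [s sP] := dependent_choice (fun n => dependent_choice (step n)).
have [h0 gh0] := level0_lift.
pose hh := nat_rect (fun n => {h : Y n -> E n | good h}) (exist _ h0 gh0) (fun n => s n).
have hf n (i : 'I_n.+2) y : sval (hh n) (face i y) = face i (sval (hh n.+1) y).
  by case: (sP n (hh n)).
have hd n (i : 'I_n.+2) y : sval (hh n.+1) (smap (codeg i) y) = smap (codeg i) (sval (hh n) y).
  by case: (sP n (hh n)).
have hn := natural_of_generators hf hd.
have hc n : continuous (sval (hh n)) by case: (svalP (hh n)).
have he n g (y : Y n) : sval (hh n) (gact g y) = gact g (sval (hh n) y).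
  by case: (svalP (hh n)).
exists (@GMap G Y E (PMap hc hn) he); split=> n y /=; by case: (svalP (hh n)).
Qed.
End Lifting.

Theorem free_mono_cofibration (G : profiniteGroupType) (X Y : gspace G) (f : gmap X Y) :
  levelwise_mono f -> (forall n, acts_freely_on (~` range (f n))) -> g_cofibration f.
Proof.
move=> f_mono f_free E Z p fp wp u v pu.
have [r [r_emb p_r]] := trivial_fibration_retract fp wp.
exact: (equivariant_lift f_mono f_free pu r_emb p_r).
Qed.

(** * Test objects *)

Lemma cofree_projection_fibration (A : pspace) (J : Type) (dim : J -> nat)
    (S : J -> profiniteType) :
  (forall j, absolute_extensor (S j)) -> fibration (prod_fst A (cofree dim S)).
Proof.
move=> aeS B D i im _ u v uv.
have [w wE] := cofree_lift (pmap_comp (prod_snd _ _) u) im aeS.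
exists (pair_pmap v w); split=> // n a; rewrite /= wE -uv /= /pmap_comp_fun.
by case: (u n a).
Qed.

Definition to_point (X : pspace) : pmap X point_pspace :=
  @PMap X point_pspace (fun n _ => tt) (fun n => @cst_continuous _ _ _)
    (fun _ _ _ _ => erefl).

(** Trivial fibrations for testing cofibrations: finite [G]-sets [S] and [Q]
    give rise to cofree objects, and the action on the total space may be twisted,
    in that the action on [Q] depends on a point of [S]. *)
Section TestObject.
Variables (G : profiniteGroupType) (n : nat) (S Q : finType).
Variables (b : G -> S -> S) (a : G -> S -> Q -> Q).
Hypothesis b1 : forall s, b 1%g s = s.
Hypothesis bM : forall g h s, b (g * h)%g s = b g (b h s).
Hypothesis b_open : forall s g, nbhs g [set g' | b g' s = b g s].
Hypothesis a1 : forall s q, a 1%g s q = q.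
Hypothesis aM : forall g h s q, a (g * h)%g s q = a g (b h s) (a h s q).
Hypothesis a_open : forall s q g, nbhs g [set g' | a g' s q = a g s q].
Variables (s0 : S) (q0 : Q).

Local Notation WS := (cofree (fun _ : unit => n) (fun=> finite_space S)).
Local Notation WQ := (cofree (fun _ : unit => n) (fun=> finite_space Q)).
Definition test_base : pspace := prod_pspace point_pspace WS.
Definition test_total : pspace := prod_pspace test_base WQ.

Definition base_act m (g : G) (z : test_base m) : test_base m :=
  (z.1, (fun j t => b g (z.2 j t)) : WS m).
Definition total_act m (g : G) (z : test_total m) : test_total m :=
  (base_act g z.1, (fun j t => a g (z.1.2 j t) (z.2 j t)) : WQ m).

Lemma near_const (F : finType) (T : topologicalType) (c : T -> finite_space F) x :
  continuous c -> nbhs x [set y | c y = c x].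
Proof.
move=> cc; apply: (cc x [set s | s = c x]).
by apply: open_nbhs_nbhs; split=> //; exact: finite_space_open.
Qed.

Lemma to_finite_near (F : finType) (T : topologicalType) (c : T -> finite_space F) :
  (forall x, nbhs x [set y | c y = c x]) -> continuous c.
Proof. by move=> H x U Ux; apply: filterS (H x) => y /= ->; exact: nbhs_singleton. Qed.

Lemma base_coord_continuous m (j : unit) t :
  continuous (fun z : test_base m => z.2 j t : finite_space S).
Proof.
apply: (@comp_continuous _ _ _ snd (fun w : WS m => w j t)); first exact: snd_continuous.
exact: cofree_eval_continuous.
Qed.

Lemma base_act_continuous m : continuous (fun z : G * test_base m => base_act z.1 z.2).
Proof.
apply: pair_continuous.
  by apply: (@comp_continuous _ _ _ snd fst); [exact: snd_continuous|exact: fst_continuous].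
apply: cofree_continuous => j t; apply: to_finite_near => z.
have n1 : nbhs z [set z' : G * test_base m | b z'.1 (z.2.2 j t) = b z.1 (z.2.2 j t)].
  exact: (@fst_continuous _ _ z _ (b_open (z.2.2 j t) z.1)).
have n2 : nbhs z [set z' : G * test_base m | z'.2.2 j t = z.2.2 j t].
  apply: (@near_const S _ (fun z' : G * test_base m => z'.2.2 j t)).
  by apply: (@comp_continuous _ _ _ snd (fun z' : test_base m => z'.2 j t));
    [exact: snd_continuous|exact: base_coord_continuous].
by apply: filterS (filterI n1 n2) => z' [/= <- ->].
Qed.

Lemma total_act_continuous m : continuous (fun z : G * test_total m => total_act z.1 z.2).
Proof.
apply: pair_continuous.
  apply: (@comp_continuous _ _ _ (fun z : G * test_total m => (z.1, z.2.1))
    (fun z : G * test_base m => base_act z.1 z.2)); last exact: base_act_continuous.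
  apply: pair_continuous; first exact: fst_continuous.
  by apply: (@comp_continuous _ _ _ snd fst); [exact: snd_continuous|exact: fst_continuous].
apply: cofree_continuous => j t; apply: to_finite_near => z.
have n1 : nbhs z [set z' : G * test_total m |
    a z'.1 (z.2.1.2 j t) (z.2.2 j t) = a z.1 (z.2.1.2 j t) (z.2.2 j t)].
  exact: (@fst_continuous _ _ z _ (a_open (z.2.1.2 j t) (z.2.2 j t) z.1)).
have n2 : nbhs z [set z' : G * test_total m | z'.2.1.2 j t = z.2.1.2 j t].
  apply: (@near_const S _ (fun z' : G * test_total m => z'.2.1.2 j t)).
  apply: (@comp_continuous _ _ _ snd (fun z' : test_total m => z'.1.2 j t)).
    exact: snd_continuous.
  by apply: (@comp_continuous _ _ _ fst (fun z' : test_base m => z'.2 j t));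
    [exact: fst_continuous|exact: base_coord_continuous].
have n3 : nbhs z [set z' : G * test_total m | z'.2.2 j t = z.2.2 j t].
  apply: (@near_const Q _ (fun z' : G * test_total m => z'.2.2 j t)).
  apply: (@comp_continuous _ _ _ snd (fun z' : test_total m => z'.2 j t)).
    exact: snd_continuous.
  by apply: (@comp_continuous _ _ _ snd (fun w : WQ m => w j t));
    [exact: snd_continuous|exact: cofree_eval_continuous].
by apply: filterS (filterI n1 (filterI n2 n3)) => z' [/= <- [-> ->]].
Qed.

Lemma base_act1 m (z : test_base m) : base_act 1%g z = z.
Proof. by case: z => z w; congr (_, _); apply: cofree_ext => j t; rewrite b1. Qed.
Lemma base_actM m g h (z : test_base m) : base_act (g * h)%g z = base_act g (base_act h z).
Proof. by case: z => z w; congr (_, _); apply: cofree_ext => j t; rewrite bM. Qed.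
Lemma base_act_natural l m (t : delta l m) g (z : test_base m) :
  smap t (base_act g z) = base_act g (smap t z).
Proof. by []. Qed.

Lemma total_act1 m (z : test_total m) : total_act 1%g z = z.
Proof.
case: z => z w; rewrite /total_act /= base_act1; congr (_, _).
by apply: cofree_ext => j t; rewrite a1.
Qed.
Lemma total_actM m g h (z : test_total m) :
  total_act (g * h)%g z = total_act g (total_act h z).
Proof.
case: z => z w; rewrite /total_act /= base_actM; congr (_, _).
by apply: cofree_ext => j t; rewrite aM.
Qed.
Lemma total_act_natural l m (t : delta l m) g (z : test_total m) :
  smap t (total_act g z) = total_act g (smap t z).
Proof. by []. Qed.

Definition base_gspace : gspace G :=
  GSpace base_act_continuous base_act1 base_actM base_act_natural.
Definition total_gspace : gspace G :=
  GSpace total_act_continuous total_act1 total_actM total_act_natural.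

Definition test_map : gmap total_gspace base_gspace :=
  @GMap G total_gspace base_gspace (prod_fst test_base WQ) (fun _ _ _ => erefl).

(** By adjunction, lifting against the test fibration extends a twisted
    equivariant function on the [n]-simplices. *)
Lemma cofibration_extends (X Y : gspace G) (f : gmap X Y) (phi : Y n -> finite_space S)
    (psi : X n -> finite_space Q) :
  g_cofibration f -> continuous phi -> continuous psi ->
  (forall g y, phi (gact g y) = b g (phi y)) ->
  (forall g x, psi (gact g x) = a g (phi (f n x)) (psi x)) ->
  exists psi' : Y n -> Q, (forall x, psi' (f n x) = psi x) /\
    forall g y, psi' (gact g y) = a g (phi y) (psi' y).
Proof.
move=> cof c_phi c_psi phi_act psi_act.
have fib : g_fibration test_map.
  apply: cofree_projection_fibration => _; exact: (finite_absolute_extensor q0).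
have we : g_weak_equivalence test_map.
  by apply: contractible_projection; [exact: (fun _ _ => s0)|exact: (fun _ _ => q0)].
pose v := pair_pmap (to_point Y) (to_cofree (J := unit) (dim := fun=> n) (fun _ => c_phi)).
pose u := pair_pmap (pmap_comp v f)
  (to_cofree (J := unit) (dim := fun=> n) (fun _ => c_psi)).
have v_act m g (y : Y m) : v m (gact g y) = base_act g (v m y).
  congr (_, _); apply: cofree_ext => j t.
  by rewrite /= /to_cofree_fun gact_natural phi_act.
have u_act m g (x : X m) : u m (gact g x) = total_act g (u m x).
  rewrite /total_act; congr (_, _).
    transitivity (v m (gact g (f m x))); last exact: v_act.
    by rewrite -gmap_equivariant.
  apply: cofree_ext => j t.
  by rewrite /= /to_cofree_fun gact_natural psi_act /pmap_comp_fun pmap_natural.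
have [|h [hf ph]] := cof _ _ _ fib we (@GMap G X total_gspace u u_act)
    (@GMap G Y base_gspace v v_act).
  by [].
exists (fun y => (h n y).2 tt (delta_id n)); split=> [x|g y].
  by rewrite hf /= /to_cofree_fun smap_id.
rewrite gmap_equivariant /=; congr (a g _ _).
have := ph n y => /= ->; by rewrite /= /to_cofree_fun smap_id.
Qed.
End TestObject.

(** * Finite quotients of profinite G-sets *)

Section FiniteQuotient.
Variables (G : profiniteGroupType) (Y : gset G) (C : set Y).
Hypothesis cC : clopen C.

(** A point is sent to the list of translates of [C] that contain it; only
    finitely many translates are distinct. *)
Lemma finite_quotient : exists (Q : finType) (b : G -> Q -> Q) (phi : Y -> finite_space Q),
  [/\ (forall q, b 1%g q = q) /\ (forall g h q, b (g * h)%g q = b g (b h q)),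
    forall q g, nbhs g [set g' | b g' q = b g q], continuous phi,
    forall g y, phi (ga g y) = b g (phi y) &
    forall y y', phi y = phi y' -> C y -> C y'].
Proof.
have [s sP] := clopen_finite_orbit cC.
pose Q : finType := {ffun 'I_(size s) -> bool}.
pose phi (y : Y) : Q := [ffun i => `[< C (ga (tnth (in_tuple s) i) y) >]].
have phi_eq y y' : phi y = phi y' -> forall g, C (ga g y) <-> C (ga g y').
  move=> yy g; have [h hs hP] := sP g; rewrite !hP.
  have [i hi] : exists i : 'I_(size s), tnth (in_tuple s) i = h.
    by have /tnthP [i ->] : h \in in_tuple s by []; exists i.
  have := congr1 (fun q : Q => q i) yy; rewrite !ffunE hi => E.
  by split=> H; apply/asboolP; [rewrite -E|rewrite E]; exact/asboolP.
pose b g (q : Q) : Q := if pselect (exists y, phi y = q) is left H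
  then phi (ga g (sval (cid H))) else q.
have bE g y : b g (phi y) = phi (ga g y).
  rewrite /b; case: pselect => [H|[]]; last by exists y.
  case: (cid H) => y' /= /phi_eq yy; apply/ffunP => i; rewrite !ffunE -!gaM.
  by apply/asboolP/asboolP => /yy.
have bN g q : ~ (exists y, phi y = q) -> b g q = q by rewrite /b; case: pselect.
have c_phi : continuous (phi : Y -> finite_space Q).
  apply: to_finite_near => y.
  have : nbhs y [set y' | forall i : 'I_(size s),
      C (ga (tnth (in_tuple s) i) y') <-> C (ga (tnth (in_tuple s) i) y)].
    apply: finite_open_forall => i.
    exact: (@ga_continuous_r G Y _ y _ (clopen_near _ cC)).
  apply: filterS => y' H; apply/ffunP => i; rewrite !ffunE.
  by apply/asboolP/asboolP => /H.
exists Q, b, phi; split=> //.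
- split=> [q|g h q]; have [[y <-]|nq] := pselect (exists y, phi y = q).
  + by rewrite bE ga1.
  + by rewrite bN.
  + by rewrite !bE gaM.
  + by rewrite !bN.
- move=> q g; have [[y <-]|nq] := pselect (exists y, phi y = q); last first.
    by apply: filterS filterT => g' _ /=; rewrite !bN.
  rewrite (_ : [set g' | _] = [set g' | phi (ga g' y) = phi (ga g y)]); last first.
    by apply/seteqP; split=> g' /=; rewrite !bE.
  apply: (@near_const Q _ (fun g' => phi (ga g' y))).
  by apply: (@comp_continuous _ _ _ (fun g' => ga g' y) (phi : Y -> finite_space Q)) => //; exact: ga_continuous_l.
- by move=> y y' /phi_eq /(_ 1%g); rewrite !ga1 => -[].
Qed.
End FiniteQuotient.

Section Necessity.
Variables (G : profiniteGroupType) (X Y : gspace G) (f : gmap X Y).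
Hypothesis cof : g_cofibration f.

(** A finite quotient of [X n] that separates two points extends along [f]. *)
Lemma cofibration_mono : levelwise_mono f.
Proof.
move=> n x x' fx; apply: contrapT => /clopen_points [C [cC Cx nCx']].
have [Q [b [phi [[b1 bM] b_near c_phi phi_act phiC]]]] := @finite_quotient G (level X n) C cC.
have [||||||||||psi [psif _]] := @cofibration_extends G n unit Q (fun _ s => s) (fun g _ => b g)
  _ _ _ _ _ _ tt (phi x) X Y f (fun _ => tt) phi cof.
- by [].
- by [].
- by move=> s g; apply: filterS filterT.
- by move=> _; exact: b1.
- by move=> g h _; exact: bM.
- by move=> _; exact: b_near.
- exact: cst_continuous.
- exact: c_phi.
- by [].
- by move=> g y; exact: phi_act.
by apply: nCx'; apply: phiC Cx; rewrite -!psif fx.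
Qed.

Definition regular : gset G :=
  GSet (@mulg_continuous G) (@mul1g G) (fun g h y => esym (mulgA g h y)).

(** Suppose that [g <> 1] fixes a point [y] outside the image. The orbit of a
    small clopen neighbourhood of [y] misses the image, and [phi] is its indicator
    function. Twist the action so that [G] permutes a finite quotient [Q] of
    itself on which [g] acts nontrivially where [phi] is true, and acts trivially
    elsewhere. The constant function [1] on [X n] extends, but no permutation of
    [Q] is fixed by [g]. *)
Lemma cofibration_free n : acts_freely_on (~` range (f n)).
Proof.
move=> y ny g gy; apply: contrapT => g1.
have cf : closed (range (f n)).
  apply: compact_closed; first exact: profinite_hausdorff.
  apply: continuous_compact; last exact: profinite_compact.
  by apply: continuous_subspaceT => x; exact: pmap_continuous.
have [C [cC Cy nC]] : exists C, [/\ clopen C, C y & C `<=` ~` range (f n)].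
  by apply: clopen_nbhs; apply: open_nbhs_nbhs; split=> //; exact: closed_openC.
have cO := @orbit_clopen G (level Y n) C cC.
pose O : set (Y n) := [set y' | exists h, C (gact h y')].
pose phi (y' : Y n) : finite_space bool := `[< O y' >].
have [D [cD D1 nDg]] := clopen_points (fun e : 1%g = g => g1 (esym e)).
have [Q [b [chi [[b1 bM] b_near c_chi chi_act chiD]]]] := @finite_quotient G regular D cD.
have b_inj h : injective (b h).
  by apply: (can_inj (g := b h^-1%g)) => q; rewrite -bM mulVg b1.
pose rho h : {perm Q} := perm (@b_inj h).
have rho1 : rho 1%g = 1%g by apply/permP => q; rewrite permE b1 perm1.
have rhoM h k : rho (h * k)%g = (rho k * rho h)%g.
  by apply/permP => q; rewrite permM !permE bM.
pose a h (s : bool) (q : {perm Q}) : {perm Q} := if s then (q * rho h)%g else q.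
have [||||||||||psi [psif psi_act]] := @cofibration_extends G n bool {perm Q}
  (fun _ s => s) a _ _ _ _ _ _ false 1%g X Y f phi (fun _ => 1%g) cof.
- by [].
- by [].
- by move=> s h; apply: filterS filterT.
- by move=> [] q; rewrite /a // rho1 mulg1.
- by move=> h k [] q; rewrite /a // rhoM mulgA.
- move=> s q h; have : nbhs h [set h' | forall x, b h' x = b h x].
    by apply: finite_open_forall => x; exact: b_near.
  apply: filterS => h' H; rewrite /= /a; case: s => //; congr (_ * _)%g.
  by apply/permP => x; rewrite !permE H.
- apply: to_finite_near => y'; apply: filterS (clopen_near y' cO) => z H.
  by apply/asboolP/asboolP => /H.
- exact: cst_continuous.
- move=> h y'; apply/asboolP/asboolP => -[k kC]; last first.
    by exists (k * h^-1)%g; rewrite -gactM -mulgA mulVg mulg1.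
  by exists (k * h)%g; rewrite gactM.
- move=> h x; suff -> : phi (f n x) = false by [].
  apply/asboolP => -[k /nC]; apply.
  by exists (gact k x) => //; rewrite gmap_equivariant.
have phi_y : phi y by apply/asboolP; exists 1%g; rewrite gact1.
have := psi_act g y; rewrite gy /a phi_y -[X in X = _]mulg1 => /mulgI rg.
apply: nDg; apply: (chiD 1%g) => //.
have -> : g = ga (g : G) (1%g : regular) by rewrite /= mulg1.
by rewrite chi_act -(permE (@b_inj g)) -/(rho g) -rg perm1.
Qed.
End Necessity.

Theorem corollary2p10 (G : profiniteGroupType) :
  (forall (X Y : gspace G) (f : gmap X Y),
     g_cofibration f <->
     levelwise_mono f /\
     (forall n : nat, acts_freely_on (~` range (f n)))) /\
  (forall X : gspace G,
     g_cofibrant X <-> (forall n : nat, acts_freely_on [set: X n])).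
Proof.
have main (X Y : gspace G) (f : gmap X Y) : g_cofibration f <->
    levelwise_mono f /\ (forall n : nat, acts_freely_on (~` range (f n))).
  split=> [cof|[]]; last exact: free_mono_cofibration.
  by split; [exact: cofibration_mono|exact: cofibration_free].
split=> // X.
have rE n : ~` range (from_empty X n) = [set: X n].
  by apply/seteqP; split=> // x _ [[]].
rewrite /g_cofibrant main; split=> [[_ free] n|free]; first by rewrite -rE.
by split=> [n []|n] //; rewrite rE.
Qed.
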